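(* Let $N\ge 0$ be an integer, let $\|A\|>0$ and $\Omega>0$, set $$m=\left\lceil \frac{\sqrt{2}\,\sigma^2\sigma_\omega\sqrt{N+1}}{\|A\|^2\Omega}\right\rceil ,$$ and let the smoothing parameter be $$\mu=\mu(N)=\frac{\|A\|^2\sqrt{(6-\sqrt{2})\,mD}}{\sqrt{2(N+1)\sigma_d\sigma_\omega}\,\sqrt{m\|A\|^2\Omega+\sqrt{2(N+1)}\,\sigma_\omega\sigma^2}} .$$ Apply the mini-batch stochastic Nesterov's smoothing algorithm (described in the context) with this $\mu$ and this batch size $m$ to the smooth problem $\min_{x\in X}\psi_\mu(x)$, for $k=0,\dots,N$, and put $$\widehat x=y_N\in X,\qquad \widehat u=\sum_{i=0}^{N}\frac{1}{N+1}\,u_\mu(x_i)\in U .$$ Then $$0\le E\left[\psi(\widehat x)-\phi(\widehat u)\right]\le \frac{2\|A\|\sqrt{(6-\sqrt2)D\Omega}}{\sqrt{(N+1)\sigma_d\sigma_\omega}}+\frac{(6-\sqrt2)L_fD}{(N+1)\sigma_d},$$ where the expectation is with respect to all the samples drawn by the algorithm. Consequently, for every $\epsilon>0$, the number of iterations needed to find an $\epsilon$-approximate solution of $\min_{x\in X}\psi(x)$ (in the sense $E[\psi(\widehat x)-\phi(\widehat u)]\le\epsilon$) does not exceed $$N+1=\left\lceil \frac{4(6-\sqrt2)D\Omega\|A\|^2}{\sigma_d\sigma_\omega}\cdot\frac1{\epsilon^2}+\frac{2(6-\sqrt2)L_fD}{\sigma_d}\cdot\frac1\epsilon\right\rceil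 .$$
   Context: Problem. $\|\cdot\|$ is the Euclidean norm (and $\|A\|$ the operator norm). $X\subset\mathbb{R}^n$ is nonempty, bounded, closed and convex; $f:X\to\mathbb{R}$ is convex with Lipschitz continuous gradient, with Lipschitz constant $L_f$; $U$ is a nonempty bounded closed convex set in a finite-dimensional Euclidean space; $A$ is a linear operator from $\mathbb{R}^n$ to that space; $Q$ is a continuous convex function on $U$. Put $h(x)=\max_{u\in U}\{\langle Ax,u\rangle-Q(u)\}$ and $\psi(x)=f(x)+h(x)$; the problem is $\min_{x\in X}\psi(x)$. The dual objective is $\phi(u)=\min_{x\in X}\{f(x)+\langle Ax,u\rangle-Q(u)\}$ for $u\in U$. Smoothing. $\omega$ is a nonnegative continuous function on $U$, strongly convex with parameter $\sigma_\omega>0$, with $\min_{u\in U}\omega(u)=0$; $\Omega=\max_{u\in U}\omega(u)$. For $\mu>0$, $h_\mu(x)=\max_{u\in U}\{\langle Ax,u\rangle-Q(u)-\mu\omega(u)\}$, $u_\mu(x)\in U$ denotes its unique maximizer, and $\psi_\mu=f+h_\mu$. It is known that $\nabla h_\mu(x)=A^Tu_\mu(x)$ is Lipschitz with constant $L_{h_\mu}=\|A\|^2/(\mu\sigma_\omega)$; put $L=L_f+L_{h_\mu}$. Prox-function. $d$ is continuous on $X$ and strongly convex with parameter $\sigma_d>0$, $x_0=\arg\min_{x\in X}d(x)$, $d(x_0)=0$, and $D>0$ is a constant with $\max_{x\in X}d(x)\le D$. Stochastic oracle. $\xi$ is a random vector. For $\mu>0$, $x\in X$, the oracle returns a stochastic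 value $\Psi_\mu(x,\xi)\in\mathbb{R}$ and a stochastic gradient $\nabla\Psi_\mu(x,\xi)\in\mathbb{R}^n$ such that, for a constant $\sigma>0$ and every $\mu>0$, $x\in X$: (a) $E[\Psi_\mu(x,\xi)]=\psi_\mu(x)$; (b) $E[\nabla\Psi_\mu(x,\xi)]=\nabla\psi_\mu(x)$; (c) $E[\|\nabla\Psi_\mu(x,\xi)-\nabla\psi_\mu(x)\|^2]\le\sigma^2$. Algorithm. Input: the point $x_0$ above, $N$, $\mu$, batch size $m\ge1$. For $k=0,1,\dots,N$: 1. Draw samples $\xi_{k,1},\dots,\xi_{k,m}$ that are independent copies of $\xi$, independent of all earlier samples, and set $\Psi_\mu^k=\frac1m\sum_{i=1}^m\Psi_\mu(x_k,\xi_{k,i})$, $\nabla\Psi_\mu^k=\frac1m\sum_{i=1}^m\nabla\Psi_\mu(x_k,\xi_{k,i})$. 2. $y_k=\arg\min_{y\in X}\left\{\langle\nabla\Psi_\mu^k,y-x_k\rangle+\frac{L\sqrt{k+1}}{2\sqrt2}\|y-x_k\|^2\right\}$. 3. $z_k=\arg\min_{x\in X}\left\{\frac{L}{\sigma_d}d(x)+\sum_{i=0}^k\frac12\left[\Psi_\mu^i+\langle\nabla\Psi_\mu^i,x-x_i\rangle\right]\right\}$. 4. $x_{k+1}=\frac1{k+2}z_k+\frac{k+1}{k+2}y_k$. Output: $y_N$. *)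

(* Defs.v *)
From HB Require Import structures.
From mathcomp Require Import all_boot all_order all_algebra.
From mathcomp Require Import all_classical all_reals all_analysis.

Set Implicit Arguments.
Unset Strict Implicit.
Unset Printing Implicit Defensive.

Import Order.TTheory GRing.Theory Num.Theory.
Import numFieldNormedType.Exports.

Local Open Scope classical_set_scope.
Local Open Scope ring_scope.

(* R^n is 'rV[R]_n.  Its library norm is the sup norm, so the Euclidean norm is
   introduced here; the two norms give the same topology and the same bounded
   sets, so open, closed, bounded_set, continuous and nbhs are the library's. *)
Definition dot (R : realType) (n : nat) (u v : 'rV[R]_n) : R :=
  \sum_(j < n) u 0 j * v 0 j.

Definition norm2 (R : realType) (n : nat) (u : 'rV[R]_n) : R :=
  Num.sqrt (dot u u).

Definition opnorm (R : realType) (n p : nat)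
    (A : {linear 'rV[R]_n -> 'rV[R]_p}) : R :=
  sup [set norm2 (A x) | x in [set x | norm2 x <= 1]].

Definition is_argmin (T : Type) (R : realType) (D : set T) (F : T -> R) (a : T) :=
  D a /\ forall b, D b -> F a <= F b.

Definition is_argmax (T : Type) (R : realType) (D : set T) (F : T -> R) (a : T) :=
  D a /\ forall b, D b -> F b <= F a.

Definition strongly_convex_on (R : realType) (n : nat) (D : set 'rV[R]_n)
    (s : R) (F : 'rV[R]_n -> R) :=
  forall (x y : 'rV[R]_n) (t : R), D x -> D y -> 0 <= t <= 1 ->
    F (t *: x + (1 - t) *: y) <=
      t * F x + (1 - t) * F y - s / 2 * t * (1 - t) * norm2 (x - y) ^+ 2.

(* g is a gradient at x of the restriction of F to X: the first-order expansion
   F y = F x + <g, y - x> + o(|y - x|) is required for y in X only, so that F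
   need not be defined (or smooth) outside X.  When x is an interior point of X
   this is the usual gradient; when F is differentiable in a neighbourhood of
   x, the usual gradient satisfies it. *)
Definition is_gradient_on (R : realType) (n : nat) (X : set 'rV[R]_n)
    (F : 'rV[R]_n -> R) (x g : 'rV[R]_n) :=
  forall e : R, 0 < e -> \forall y \near x, X y ->
    `|F y - F x - dot g (y - x)| <= e * norm2 (y - x).

Section Objectives.
Context (R : realType) (n p : nat).
Variables (X : set 'rV[R]_n) (f : 'rV[R]_n -> R).
Variables (U : set 'rV[R]_p) (A : {linear 'rV[R]_n -> 'rV[R]_p}).
Variables (Q om : 'rV[R]_p -> R).

(* The maxima and minima below are over compact sets of continuous functions,
   hence attained, so they are the library's sup and inf. *)
Definition h_fun (x : 'rV[R]_n) : R :=
  sup [set dot (A x) u - Q u | u in U].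

Definition psi (x : 'rV[R]_n) : R := f x + h_fun x.

Definition phi (u : 'rV[R]_p) : R :=
  inf [set f x + dot (A x) u - Q u | x in X].

Definition h_mu (mu : R) (x : 'rV[R]_n) : R :=
  sup [set dot (A x) u - Q u - mu * om u | u in U].

Definition psi_mu (mu : R) (x : 'rV[R]_n) : R := f x + h_mu mu x.

Definition omega_max : R := sup [set om u | u in U].

Definition lip_psi_mu (Lf som mu : R) : R :=
  Lf + opnorm A ^+ 2 / (mu * som).

End Objectives.

Notation borelV R n := (g_sigma_algebraType (@open 'rV[R]_n)).

Section Sampling.
Context (R : realType) (d d' : measure_display).
Context (T : measurableType d) (V : measurableType d').
Variable P : probability T R.

Definition mutually_independent (I : finType) (Z : I -> {RV P >-> V}) :=
  forall (J : {set I}) (B : I -> set V), (forall i, measurable (B i)) ->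
    P (\bigcap_(i in [set i | i \in J]) Z i @^-1` B i) =
    (\prod_(i in J) P (Z i @^-1` B i))%E.

Definition iid_copies (I : finType) (xi : {RV P >-> V}) (Z : I -> {RV P >-> V}) :=
  mutually_independent Z /\
  forall (i : I) (B : set V), measurable B ->
    distribution P (Z i) B = distribution P xi B.

End Sampling.

(* Psi and GPsi are the stochastic value and gradient oracles at a fixed value
   of the smoothing parameter.  The two measurability clauses are what gives a
   meaning to the expectations, both for fixed x and along the random iterates. *)
Record stochastic_oracle (R : realType) (d : measure_display)
    (T : measurableType d) (P : probability T R) (n q : nat)
    (X : set 'rV[R]_n) (xi : {RV P >-> borelV R q})
    (F : 'rV[R]_n -> R) (gradF : 'rV[R]_n -> 'rV[R]_n) (sigma : R)
    (Psi : 'rV[R]_n -> 'rV[R]_q -> R)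
    (GPsi : 'rV[R]_n -> 'rV[R]_q -> 'rV[R]_n) : Prop := StochasticOracle {
  oracle_value_measurable :
    measurable_fun (X `*` [set: 'rV[R]_q] : set (borelV R n * borelV R q))
      (fun z : borelV R n * borelV R q => Psi z.1 z.2);
  oracle_grad_measurable :
    measurable_fun (X `*` [set: 'rV[R]_q] : set (borelV R n * borelV R q))
      (fun z : borelV R n * borelV R q => GPsi z.1 z.2 : borelV R n);
  oracle_value_mean : forall x, X x ->
    ('E_P[fun w => (Psi x (xi w))%R] = (F x)%:E)%E;
  oracle_grad_mean : forall x, X x -> forall j,
    ('E_P[fun w => (GPsi x (xi w) 0 j)%R] = (gradF x 0 j)%:E)%E;
  oracle_grad_variance : forall x, X x ->
    ('E_P[fun w => (norm2 (GPsi x (xi w) - gradF x) ^+ 2)%R] <= (sigma ^+ 2)%:E)%E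
}.

Section Algorithm.
Context (R : realType) (n q : nat) (T : Type).
Variables (X : set 'rV[R]_n) (dprox : 'rV[R]_n -> R) (sd L : R) (x0 : 'rV[R]_n).
Variables (Psi : 'rV[R]_n -> 'rV[R]_q -> R).
Variables (GPsi : 'rV[R]_n -> 'rV[R]_q -> 'rV[R]_n).
Variables (N m : nat) (xi : nat -> nat -> T -> 'rV[R]_q).
Variables (x y z : nat -> T -> 'rV[R]_n).

Definition batch_value (k : nat) (w : T) : R :=
  m%:R^-1 * \sum_(i < m) Psi (x k w) (xi k i w).

Definition batch_grad (k : nat) (w : T) : 'rV[R]_n :=
  m%:R^-1 *: \sum_(i < m) GPsi (x k w) (xi k i w).

(* x k w, y k w, z k w are the iterates x_k, y_k, z_k for the outcome w. *)
Record nesterov_run : Prop := NesterovRun {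
  run_init : forall w, x 0%N w = x0;
  run_y : forall k w, (k <= N)%N ->
    is_argmin X
      (fun v => dot (batch_grad k w) (v - x k w) +
         L * Num.sqrt k.+1%:R / (2 * Num.sqrt 2) * norm2 (v - x k w) ^+ 2)
      (y k w);
  run_z : forall k w, (k <= N)%N ->
    is_argmin X
      (fun v => L / sd * dprox v +
         \sum_(i < k.+1) 2^-1 * (batch_value i w +
                                  dot (batch_grad i w) (v - x i w)))
      (z k w);
  run_x : forall k w, (k <= N)%N ->
    x k.+1 w = (k.+2%:R)^-1 *: z k w + (k.+1%:R / k.+2%:R) *: y k w
}.

End Algorithm.

Section Constants.
Context (R : realType).
(* nA stands for the operator norm of A, Om for the maximum of omega *)
Variables (nA Om sigma som sd D Lf : R).

(* the batch size m is the ceiling of this number *)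
Definition batch_size_arg (N : nat) : R :=
  Num.sqrt 2 * sigma ^+ 2 * som * Num.sqrt N.+1%:R / (nA ^+ 2 * Om).

Definition mu_param (N m : nat) : R :=
  nA ^+ 2 * Num.sqrt ((6 - Num.sqrt 2) * m%:R * D) /
  (Num.sqrt (2 * N.+1%:R * sd * som) *
   Num.sqrt (m%:R * nA ^+ 2 * Om + Num.sqrt (2 * N.+1%:R) * som * sigma ^+ 2)).

End Constants.

(* Main.v *)
From HB Require Import structures.
Require Import Defs.
From mathcomp Require Import all_boot all_order all_algebra.
From mathcomp Require Import all_classical all_reals all_analysis.
From mathcomp Require Import measurable_realfun ring lra.
Set Implicit Arguments.
Unset Strict Implicit.
Unset Printing Implicit Defensive.
Import Order.TTheory GRing.Theory Num.Theory.
Import numFieldNormedType.Exports.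
Local Open Scope classical_set_scope.
Local Open Scope ring_scope.

(* Write F for psi_mu, L for its smoothness constant, delta_k for the error of the
   k-th mini-batch gradient and s_k = y_k - x_k.  Along every trajectory an
   estimate-sequence argument bounds ((N+1)/2) F(y_N) by a prox-regularised linear
   model of F plus noise terms -<delta_k, s_k> - rho_k |s_k|^2 and
   <delta_{k+1}, y_k - x_{k+1}>.  The minimum of the exact linear model is controlled
   by the dual value phi(uhat), because the gradient of F at x_i is the gradient of f
   plus A^T u_mu(x_i) and Q is convex.

   The point realising phi(uhat) depends on all samples, so the noise terms
   <delta_i, x - x_i> do not vanish in expectation at it.  They are instead evaluated at
   the minimiser zb of the prox-regularised model built from exact gradients, which does
   not depend on the last batch.  For N = 1 its dependence on delta_0 is Lipschitz with an
   explicit small constant; for N >= 2 Young's inequality trades <sum delta_i, zb - x_0>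
   against the unused fraction (2 - sqrt 2)/4 of the prox-diameter term and the second
   moment of sum delta_i, a sum of martingale increments.  The quadratic slack in the prox
   steps makes the resulting variance budget fit, for every N, the constant of the claim.

   In expectation each delta_k is orthogonal to every square-integrable function of the
   earlier samples: the sigma-algebra they generate is independent of the current sample,
   so Fubini's theorem applies to the joint law. *)

(** * Euclidean geometry and strong convexity *)

(** The constant 6 - sqrt 2 is 4 (1 + (2 - sqrt 2)/4): the estimate sequence uses one full
    prox-diameter term, and the fraction (2 - sqrt 2)/4 is all that may be spent on the comparator.
    The variance costs must then sum to at most (N+1)^(3/2) / sqrt 2, which is tight for small N.
    For N = 0 the budget is about 0.707, while absorbing the whole first noise in the quadratic
    slack costs about 1.52; hence the comparison with a deterministic prox step. For N = 1 the
    budget is 2, while Young's inequality would bring the cost to about 2.145; hence the Lipschitz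
    argument. At N = 2 Young's inequality fits with a slack of about 0.05. [X] may have empty
    interior, so a gradient relative to [X] is determined only through its products with differences
    of points of [X]; its Lipschitz property is therefore stated in that weak form. The iterates are
    given only as minimisers. Strong convexity makes each a Lipschitz function of its data, which
    yields both the stability bounds and measurability with respect to the past samples. *)

Section Euclidean.
Context (R : realType) (n : nat).
Implicit Types (u v w : 'rV[R]_n) (a : R).

Lemma dotC u v : dot u v = dot v u.
Proof. by apply: eq_bigr => j _; rewrite mulrC. Qed.

Lemma dotDl u v w : dot (u + v) w = dot u w + dot v w.
Proof. by rewrite -big_split; apply: eq_bigr => j _; rewrite mxE mulrDl. Qed.

Lemma dotZl a u v : dot (a *: u) v = a * dot u v.
Proof. by rewrite mulr_sumr; apply: eq_bigr => j _; rewrite mxE mulrA. Qed.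

Lemma dotNl u v : dot (- u) v = - dot u v.
Proof. by rewrite -scaleN1r dotZl mulN1r. Qed.

Lemma dotBl u v w : dot (u - v) w = dot u w - dot v w.
Proof. by rewrite dotDl dotNl. Qed.

Lemma dotDr u v w : dot w (u + v) = dot w u + dot w v.
Proof. by rewrite dotC dotDl !(dotC w). Qed.

Lemma dotZr a u v : dot u (a *: v) = a * dot u v.
Proof. by rewrite dotC dotZl dotC. Qed.

Lemma dotNr u v : dot u (- v) = - dot u v.
Proof. by rewrite dotC dotNl dotC. Qed.

Lemma dotBr u v w : dot w (u - v) = dot w u - dot w v.
Proof. by rewrite dotDr dotNr. Qed.

Lemma dot0l u : dot 0 u = 0.
Proof. by rewrite -(scale0r 0) dotZl mul0r. Qed.

Lemma dot0r u : dot u 0 = 0.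
Proof. by rewrite dotC dot0l. Qed.

Definition dotE := (dotDl, dotDr, dotNl, dotNr, dotZl, dotZr, dot0l, dot0r).

Lemma dot_suml (I : Type) (r : seq I) (P : pred I) (F : I -> 'rV[R]_n) u :
  dot (\sum_(i <- r | P i) F i) u = \sum_(i <- r | P i) dot (F i) u.
Proof.
by elim/big_rec2: _ => [|i b v _ <-]; rewrite ?dot0l// dotDl.
Qed.

Lemma dot_sumr (I : Type) (r : seq I) (P : pred I) (F : I -> 'rV[R]_n) u :
  dot u (\sum_(i <- r | P i) F i) = \sum_(i <- r | P i) dot u (F i).
Proof. by rewrite dotC dot_suml; under eq_bigr do rewrite dotC. Qed.

Lemma dot_ge0 u : 0 <= dot u u.
Proof. by apply: sumr_ge0 => j _; rewrite -expr2 sqr_ge0. Qed.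

Lemma norm2_ge0 u : 0 <= norm2 u.
Proof. exact: sqrtr_ge0. Qed.
Hint Resolve norm2_ge0 : core.

Lemma norm2_sqr u : norm2 u ^+ 2 = dot u u.
Proof. by rewrite sqr_sqrtr ?dot_ge0. Qed.

Lemma norm2N u : norm2 (- u) = norm2 u.
Proof. by rewrite /norm2 dotNl dotNr opprK. Qed.

Lemma norm2_distC u v : norm2 (u - v) = norm2 (v - u).
Proof. by rewrite -norm2N opprB. Qed.

Lemma norm2_0 : norm2 (0 : 'rV[R]_n) = 0.
Proof. by rewrite /norm2 dot0l sqrtr0. Qed.

Lemma norm2Z a u : norm2 (a *: u) = `|a| * norm2 u.
Proof.
by rewrite /norm2 dotZl dotZr mulrA -expr2 sqrtrM ?sqr_ge0// sqrtr_sqr.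
Qed.

Lemma coord_le_norm2 u j : `|u 0 j| <= norm2 u.
Proof.
rewrite -[leRHS]ger0_norm// -ler_sqr ?nnegrE//.
rewrite !real_normK ?num_real// norm2_sqr /dot (bigD1 j)//= -expr2 lerDl.
by apply: sumr_ge0 => i _; rewrite -expr2 sqr_ge0.
Qed.

Lemma norm2_eq0 u : norm2 u = 0 -> u = 0.
Proof.
move=> u0; apply/rowP => j; rewrite mxE; apply/eqP.
by rewrite -normr_le0 -u0 coord_le_norm2.
Qed.

Lemma dot_young a u v : 0 < a ->
  dot u v <= a / 2 * norm2 u ^+ 2 + (2 * a)^-1 * norm2 v ^+ 2.
Proof.
move=> a0; have := dot_ge0 (a *: u - v).
rewrite !norm2_sqr !dotE (dotC v u) => H.
rewrite -(ler_pM2l (_ : 0 < 2 * a)) ?mulr_gt0//.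
have -> : 2 * a * (a / 2 * dot u u + (2 * a)^-1 * dot v v) =
  a ^+ 2 * dot u u + dot v v by field; lra.
by nra.
Qed.

Lemma cauchy_schwarz u v : dot u v <= norm2 u * norm2 v.
Proof.
have [/norm2_eq0->|u0] := eqVneq (norm2 u) 0; first by rewrite dot0l norm2_0 mul0r.
have [/norm2_eq0->|v0] := eqVneq (norm2 v) 0; first by rewrite dot0r norm2_0 mulr0.
have a0 : 0 < norm2 v / norm2 u by rewrite divr_gt0// lt0r norm2_ge0 ?u0 ?v0.
apply: (le_trans (dot_young u v a0)).
by rewrite le_eqVlt; apply/orP; left; apply/eqP; field; rewrite u0 v0.
Qed.

Lemma cauchy_schwarz_abs u v : `|dot u v| <= norm2 u * norm2 v.
Proof.
by rewrite ler_norml cauchy_schwarz andbT lerNl -dotNl -(norm2N u) cauchy_schwarz.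
Qed.

Lemma ler_norm2D u v : norm2 (u + v) <= norm2 u + norm2 v.
Proof.
rewrite -ler_sqr ?nnegrE ?addr_ge0// sqrrD !norm2_sqr !dotE (dotC v u).
by have := cauchy_schwarz u v; lra.
Qed.

Lemma norm2_le_mx_norm u : norm2 u <= Num.sqrt n%:R * `|u|.
Proof.
rewrite -[X in _ * X]ger0_norm// -sqrtr_sqr -sqrtrM// ler_sqrt ?mulr_ge0 ?sqr_ge0//.
rewrite /dot mulr_natl -[X in _ *+ X]card_ord -sumr_const; apply: ler_sum => j _.
rewrite -expr2 -real_normK ?num_real// ler_sqr ?nnegrE//.
by rewrite [leRHS]/Num.norm/= mx_normrE; apply/bigmax_geP; right; exists (0, j).
Qed.

Lemma mx_norm_le_norm2 u : `|u| <= norm2 u.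
Proof.
rewrite [leLHS]/Num.norm/= mx_normrE; apply/bigmax_leP; split => //= -[i j] _.
by rewrite (ord1 i); exact: coord_le_norm2.
Qed.

Lemma bounded_norm2 (X : set 'rV[R]_n) : bounded_set X ->
  exists2 B, 0 < B & forall x, X x -> norm2 x <= B.
Proof.
move=> [M [_ XM]]; exists (Num.sqrt n%:R * (`|M| + 1) + 1).
  by rewrite ltr_wpDl// mulr_ge0// addr_ge0.
move=> x Xx; rewrite (le_trans (norm2_le_mx_norm x))// ler_wpDr//.
rewrite ler_wpM2l//; apply: XM => //.
by rewrite (le_lt_trans (ler_norm M)) ?ltrDl.
Qed.

End Euclidean.
#[global] Hint Extern 0 (is_true (0 <= norm2 _)) => solve [apply: norm2_ge0] : core.

Lemma opnorm_bound (R : realType) (n p : nat)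
    (A : {linear 'rV[R]_n -> 'rV[R]_p}) (x : 'rV[R]_n) :
  0 < opnorm A -> norm2 (A x) <= opnorm A * norm2 x.
Proof.
move=> A0; set S := [set norm2 (A x) | x in [set x | norm2 x <= 1]].
(* [sup] takes the value 0 on a set without a supremum, so [0 < opnorm A] already forces the set to
   be bounded above. *)
have hS : has_sup S by apply: contrapT => /sup_out S0; move: A0; rewrite /opnorm S0 ltxx.
have [/norm2_eq0->|x0] := eqVneq (norm2 x) 0; first by rewrite linear0 !norm2_0 mulr0.
have xp : 0 < norm2 x by rewrite lt0r x0 norm2_ge0.
rewrite -ler_pdivrMr//.
suff : norm2 (A ((norm2 x)^-1 *: x)) <= opnorm A.
  by rewrite linearZ norm2Z ger0_norm ?invr_ge0 ?norm2_ge0// mulrC.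
apply: (sup_upper_bound hS); exists ((norm2 x)^-1 *: x) => //=.
by rewrite norm2Z ger0_norm ?invr_ge0 ?norm2_ge0// mulVf.
Qed.

Section Convexity.
Context (R : realType) (n : nat).
Implicit Types (X : set 'rV[R]_n) (F : 'rV[R]_n -> R) (x y q : 'rV[R]_n).

Lemma convex_setE X x y (t : R) : convex_set X -> X x -> X y ->
  0 <= t <= 1 -> X (t *: x + (1 - t) *: y).
Proof.
move=> cX Xx Xy /andP[t0 t1].
have := cX x y (Itv01 t0 t1); rewrite !inE; exact.
Qed.

Lemma convex_functionE X F x y (t : R) : convex_function X F -> X x -> X y ->
  0 <= t <= 1 -> F (t *: x + (1 - t) *: y) <= t * F x + (1 - t) * F y.
Proof.
move=> cF Xx Xy /andP[t0 t1].
have := cF (Itv01 t0 t1) x y; rewrite !inE; exact.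
Qed.

Lemma strongly_convex_dot X s F q : strongly_convex_on X s F ->
  strongly_convex_on X s (fun v => F v + dot q v).
Proof.
move=> sF x y t Xx Xy t01; have := sF x y t Xx Xy t01.
rewrite !dotE; lra.
Qed.

Lemma strongly_convex_scale X s F (a : R) : 0 <= a -> strongly_convex_on X s F ->
  strongly_convex_on X (a * s) (fun v => a * F v).
Proof.
move=> a0 sF x y t Xx Xy t01; have := ler_wpM2l a0 (sF x y t Xx Xy t01).
lra.
Qed.

Lemma strongly_convex_sqr X (a : R) (c : 'rV[R]_n) :
  strongly_convex_on X (2 * a) (fun v => a * norm2 (v - c) ^+ 2).
Proof.
move=> x y t _ _ _; rewrite !norm2_sqr !dotE (dotC y x) (dotC c x) (dotC c y).
lra.
Qed.

(** Strong convexity on the segment gives [F x + (1 - t) * b <= F y] after division by [t]; letting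
    [t] tend to 0 recovers the full constant [s / 2]. *)
Lemma argmin_growth X s F x y : convex_set X -> strongly_convex_on X s F ->
  is_argmin X F x -> X y -> F x + s / 2 * norm2 (y - x) ^+ 2 <= F y.
Proof.
move=> cX sF [Xx minx] Xy; apply/ler_addgt0Pr => e e0.
set b := s / 2 * norm2 (y - x) ^+ 2.
have H t : 0 < t <= 1 -> F x + (1 - t) * b <= F y.
  move=> /andP[t0 t1]; have t01 : 0 <= t <= 1 by rewrite (ltW t0).
  have := minx _ (convex_setE cX Xy Xx t01).
  have := sF y x t Xy Xx t01; rewrite -/b => H1 H2.
  rewrite -(ler_pM2l t0); move: (le_trans H2 H1).
  by rewrite /b; lra.
have [b0|b0] := lerP b 0.
  by have := H 1; rewrite ltr01 lexx subrr mul0r => /(_ isT); lra.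
pose t := Num.min 1 (e / b).
have t0 : 0 < t <= 1 by rewrite lt_min ltr01 divr_gt0//= ge_min lexx.
have : t * b <= e by rewrite -ler_pdivlMr// ge_min lexx orbT.
by have := H t t0; lra.
Qed.

(** Each minimiser is tested in the growth inequality of the other. The product form is kept beside
    the norm form because gradients relative to [X] are controlled only in such products. *)
Lemma argmin_linear_growth X s F q q' x y :
  convex_set X -> strongly_convex_on X s F ->
  is_argmin X (fun v => F v + dot q v) x ->
  is_argmin X (fun v => F v + dot q' v) y ->
  s * norm2 (x - y) ^+ 2 <= dot (q - q') (y - x).
Proof.
move=> cX sF mx my; have [Xx _] := mx; have [Xy _] := my.
have := argmin_growth cX (strongly_convex_dot q sF) mx Xy.
have := argmin_growth cX (strongly_convex_dot q' sF) my Xx.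
by rewrite (norm2_distC y x) !dotE; lra.
Qed.

(** Stability under linear tilts. It serves for the maximisers [u x], for the distance between noisy
    and noise-free steps, and for the measurability of the iterates. *)
Lemma argmin_linear_lipschitz X s F q q' x y :
  0 < s -> convex_set X -> strongly_convex_on X s F ->
  is_argmin X (fun v => F v + dot q v) x ->
  is_argmin X (fun v => F v + dot q' v) y ->
  norm2 (x - y) <= s^-1 * norm2 (q - q').
Proof.
move=> s0 cX sF mx my; rewrite -(ler_pM2l s0) mulrA mulfV ?gt_eqF// mul1r.
have := argmin_linear_growth cX sF mx my.
have := cauchy_schwarz (q - q') (y - x); rewrite (norm2_distC y x).
have [->|] := eqVneq (norm2 (x - y)) 0; first by move=> _ _; rewrite mulr0 norm2_ge0.
move=> xy0 H2 H1; have xyp : 0 < norm2 (x - y) by rewrite lt0r xy0 norm2_ge0.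
by rewrite -(ler_pM2r xyp) -mulrA -expr2; exact: le_trans H2.
Qed.

Lemma is_argmin_ext (T : Type) (D : set T) (f g : T -> R) a :
  (exists c, forall v, D v -> f v = g v + c) -> is_argmin D f a -> is_argmin D g a.
Proof.
move=> [c fg] [Da ma]; split=> // b Db; have := ma b Db.
by rewrite !fg// lerD2r.
Qed.

Lemma argmin_exists X F : X !=set0 -> bounded_set X -> closed X ->
  {within X, continuous F} -> exists x, is_argmin X F x.
Proof.
move=> X0 bX cX cF; have := EVT_min_rV X0 (bounded_closed_compact bX cX) cF.
by move=> [c /set_mem Xc minc]; exists c; split => // b Xb; apply: minc; rewrite inE.
Qed.

Lemma within_bounded X F : X !=set0 -> bounded_set X -> closed X ->
  {within X, continuous F} -> exists B, forall x, X x -> `|F x| <= B.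
Proof.
move=> X0 bX cX cF.
have [a /set_mem _ mina] := EVT_min_rV X0 (bounded_closed_compact bX cX) cF.
have [b /set_mem _ maxb] := EVT_max_rV X0 (bounded_closed_compact bX cX) cF.
exists (`|F a| + `|F b|) => x Xx.
have := mina x (mem_set Xx); have := maxb x (mem_set Xx).
have := ler_norm (F b); have := lerNnormlW (lexx `|F a|); rewrite ler_norml.
by have := normr_ge0 (F a); have := normr_ge0 (F b); lra.
Qed.

End Convexity.

(** * Gradients relative to a convex set and the descent inequality *)

Section Gradients.
Context (R : realType) (n : nat).
Implicit Types (X : set 'rV[R]_n) (F : 'rV[R]_n -> R) (x y g : 'rV[R]_n).

Lemma gradient_along X F x g y (e : R) : convex_set X -> is_gradient_on X F x g ->
  X x -> X y -> 0 < e ->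
  exists2 t, 0 < t <= 1 & t <= e /\
    `|F (t *: y + (1 - t) *: x) - F x - t * dot g (y - x)| <=
       e * t * norm2 (y - x).
Proof.
move=> cX gF Xx Xy e0; have /nbhs_ballP[r /= r0 xr] := gF e e0.
have N0 : 0 < 1 + `|y - x| by rewrite ltr_pwDl.
(* The last bound keeps the point in the ball of radius [r]; [t <= e] lets [gradient_le] discard its
   quadratic term. *)
pose t := Num.min (Num.min 1 e) (r / 2 / (1 + `|y - x|)).
have t0 : 0 < t by rewrite !lt_min ltr01 e0 !divr_gt0.
have t1 : t <= 1 by rewrite !ge_min lexx.
exists t; first by rewrite t0.
split; first by rewrite !ge_min lexx orbT.
have tr : t * (1 + `|y - x|) <= r / 2.
  by rewrite -ler_pdivlMr// !ge_min lexx !orbT.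
have Xt : X (t *: y + (1 - t) *: x) by apply: convex_setE; rewrite ?t1 ?ltW.
have E : t *: y + (1 - t) *: x - x = t *: (y - x).
  by rewrite scalerBl scale1r scalerBr addrA addrAC addrK.
have B : ball x r (t *: y + (1 - t) *: x).
  rewrite -ball_normE /= distrC E normrZ gtr0_norm//.
  by apply: le_lt_trans (_ : t * (1 + `|y - x|) < r); [rewrite ler_pM2l// lerDr|lra].
have := xr _ B Xt; rewrite E dotZr norm2Z. rewrite (gtr0_norm t0) mulrA; exact.
Qed.

Lemma gradient_le X F x g y (l C : R) : convex_set X -> is_gradient_on X F x g ->
  X x -> X y ->
  (forall t, 0 < t <= 1 -> F (t *: y + (1 - t) *: x) <= F x + t * l + C * t ^+ 2) ->
  dot g (y - x) <= l.
Proof.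
move=> cX gF Xx Xy H; apply/ler_addgt0Pr => e e0.
have K0 : 0 < `|C| + norm2 (y - x) + 1 by rewrite ltr_wpDl// addr_ge0.
pose e' := e / (`|C| + norm2 (y - x) + 1).
have e'0 : 0 < e' by rewrite divr_gt0.
have [t t01 [te]] := gradient_along cX gF Xx Xy e'0.
have := H t t01; case/andP: t01 => t0 t1; rewrite ler_norml => H1 /andP[H2 H3].
have : t * dot g (y - x) <= t * (l + C * t + e' * norm2 (y - x)) by lra.
rewrite ler_pM2l// => H4; apply: (le_trans H4); rewrite -addrA lerD2l.
have -> : e = e' * `|C| + e' * norm2 (y - x) + e'.
  by rewrite /e'; field; rewrite gt_eqF.
have : C * t <= `|C| * t by rewrite ler_pM2r// ler_norm.
have : `|C| * t <= `|C| * e' by rewrite ler_wpM2l.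
lra.
Qed.

Lemma is_gradient_opp X F x g : is_gradient_on X F x g ->
  is_gradient_on X (fun v => - F v) x (- g).
Proof.
move=> gF e e0; apply: filterS (gF e e0) => y H /H.
by rewrite dotNl -normrN !opprB opprK; congr (`|_| <= _); ring.
Qed.

Lemma gradient_ge X F x g y (l : R) : convex_set X -> is_gradient_on X F x g ->
  X x -> X y ->
  (forall t, 0 < t <= 1 -> F x + t * l <= F (t *: y + (1 - t) *: x)) ->
  l <= dot g (y - x).
Proof.
move=> cX gF Xx Xy H; rewrite -lerN2 -dotNl.
apply: (@gradient_le X (fun v => - F v) x (- g) y (- l) 0) => //.
  exact: is_gradient_opp.
by move=> t /H; lra.
Qed.

Lemma convex_gradient X F x g y : convex_set X -> convex_function X F ->
  is_gradient_on X F x g -> X x -> X y -> F x + dot g (y - x) <= F y.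
Proof.
move=> cX cF gF Xx Xy; suff : dot g (y - x) <= F y - F x by lra.
apply: (@gradient_le X F x g y _ 0) => // t /andP[t0 t1].
have t01 : 0 <= t <= 1 by rewrite (ltW t0).
have := convex_functionE cF Xy Xx t01; lra.
Qed.

(** Instead of integrating the gradient, the segment is cut into [M.+1] equal pieces. Convexity at
    the far end of each piece bounds the increment of [F], the Lipschitz property compares that
    gradient with [G x], and the excess over [l / 2 * b] vanishes as [M] grows. *)
Lemma descent_lemma X F (G : 'rV[R]_n -> 'rV[R]_n) (l : R) :
  convex_set X -> convex_function X F ->
  (forall x, X x -> is_gradient_on X F x (G x)) ->
  (forall x y, X x -> X y -> norm2 (G x - G y) <= l * norm2 (x - y)) ->
  forall x y, X x -> X y ->
    F y <= F x + dot (G x) (y - x) + l / 2 * norm2 (y - x) ^+ 2.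
Proof.
move=> cX cF gF lG x y Xx Xy.
set b := norm2 (y - x) ^+ 2.
have key (M : nat) : F y <= F x + dot (G x) (y - x) + l / 2 * b * (1 + M.+1%:R^-1).
  set h : R := M.+1%:R^-1.
  have h0 : 0 < h by rewrite invr_gt0.
  pose p j : 'rV[R]_n := (j%:R * h) *: y + (1 - j%:R * h) *: x.
  have jh j : (j <= M.+1)%N -> 0 <= (j%:R : R) * h <= 1.
    move=> jM; rewrite mulr_ge0 ?(ltW h0)//= ler_pdivrMr// mul1r ler_nat//.
  have Xp j : (j <= M.+1)%N -> X (p j) by move=> jM; apply: convex_setE; rewrite ?jh.
  (* Summing the Lipschitz errors [l * (i * h) * b * h] for [i = 1, ..., j] produces the factor
     [j (j + 1) / 2]. *)
  have ind j : (j <= M.+1)%N ->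
      F (p j) <= F x + (j%:R * h) * dot (G x) (y - x) +
                 l / 2 * b * (j%:R * j.+1%:R * h ^+ 2).
    elim: j => [_|j IH jM].
      by rewrite /p !mul0r scale0r add0r subr0 scale1r; lra.
    have := convex_gradient cX cF (gF _ (Xp _ jM)) (Xp _ jM) (Xp _ (ltnW jM)).
    have -> : p j - p j.+1 = (- h) *: (y - x).
      rewrite /p -natr1; apply/rowP => i; rewrite !mxE; ring.
    have pjx : p j.+1 - x = (j.+1%:R * h) *: (y - x).
      by rewrite /p; apply/rowP => i; rewrite !mxE; ring.
    have : dot (G (p j.+1) - G x) (y - x) <= l * (j.+1%:R * h) * b.
      apply: (le_trans (cauchy_schwarz _ _)).
      rewrite /b expr2 mulrA ler_wpM2r//.
      apply: (le_trans (lG _ _ (Xp _ jM) Xx)).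
      by rewrite pjx norm2Z ger0_norm ?mulrA// mulr_ge0// ltW.
    rewrite dotBl dotZr => H1 H2; have := IH (ltnW jM).
    have : h * dot (G (p j.+1)) (y - x) <=
           h * (dot (G x) (y - x) + l * (j.+1%:R * h) * b).
      by rewrite ler_pM2l//; lra.
    rewrite -!(natr1 j.+1) -!(natr1 j); lra.
  have := ind M.+1 (leqnn _).
  have Mh : M.+1%:R * h = 1 by rewrite /h mulfV.
  rewrite {1}/p Mh scale1r subrr scale0r addr0 => H; apply: (le_trans H).
  have -> : M.+1%:R * M.+2%:R * h ^+ 2 = (M.+1%:R * h) * (M.+1%:R * h + h).
    by rewrite -(natr1 M.+1); ring.
  by rewrite Mh; lra.
apply/ler_addgt0Pr => e e0.
have [lb|lb] := lerP (l / 2 * b) 0.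
  have := key 0%N; rewrite invr1; lra.
have [M HM] : exists M : nat, l / 2 * b * M.+1%:R^-1 <= e.
  exists (Num.truncn (l / 2 * b / e)).
  rewrite ler_pdivrMr// [leRHS]mulrC -ler_pdivrMr//; apply: ltW.
  by rewrite real_truncnS_gt ?num_real.
have := key M; move: HM; set h := M.+1%:R^-1; clearbody h; lra.
Qed.

End Gradients.

(** * The smoothed model *)

Lemma sup_argmax (T : Type) (R : realType) (D : set T) (F : T -> R) (a : T) :
  is_argmax D F a -> sup [set F u | u in D] = F a.
Proof.
move=> [Da ma]; have ub : ubound [set F u | u in D] (F a) by move=> _ [u Du <-]; exact: ma.
apply/eqP; rewrite eq_le; apply/andP; split.
  by apply: ge_sup => //; exists (F a), a.
by apply: ub_le_sup; [exists (F a)|exists a].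
Qed.

Lemma convex_average (R : realType) (n : nat) (U : set 'rV[R]_n) (Q : 'rV[R]_n -> R)
    (u : nat -> 'rV[R]_n) (N : nat) : convex_set U -> convex_function U Q ->
  (forall i, (i <= N)%N -> U (u i)) ->
  U (\sum_(i < N.+1) N.+1%:R^-1 *: u i) /\
  N.+1%:R * Q (\sum_(i < N.+1) N.+1%:R^-1 *: u i) <= \sum_(i < N.+1) Q (u i).
Proof.
move=> cU cQ; elim: N => [Uu|N IH Uu].
  rewrite !big_ord_recl !big_ord0 !addr0 invr1 scale1r mul1r.
  by split => //; exact: Uu.
have [Us Qs] := IH (fun i iN => Uu i (leqW iN)).
rewrite big_ord_recr /= [in leRHS]big_ord_recr /=.
set t : R := N.+2%:R^-1.
have N2 : N.+2%:R * t = 1 by rewrite mulfV.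
have N1 : N.+1%:R * t = 1 - t by move: N2; rewrite -(natr1 N.+1); lra.
have t01 : 0 <= t <= 1 by rewrite invr_ge0 ler0n invf_le1 ?ler1n.
have E : \sum_(i < N.+1) t *: u i = (1 - t) *: \sum_(i < N.+1) N.+1%:R^-1 *: u i.
  rewrite scaler_sumr; apply: eq_bigr => i _; rewrite scalerA -N1.
  by rewrite mulrAC mulfV ?mul1r.
rewrite E addrC; split; first by apply: convex_setE => //; exact: Uu.
have := convex_functionE cQ (Uu N.+1 (leqnn _)) Us t01.
rewrite -(ler_pM2l (_ : 0 < N.+2%:R)) // => H; apply: (le_trans H).
rewrite mulrDr !mulrA N2 mul1r -N1; by rewrite (mulrCA N.+2%:R) N2 mulr1; move: Qs; lra.
Qed.

Section Model.
Context (R : realType) (n p : nat).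
Variables (X : set 'rV[R]_n) (f : 'rV[R]_n -> R) (gradf : 'rV[R]_n -> 'rV[R]_n) (Lf : R).
Hypotheses (X0 : X !=set0) (Xbnd : bounded_set X) (Xcvx : convex_set X).
Hypotheses (fcvx : convex_function X f).
Hypotheses (fgrad : forall x, X x -> is_gradient_on X f x (gradf x)).
Hypotheses (Lf0 : 0 <= Lf).
Hypotheses (fLip : forall x y, X x -> X y ->
     norm2 (gradf x - gradf y) <= Lf * norm2 (x - y)).
Variables (U : set 'rV[R]_p) (A : {linear 'rV[R]_n -> 'rV[R]_p}) (Q : 'rV[R]_p -> R).
Hypotheses (U0 : U !=set0) (Ubnd : bounded_set U) (Ucl : closed U) (Ucvx : convex_set U).
Hypotheses (Qcont : {within U, continuous Q}) (Qcvx : convex_function U Q).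
Variables (om : 'rV[R]_p -> R) (som : R).
Hypotheses (om_cont : {within U, continuous om}) (som0 : 0 < som).
Hypotheses (om_scvx : strongly_convex_on U som om).
Hypotheses (om_ge0 : forall u, U u -> 0 <= om u).
Hypothesis nA0 : 0 < opnorm A.

(** The tangent inequality at both points suffices, since the gradient is Lipschitz on a bounded set
    and so bounded. Boundedness of [f] then makes the infimum in [phi] genuine, and the Lipschitz
    bound makes [psi] measurable along the iterates. *)
Lemma lipschitz_f : exists2 C, 0 <= C &
  forall x y, X x -> X y -> `|f x - f y| <= C * norm2 (x - y).
Proof.
have [x0 Xx0] := X0; have [B B0 XB] := bounded_norm2 Xbnd.
exists (norm2 (gradf x0) + Lf * (B + B)).
  by rewrite addr_ge0// mulr_ge0// addr_ge0 ?ltW.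
have Xg x : X x -> norm2 (gradf x) <= norm2 (gradf x0) + Lf * (B + B).
  move=> Xx; rewrite -[in leLHS](subrK (gradf x0) (gradf x)) addrC.
  apply: (le_trans (ler_norm2D _ _)); rewrite lerD2l.
  apply: (le_trans (fLip Xx Xx0)); rewrite ler_wpM2l//.
  by apply: (le_trans (ler_norm2D _ _)); rewrite norm2N lerD// XB.
move=> x y Xx Xy; rewrite ler_norml; apply/andP; split.
  have := convex_gradient Xcvx fcvx (fgrad Xy) Xy Xx.
  have := cauchy_schwarz_abs (gradf y) (x - y); rewrite ler_norml => /andP[H _].
  have : norm2 (gradf y) * norm2 (x - y) <=
    (norm2 (gradf x0) + Lf * (B + B)) * norm2 (x - y) by rewrite ler_wpM2r// Xg.
  by lra.
have := convex_gradient Xcvx fcvx (fgrad Xx) Xx Xy.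
have := cauchy_schwarz_abs (gradf x) (y - x); rewrite ler_norml => /andP[H _].
have : norm2 (gradf x) * norm2 (x - y) <=
  (norm2 (gradf x0) + Lf * (B + B)) * norm2 (x - y) by rewrite ler_wpM2r// Xg.
by rewrite norm2_distC in H *; lra.
Qed.

Lemma bounded_f : exists B, forall x, X x -> `|f x| <= B.
Proof.
have [C C0 lf] := lipschitz_f; have [x0 Xx0] := X0; have [B B0 XB] := bounded_norm2 Xbnd.
exists (`|f x0| + C * (B + B)) => x Xx.
rewrite -[in leLHS](subrK (f x0) (f x)) addrC.
apply: (le_trans (ler_normD _ _)); rewrite lerD2l.
apply: (le_trans (lf _ _ Xx Xx0)); rewrite ler_wpM2l//.
by apply: (le_trans (ler_norm2D _ _)); rewrite norm2N lerD// XB.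
Qed.

Lemma coupling_bound : exists2 B, 0 <= B &
  forall x u, U u -> `|dot (A x) u| <= B * norm2 x.
Proof.
have [B B0 UB] := bounded_norm2 Ubnd; exists (opnorm A * B).
  by rewrite mulr_ge0 ?ltW.
move=> x u Uu; apply: (le_trans (cauchy_schwarz_abs _ _)).
rewrite mulrAC ler_pM ?norm2_ge0//; [exact: opnorm_bound|exact: UB].
Qed.

Lemma h_fun_ub x : has_ubound [set dot (A x) u - Q u | u in U].
Proof.
have [B B0 AB] := coupling_bound; have [C QC] := within_bounded U0 Ubnd Ucl Qcont.
exists (B * norm2 x + C) => _ [u Uu <-].
have := AB x u Uu; have := QC u Uu; rewrite !ler_norml; lra.
Qed.

Lemma h_fun_ge x u : U u -> dot (A x) u - Q u <= h_fun U A Q x.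
Proof. by move=> Uu; apply: ub_le_sup; [exact: h_fun_ub|exists u]. Qed.

Lemma h_fun_le x c : (forall u, U u -> dot (A x) u - Q u <= c) -> h_fun U A Q x <= c.
Proof.
move=> H; apply: ge_sup; last by move=> _ [u Uu <-]; exact: H.
by have [u Uu] := U0; exists (dot (A x) u - Q u), u.
Qed.

Lemma lipschitz_psi : exists2 C, 0 <= C &
  forall x y, X x -> X y -> `|psi f U A Q x - psi f U A Q y| <= C * norm2 (x - y).
Proof.
have [C C0 lf] := lipschitz_f; have [B B0 AB] := coupling_bound.
have half x y : X x -> X y ->
    psi f U A Q x - psi f U A Q y <= (C + B) * norm2 (x - y).
  move=> Xx Xy; have := lf x y Xx Xy; rewrite ler_norml => /andP[_ H].
  have : h_fun U A Q x <= h_fun U A Q y + B * norm2 (x - y).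
    apply: h_fun_le => u Uu; have := h_fun_ge y Uu.
    have := AB (x - y) u Uu; rewrite ler_norml linearB dotBl; lra.
  by rewrite /psi; lra.
exists (C + B); first exact: addr_ge0.
move=> x y Xx Xy; rewrite ler_norml half// andbT lerNl opprB norm2_distC.
exact: half.
Qed.

Lemma phi_lb u : U u -> has_lbound [set f x + dot (A x) u - Q u | x in X].
Proof.
move=> Uu; have [C fC] := bounded_f; have [B B0 AB] := coupling_bound.
have [D D0 XD] := bounded_norm2 Xbnd.
exists (- C - B * D - Q u) => _ [x Xx <-].
have := AB x u Uu; have := fC x Xx; rewrite !ler_norml.
have : B * norm2 x <= B * D by rewrite ler_wpM2l// XD.
lra.
Qed.

Lemma phi_le u x : U u -> X x -> phi X f A Q u <= f x + dot (A x) u - Q u.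
Proof. by move=> Uu Xx; apply: ge_inf; [exact: phi_lb|exists x]. Qed.

Lemma phi_ge u c : (forall x, X x -> c <= f x + dot (A x) u - Q u) ->
  c <= phi X f A Q u.
Proof.
move=> H; apply: lb_le_inf; last by move=> _ [x Xx <-]; exact: H.
by have [x Xx] := X0; exists (f x + dot (A x) u - Q u), x.
Qed.

Lemma weak_duality x u : X x -> U u -> phi X f A Q u <= psi f U A Q x.
Proof.
by move=> Xx Uu; have := phi_le Uu Xx; have := h_fun_ge x Uu; rewrite /psi; lra.
Qed.

(** [Q] is merely continuous on [U], so [phi] itself need not be Lipschitz. Adding [Q] back leaves
    an infimum of functions affine in [u] with bounded slopes [A x]. *)
Lemma lipschitz_phi : exists2 C, 0 <= C & forall u v, U u -> U v ->
  `|(phi X f A Q u + Q u) - (phi X f A Q v + Q v)| <= C * norm2 (u - v).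
Proof.
have [D D0 XD] := bounded_norm2 Xbnd.
have half u v : U u -> U v ->
    (phi X f A Q u + Q u) - (phi X f A Q v + Q v) <= opnorm A * D * norm2 (u - v).
  move=> Uu Uv.
  suff : phi X f A Q u + Q u - Q v - opnorm A * D * norm2 (u - v) <= phi X f A Q v.
    lra.
  apply: phi_ge => x Xx; have := phi_le Uu Xx.
  have := cauchy_schwarz (A x) (u - v).
  have : norm2 (A x) * norm2 (u - v) <= opnorm A * D * norm2 (u - v).
    rewrite ler_wpM2r// (le_trans (opnorm_bound _ nA0))// ler_wpM2l ?XD//.
    exact: ltW.
  by rewrite dotBr; lra.
exists (opnorm A * D); first by rewrite mulr_ge0 ?ltW.
move=> u v Uu Uv; rewrite ler_norml half// andbT lerNl opprB norm2_distC.
exact: half.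
Qed.

Lemma omega_le u : U u -> om u <= omega_max U om.
Proof.
move=> Uu; have [C oC] := within_bounded U0 Ubnd Ucl om_cont.
apply: ub_le_sup; last by exists u.
by exists C => _ [v Uv <-]; exact: le_trans (ler_norm _) (oC v Uv).
Qed.

Section Smoothed.
Variables (mu : R) (u : 'rV[R]_n -> 'rV[R]_p).
Hypothesis mu0 : 0 < mu.
Hypothesis uP : forall x, is_argmax U (fun v => dot (A x) v - Q v - mu * om v) (u x).

Let L := lip_psi_mu A Lf som mu.
Let F := psi_mu f U A Q om mu.

Lemma umu_in x : U (u x). Proof. by have [] := uP x. Qed.

Lemma h_muE x : h_mu U A Q om mu x = dot (A x) (u x) - Q (u x) - mu * om (u x).
Proof. exact: sup_argmax (uP x). Qed.

Let G v := Q v + mu * om v.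

Let G_scvx : strongly_convex_on U (mu * som) G.
Proof.
move=> x y t Ux Uy t01; have := convex_functionE Qcvx Ux Uy t01.
have := strongly_convex_scale (ltW mu0) om_scvx Ux Uy t01; rewrite /G; lra.
Qed.

Let u_argmin x : is_argmin U (fun v => G v + dot (- A x) v) (u x).
Proof.
have [Ux mx] := uP x; split => // v Uv; have := mx v Uv.
by rewrite /G !dotNl; lra.
Qed.

Lemma umu_lipschitz x y : norm2 (u x - u y) <= (mu * som)^-1 * norm2 (A (x - y)).
Proof.
have := argmin_linear_lipschitz (mulr_gt0 mu0 som0) Ucvx G_scvx (u_argmin x) (u_argmin y).
by rewrite -opprD norm2N linearB.
Qed.

Lemma h_mu_ge x y : h_mu U A Q om mu x + dot (A (y - x)) (u x) <= h_mu U A Q om mu y.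
Proof.
have [_ m] := uP y; have := m _ (umu_in x); rewrite !h_muE linearB dotBl; lra.
Qed.

(** Growth of the inner problem at [u x], tested at [u y], leaves a negative term [mu * som / 2]
    times the squared distance of the maximisers. Young's inequality with weight [(mu * som)^-1]
    spends exactly this term on the product of [A (y - x)] with [u y - u x]. *)
Lemma h_mu_le x y : h_mu U A Q om mu y <= h_mu U A Q om mu x + dot (A (y - x)) (u x)
  + opnorm A ^+ 2 / (mu * som) / 2 * norm2 (y - x) ^+ 2.
Proof.
have ms : 0 < mu * som by rewrite mulr_gt0.
have := argmin_growth Ucvx (strongly_convex_dot _ G_scvx) (u_argmin x) (umu_in y).
rewrite !h_muE /G !dotNl => H.
have := dot_young (A (y - x)) (u y - u x) (_ : 0 < (mu * som)^-1).
rewrite invr_gt0 => /(_ ms).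
have -> : (2 * (mu * som)^-1)^-1 = mu * som / 2 by field; rewrite !gt_eqF.
have : (mu * som)^-1 / 2 * norm2 (A (y - x)) ^+ 2 <=
    opnorm A ^+ 2 / (mu * som) / 2 * norm2 (y - x) ^+ 2.
  have -> : opnorm A ^+ 2 / (mu * som) / 2 * norm2 (y - x) ^+ 2 =
    (mu * som)^-1 / 2 * (opnorm A * norm2 (y - x)) ^+ 2 by rewrite exprMn; ring.
  rewrite ler_pM2l ?divr_gt0 ?invr_gt0//.
  by rewrite ler_sqr ?nnegrE ?mulr_ge0 ?(ltW nA0)// opnorm_bound.
have : dot (A (y - x)) (u y - u x) = dot (A y) (u y) - dot (A x) (u y)
   - dot (A (y - x)) (u x) by rewrite dotBr [in dot _ (u y)]linearB dotBl.
have : dot (A (y - x)) (u x) = dot (A y) (u x) - dot (A x) (u x).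
  by rewrite linearB dotBl.
lra.
Qed.

Lemma lip_psi_mu_gt0 : 0 < L.
Proof. by rewrite ltr_wpDl// divr_gt0 ?exprn_gt0// mulr_gt0. Qed.

Let slope x v := dot (gradf x) v + dot (A v) (u x).

Let psi_mu_ge x y : X x -> X y -> F x + slope x (y - x) <= F y.
Proof.
move=> Xx Xy; have := convex_gradient Xcvx fcvx (fgrad Xx) Xx Xy.
by have := h_mu_ge x y; rewrite /F /psi_mu /slope; lra.
Qed.

Let psi_mu_le x y : X x -> X y ->
  F y <= F x + slope x (y - x) + L / 2 * norm2 (y - x) ^+ 2.
Proof.
move=> Xx Xy; have := descent_lemma Xcvx fcvx fgrad fLip Xx Xy.
by have := h_mu_le x y; rewrite /F /psi_mu /slope /L /lip_psi_mu; lra.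
Qed.

Variable G' : 'rV[R]_n -> 'rV[R]_n.
Hypothesis gradF : forall x, X x -> is_gradient_on X F x (G' x).

(** [G'] is an arbitrary gradient relative to [X], so it need not equal the expected vector. Its
    product with [y - x] is forced: along the segment [F] lies between the linear model with slope
    [slope x] and that model plus a quadratic, and [t] tends to 0. *)
Lemma gradient_psi_muE x y : X x -> X y ->
  dot (G' x) (y - x) = dot (gradf x) (y - x) + dot (A (y - x)) (u x).
Proof.
move=> Xx Xy.
have E t : t *: y + (1 - t) *: x - x = t *: (y - x).
  by apply/rowP => i; rewrite !mxE; ring.
have Xt t : 0 < t <= 1 -> X (t *: y + (1 - t) *: x).
  by move=> /andP[t0 t1]; apply: convex_setE; rewrite ?t1 ?ltW.
have sE t : slope x (t *: (y - x)) = t * slope x (y - x).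
  by rewrite /slope linearZ dotZl dotZr mulrDr.
apply/eqP; rewrite eq_le; apply/andP; split.
  apply: (gradient_le (C := L / 2 * norm2 (y - x) ^+ 2) Xcvx (gradF Xx) Xx Xy).
  move=> t t01; have := psi_mu_le Xx (Xt t t01); rewrite E sE norm2Z exprMn.
  by rewrite real_normK ?num_real// /slope; lra.
apply: (gradient_ge Xcvx (gradF Xx) Xx Xy) => t t01.
by have := psi_mu_ge Xx (Xt t t01); rewrite E sE.
Qed.

Lemma gradient_psi_mu_dir x y y' : X x -> X y -> X y' ->
  dot (G' x) (y - y') = dot (gradf x) (y - y') + dot (A (y - y')) (u x).
Proof.
move=> Xx Xy Xy'; have := gradient_psi_muE Xx Xy; have := gradient_psi_muE Xx Xy'.
by rewrite !linearB !dotE; lra.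
Qed.

Lemma psi_mu_gradient_le x y : X x -> X y -> F x + dot (G' x) (y - x) <= F y.
Proof. by move=> Xx Xy; rewrite gradient_psi_muE//; exact: psi_mu_ge. Qed.

Lemma psi_mu_descent x y : X x -> X y ->
  F y <= F x + dot (G' x) (y - x) + L / 2 * norm2 (y - x) ^+ 2.
Proof. by move=> Xx Xy; rewrite gradient_psi_muE//; exact: psi_mu_le. Qed.

(** Paired with [y - y'] because [G' x - G' x'] may have an uncontrolled component orthogonal to the
    directions of [X]. *)
Lemma gradient_psi_mu_lipschitz x x' y y' : X x -> X x' -> X y -> X y' ->
  dot (G' x - G' x') (y - y') <= L * norm2 (x - x') * norm2 (y - y').
Proof.
move=> Xx Xx' Xy Xy'; rewrite dotBl !gradient_psi_mu_dir//.
have := cauchy_schwarz (gradf x - gradf x') (y - y').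
have := cauchy_schwarz (A (y - y')) (u x - u x').
have : norm2 (gradf x - gradf x') * norm2 (y - y') <=
    Lf * norm2 (x - x') * norm2 (y - y') by rewrite ler_wpM2r// fLip.
have : norm2 (A (y - y')) * norm2 (u x - u x') <=
    opnorm A ^+ 2 / (mu * som) * norm2 (x - x') * norm2 (y - y').
  have -> : opnorm A ^+ 2 / (mu * som) * norm2 (x - x') * norm2 (y - y') =
    (opnorm A * norm2 (y - y')) * ((mu * som)^-1 * (opnorm A * norm2 (x - x'))).
    by ring.
  rewrite ler_pM// ?opnorm_bound//.
  apply: (le_trans (umu_lipschitz _ _)).
  by rewrite ler_wpM2l ?invr_ge0 ?mulr_ge0 ?opnorm_bound ?ltW.
by rewrite !dotBl !dotBr /L /lip_psi_mu; lra.
Qed.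

(** The dual enters here: the tangent of [F] at [x] lies below the Lagrangian at the dual point
    [u x], the discarded term [mu * om (u x)] being nonnegative. *)
Lemma psi_mu_linear_model x v : X x -> X v ->
  F x + dot (G' x) (v - x) <= f v + dot (A v) (u x) - Q (u x).
Proof.
move=> Xx Xv; rewrite gradient_psi_muE// /F /psi_mu h_muE linearB dotBl.
have := convex_gradient Xcvx fcvx (fgrad Xx) Xx Xv.
have := mulr_ge0 (ltW mu0) (om_ge0 (umu_in x)); lra.
Qed.

Lemma psi_le_psi_mu x : psi f U A Q x <= F x + mu * omega_max U om.
Proof.
rewrite /psi /F /psi_mu -addrA lerD2l; apply: h_fun_le => v Uv.
have [_ m] := uP x; have := m v Uv; rewrite h_muE.
have : mu * om v <= mu * omega_max U om by rewrite ler_pM2l// omega_le.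
lra.
Qed.

Lemma average_linear_model (x : nat -> 'rV[R]_n) (N : nat) :
  (forall i, (i <= N)%N -> X (x i)) ->
  let uhat := \sum_(i < N.+1) N.+1%:R^-1 *: u (x i) in
  U uhat /\ forall v, X v ->
    \sum_(i < N.+1) (F (x i) + dot (G' (x i)) (v - x i)) <=
      N.+1%:R * (f v + dot (A v) uhat - Q uhat).
Proof.
move=> Xx uhat.
have [Uh Qh] := @convex_average _ _ U Q (u \o x) N Ucvx Qcvx (fun i _ => umu_in (x i)).
split; first exact: Uh.
move=> v Xv; apply: (@le_trans _ _ (\sum_(i < N.+1) (f v + dot (A v) (u (x i)) - Q (u (x i))))).
  by apply: ler_sum => i _; apply: psi_mu_linear_model => //; apply: Xx; rewrite -ltnS.
rewrite big_split big_split /= sumr_const card_ord sumrN.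
rewrite mulrBr mulrDr mulr_natl /uhat dot_sumr mulr_sumr.
under [X in _ <= _ + X - _]eq_bigr do rewrite dotZr mulrA mulfV// mul1r.
by rewrite lerB.
Qed.

End Smoothed.
End Model.

(** * The algorithm along one trajectory *)

Section ProxStep.
Context (R : realType) (n : nat).
Variables (X : set 'rV[R]_n) (F : 'rV[R]_n -> R) (G : 'rV[R]_n -> 'rV[R]_n) (L : R).
Hypotheses (Xcvx : convex_set X) (L0 : 0 < L).
Hypothesis descent : forall x y, X x -> X y ->
  F y <= F x + dot (G x) (y - x) + L / 2 * norm2 (y - x) ^+ 2.
Implicit Types (x y v g s : 'rV[R]_n) (a K th rho : R).

Lemma prox_argminE x y g a :
  is_argmin X (fun v => dot g (v - x) + a * norm2 (v - x) ^+ 2) y ->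
  is_argmin X (fun v => a * norm2 (v - 0) ^+ 2 + dot (g - (2 * a) *: x) v) y.
Proof.
apply: is_argmin_ext; exists (a * dot x x - dot g x) => v _.
rewrite !norm2_sqr subr0 !dotE (dotC x v); ring.
Qed.

(** Descent at [y] is combined with growth of the prox objective tested at [v]. The cross term is
    split by the square of [K *: (v - x) - a *: (y - x)], which leaves [K] free to be matched with
    the curvature of the estimate sequence. *)
Lemma prox_step x y v g a K : 0 < K -> X x -> X v ->
  is_argmin X (fun v => dot g (v - x) + a * norm2 (v - x) ^+ 2) y ->
  F y <= F x + dot g (v - x) + K * norm2 (v - x) ^+ 2 -
    dot (g - G x) (y - x) - (2 * a - L / 2 - a ^+ 2 / K) * norm2 (y - x) ^+ 2.
Proof.
move=> K0 Xx Xv ym; have [Xy _] := ym; have := descent Xx Xy.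
have := argmin_growth Xcvx
  (strongly_convex_dot _ (@strongly_convex_sqr _ _ X a 0)) (prox_argminE ym) Xv.
have := dot_ge0 (K *: (v - x) - a *: (y - x)).
have aK : K * (a ^+ 2 / K) = a ^+ 2 by field; rewrite gt_eqF.
rewrite !subr0 !norm2_sqr.
set s := y - x; set r := v - x.
have ys : y = x + s by rewrite addrC subrK.
have vr : v = x + r by rewrite addrC subrK.
clearbody s r; rewrite ys vr !dotE (dotC s r) (dotC s x) (dotC r x) => H1 H2 H3.
have H1' : 0 <= K * (K * dot r r - 2 * a * dot r s + a ^+ 2 / K * dot s s).
  by rewrite !mulrDr mulrN (mulrA K (a ^+ 2 / K)) aK; lra.
rewrite pmulr_rge0// in H1'; lra.
Qed.

Lemma noise_absorbed s dl rho : 0 < rho ->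
  - dot dl s - rho * norm2 s ^+ 2 <= (4 * rho)^-1 * norm2 dl ^+ 2.
Proof.
move=> rho0; have r0 : 0 < 2 * rho by rewrite mulr_gt0.
have := dot_young (- s) dl r0.
rewrite dotNl (dotC s) norm2N mulrA -natrM (_ : 2 * rho / 2 = rho); last by field.
lra.
Qed.

(* The fraction th of the noise is absorbed by the quadratic term; on the rest, s is
   compared with the noise-free step s', which is uncorrelated with the noise. *)
Lemma noise_split s s' dl rho th b : 0 < rho -> 0 <= th <= 1 -> 0 < b ->
  norm2 (s - s') <= b^-1 * norm2 dl ->
  - dot dl s - rho * norm2 s ^+ 2 <=
    dot dl (- (1 - th) *: s') + ((1 - th) / b + th ^+ 2 / (4 * rho)) * norm2 dl ^+ 2.
Proof.
move=> rho0 /andP[th0 th1] b0 ss'.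
have := @noise_absorbed s (th *: dl) rho rho0; rewrite dotZl norm2Z ger0_norm// exprMn.
have := cauchy_schwarz_abs dl (s - s'); rewrite ler_norml => /andP[+ _].
have : norm2 dl * norm2 (s - s') <= b^-1 * norm2 dl ^+ 2.
  by rewrite expr2 mulrCA ler_wpM2l.
rewrite dotBr dotZr => H1 H2 H3.
have : (1 - th) * (dot dl s' - dot dl s) <= (1 - th) * (b^-1 * norm2 dl ^+ 2).
  by rewrite ler_wpM2l ?subr_ge0//; lra.
rewrite invfM; move: H3; rewrite invfM; set r := rho^-1; set c := 4^-1; lra.
Qed.

End ProxStep.

(** * Estimate sequence and splitting of the noise *)

Section Potential.
Context (R : realType) (n : nat).
Variables (X : set 'rV[R]_n) (F : 'rV[R]_n -> R) (G : 'rV[R]_n -> 'rV[R]_n) (L : R).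
Hypotheses (Xcvx : convex_set X) (L0 : 0 < L).
Hypothesis gradient_le_F : forall x y, X x -> X y -> F x + dot (G x) (y - x) <= F y.
Hypothesis descent : forall x y, X x -> X y ->
  F y <= F x + dot (G x) (y - x) + L / 2 * norm2 (y - x) ^+ 2.
Variables (dprox : 'rV[R]_n -> R) (sd D : R) (x0 : 'rV[R]_n).
Hypotheses (sd0 : 0 < sd) (d_scvx : strongly_convex_on X sd dprox).
Hypotheses (x0P : is_argmin X dprox x0) (d_x0 : dprox x0 = 0).
Hypothesis d_le : forall x, X x -> dprox x <= D.

Lemma prox_quadratic v : X v -> sd / 2 * norm2 (v - x0) ^+ 2 <= dprox v.
Proof. by move=> Xv; have := argmin_growth Xcvx d_scvx x0P Xv; rewrite d_x0 add0r. Qed.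

Lemma scaled_prox_scvx : strongly_convex_on X L (fun v => L / sd * dprox v).
Proof.
have -> : L = L / sd * sd by rewrite mulfVK// gt_eqF.
rewrite -[in fun _ => _](_ : L = L / sd * sd); last by rewrite mulfVK// gt_eqF.
by apply: strongly_convex_scale; rewrite ?divr_ge0 ?ltW.
Qed.

Definition prox_coef k : R := L * Num.sqrt k.+1%:R / (2 * Num.sqrt 2).
(** What [prox_step] leaves for [K = L (k+1)]: there [a^2 / K = L / 8], and
    [L / 2 + L / 8 = 5 L / 8]. It is still positive at [k = 0], where it is
    [(1 / sqrt 2 - 5 / 8) L]. *)
Definition margin k : R := 2 * prox_coef k - 5 / 8 * L.

Lemma prox_coef_sqr k : prox_coef k ^+ 2 = L ^+ 2 * k.+1%:R / 8.
Proof.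
by rewrite !(exprMn, exprVn) !sqr_sqrtr ?ler0n//; field.
Qed.

Variables (N : nat) (V : nat -> R) (g x y z : nat -> 'rV[R]_n).
Hypothesis xinit : x 0 = x0.
Hypothesis yP : forall k, (k <= N)%N ->
  is_argmin X (fun v => dot (g k) (v - x k) + prox_coef k * norm2 (v - x k) ^+ 2) (y k).
Hypothesis zP : forall k, (k <= N)%N ->
  is_argmin X (fun v => L / sd * dprox v +
    \sum_(i < k.+1) 2^-1 * (V i + dot (g i) (v - x i))) (z k).
Hypothesis xS : forall k, (k <= N)%N ->
  x k.+1 = k.+2%:R^-1 *: z k + (k.+1%:R / k.+2%:R) *: y k.

Definition noise k := g k - G (x k).
Definition step k := y k - x k.

Lemma z_argmin k : (k <= N)%N ->
  is_argmin X (fun v => L / sd * dprox v + dot (2^-1 *: \sum_(i < k.+1) g i) v) (z k).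
Proof.
move=> kN; apply: is_argmin_ext (zP kN).
exists (\sum_(i < k.+1) 2^-1 * (V i - dot (g i) (x i))) => v _.
rewrite -addrA; congr (_ + _); rewrite dotZl dot_suml mulr_sumr -big_split /=.
by apply: eq_bigr => i _; rewrite dotBr; ring.
Qed.

Lemma iterate_in k : (k <= N.+1)%N -> X (x k).
Proof.
case: k => [_|k kN]; first by rewrite xinit; case: x0P.
rewrite xS//; have -> : k.+1%:R / k.+2%:R = 1 - k.+2%:R^-1 :> R.
  by apply/eqP; rewrite eq_sym subr_eq -[X in _ + X]mul1r -mulrDl natr1 mulfV ?pnatr_eq0.
apply: convex_setE => //; first by have [] := zP kN.
  by have [] := yP kN.
by rewrite invr_ge0 ler0n invf_le1 ?ler1n.
Qed.

(** The objective of [z k] with the stochastic values [V i] replaced by the exact [F (x i)]. This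
    shifts it by a constant, so [z k] still minimises it and only gradient noise remains. *)
Let pot k v := L / sd * dprox v +
  \sum_(i < k.+1) 2^-1 * (F (x i) + dot (g i) (v - x i)).

Let pot_growth k v : (k <= N)%N -> X v ->
  pot k (z k) + L / 2 * norm2 (v - z k) ^+ 2 <= pot k v.
Proof.
move=> kN Xv.
have := argmin_growth Xcvx (strongly_convex_dot _ scaled_prox_scvx) (z_argmin kN) Xv.
have E v' : pot k v' = L / sd * dprox v' + dot (2^-1 *: \sum_(i < k.+1) g i) v' +
    \sum_(i < k.+1) 2^-1 * (F (x i) - dot (g i) (x i)).
  rewrite /pot -addrA; congr (_ + _); rewrite dotZl dot_suml mulr_sumr -big_split /=.
  by apply: eq_bigr => i _; rewrite dotBr; ring.
by rewrite !E; lra.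
Qed.

Definition step_noise k := - dot (noise k) (step k) - margin k * norm2 (step k) ^+ 2.

Definition cumulative_noise k :=
  \sum_(i < k.+1) i.+1%:R / 2 * step_noise i +
  \sum_(i < k) i.+1%:R / 2 * dot (noise i.+1) (y i - x i.+1).

Let step_le k v : (k <= N)%N -> X v ->
  F (y k) <= F (x k) + dot (g k) (v - x k) + L * k.+1%:R * norm2 (v - x k) ^+ 2 +
    step_noise k.
Proof.
move=> kN Xv.
have K0 : 0 < L * k.+1%:R by rewrite mulr_gt0.
have := prox_step Xcvx descent K0 (iterate_in (leqW kN)) Xv (yP kN).
rewrite prox_coef_sqr /step_noise /margin /noise /step.
have -> : L ^+ 2 * k.+1%:R / 8 / (L * k.+1%:R) = L / 8.
  by field; rewrite nat1r pnatr_eq0 (gt_eqF L0).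
lra.
Qed.

(** In the induction step, [v] differs from [x k.+1] by [t *: (z k.+1 - z k)]. Weighted by
    [(k+2)/2], the quadratic term with [K = L (k+2)] is exactly [L / 2] times the squared distance
    of [z k.+1] and [z k], which the growth of the potential pays. Bounding [F (y k)] from below by
    the exact tangent at [x k.+1] produces the second kind of noise term. *)
Lemma potential_bound k : (k <= N)%N ->
  k.+1%:R / 2 * F (y k) <= pot k (z k) + cumulative_noise k.
Proof.
elim: k => [_|k IH kN].
  have Xz : X (z 0) by have [] := zP (leq0n N).
  have := step_le (leq0n N) Xz; rewrite /pot /cumulative_noise.
  rewrite !big_ord_recl !big_ord0 /= !addr0 mulr1 xinit.
  (* At [k = 0] there is no earlier growth to use; strong convexity of the prox term itself pays for
     the quadratic. *)
  have H : L / 2 * norm2 (z 0 - x0) ^+ 2 <= L / sd * dprox (z 0).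
    have := ler_wpM2l (_ : 0 <= L / sd) (prox_quadratic Xz).
    rewrite divr_ge0 ?(ltW L0) ?(ltW sd0)// => /(_ isT).
    by rewrite mulrA (_ : L / sd * (sd / 2) = L / 2)//; field; rewrite gt_eqF.
  move: H; lra.
have kN' := ltnW kN.
have Xz : X (z k.+1) by have [] := zP kN.
have Xy : X (y k) by have [] := yP kN'.
have Xx : X (x k.+1) by exact: iterate_in (leqW kN).
have := IH kN'; have := pot_growth kN' Xz.
have := gradient_le_F Xx Xy.
set t : R := k.+2%:R^-1.
have kt : k.+2%:R * t = 1 by rewrite mulfV.
have kt1 : k.+1%:R * t = 1 - t by move: kt; rewrite -(natr1 k.+1); lra.
pose v := t *: z k.+1 + (1 - t) *: y k.
have Xv : X v by apply: convex_setE; rewrite // invr_ge0 ler0n invf_le1 ?ler1n.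
have xE : x k.+1 = t *: z k + (1 - t) *: y k by rewrite xS// kt1.
have vx : v - x k.+1 = t *: (z k.+1 - z k).
  by rewrite xE /v; apply/rowP => i; rewrite !mxE; ring.
have := step_le kN Xv; rewrite vx dotZr norm2Z ger0_norm ?invr_ge0 ?ler0n// exprMn.
have -> : pot k.+1 (z k.+1) = pot k (z k.+1) +
    2^-1 * (F (x k.+1) + dot (g k.+1) (z k.+1 - x k.+1)).
  by rewrite /pot big_ord_recr /= addrA.
have -> : cumulative_noise k.+1 = cumulative_noise k +
    k.+2%:R / 2 * step_noise k.+1 + k.+1%:R / 2 * dot (noise k.+1) (y k - x k.+1).
  by rewrite /cumulative_noise big_ord_recr [X in _ + X = _]big_ord_recr /=; ring.
move=> H1 H2 H3 H4.
have H1' : k.+2%:R * F (y k.+1) <= k.+2%:R * F (x k.+1) +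
    dot (g k.+1) (z k.+1 - z k) + L * norm2 (z k.+1 - z k) ^+ 2 +
    k.+2%:R * step_noise k.+1.
  apply: (le_trans (ler_wpM2l (ler0n R k.+2) H1)).
  set B := dot _ (_ - _); set C := norm2 _ ^+ 2; clearbody B C.
  have -> : k.+2%:R * (F (x k.+1) + t * B + L * k.+2%:R * (t ^+ 2 * C) +
     step_noise k.+1) = k.+2%:R * F (x k.+1) + (k.+2%:R * t) * B +
     L * (k.+2%:R * t) ^+ 2 * C + k.+2%:R * step_noise k.+1 by ring.
  by rewrite kt expr1n mulr1 mul1r.
have H2' : k.+1%:R * (F (x k.+1) + dot (G (x k.+1)) (y k - x k.+1)) <=
  k.+1%:R * F (y k) by rewrite ler_pM2l.
have xE2 : k.+2%:R * dot (g k.+1) (x k.+1) =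
    dot (g k.+1) (z k) + k.+1%:R * dot (g k.+1) (y k).
  rewrite xE dotDr !dotZr mulrDr !mulrA kt mul1r (_ : k.+2%:R * (1 - t) = k.+1%:R)//.
  by move: kt; rewrite -(natr1 k.+1); lra.
rewrite /noise dotBl.
move: H1' H2' xE2 H3 H4; rewrite !dotBr -(natr1 k.+1); lra.
Qed.

(** Two comparisons are chained: [z N] with [zb] in the noisy model, then [zb] with [v] in the exact
    one. Hence [v] is never paired with noise. *)
Lemma pathwise_bound zb v : is_argmin X (fun v => L / sd * dprox v +
      dot (2^-1 *: \sum_(i < N.+1) G (x i)) v) zb -> X v ->
  N.+1%:R / 2 * F (y N) <= L / sd * D +
    2^-1 * \sum_(i < N.+1) (F (x i) + dot (G (x i)) (v - x i)) +
    2^-1 * \sum_(i < N.+1) dot (noise i) (zb - x i) + cumulative_noise N.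
Proof.
move=> [Xzb mzb] Xv; apply: (le_trans (potential_bound (leqnn N))); rewrite lerD2r.
have := pot_growth (leqnn N) Xzb.
have : 0 <= L / 2 * norm2 (zb - z N) ^+ 2 by rewrite mulr_ge0 ?sqr_ge0// divr_ge0// ltW.
have : L / sd * dprox v <= L / sd * D by rewrite ler_pM2l ?d_le// divr_gt0.
have := mzb v Xv; rewrite !dotZl !dot_suml.
have -> : pot N zb = L / sd * dprox zb +
   (2^-1 * \sum_(i < N.+1) F (x i) - 2^-1 * \sum_(i < N.+1) dot (G (x i)) (x i)) +
   2^-1 * \sum_(i < N.+1) dot (G (x i)) zb +
   2^-1 * \sum_(i < N.+1) dot (noise i) (zb - x i).
  rewrite /pot -!addrA; congr (_ + _); rewrite !mulr_sumr -sumrN -!big_split /=.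
  by apply: eq_bigr => i _; rewrite /noise !dotBl !dotBr; ring.
have -> : \sum_(i < N.+1) (F (x i) + dot (G (x i)) (v - x i)) =
   \sum_(i < N.+1) F (x i) - \sum_(i < N.+1) dot (G (x i)) (x i) +
   \sum_(i < N.+1) dot (G (x i)) v.
  rewrite -sumrN -!big_split /=.
  by apply: eq_bigr => i _; rewrite !dotBr; ring.
lra.
Qed.


Lemma prox_coefE k : 2 * prox_coef k = L * (Num.sqrt k.+1%:R / Num.sqrt 2).
Proof. by rewrite /prox_coef; field; rewrite sqrtr_eq0 -ltNge ltr0n. Qed.

(** Variance cost of the weighted noise of step [k], in units of [1 / L]. For [k > 0] it is
    [(k+1)/2] over four times [margin k / L], that is, full absorption; at [k = 0] it comes from
    [noise_split]. *)
Definition step_cost k : R :=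
  if k is 0 then 5 / 8 else k.+1%:R / 2 / (4 * (Num.sqrt k.+1%:R / Num.sqrt 2 - 5 / 8)).

Lemma first_step_noise yb :
  is_argmin X (fun v => dot (G x0) (v - x0) + prox_coef 0 * norm2 (v - x0) ^+ 2) yb ->
  1 / 2 * step_noise 0 <=
    dot (noise 0) (- (5 / 8 * Num.sqrt 2 - 1 / 2) *: (yb - x0)) +
    step_cost 0 / L * norm2 (noise 0) ^+ 2.
Proof.
move=> ybm; have y0m := yP (leq0n N).
have r2 : Num.sqrt 2 ^+ 2 = 2 :> R by rewrite sqr_sqrtr.
have r20 : 0 < Num.sqrt 2 :> R by rewrite sqrtr_gt0.
have rne : Num.sqrt 2 != 0 :> R by rewrite gt_eqF.
have Lne : L != 0 by rewrite gt_eqF.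
have ri : (Num.sqrt 2)^-1 = Num.sqrt 2 / 2 :> R.
  by apply: (mulfI rne); rewrite mulfV// mulrA -expr2 r2 mulfV.
have b0E : 2 * prox_coef 0 = L * (Num.sqrt 2 / 2) by rewrite prox_coefE sqrtr1 div1r ri.
have ss : norm2 (step 0 - (yb - x0)) <= (L * (Num.sqrt 2 / 2))^-1 * norm2 (noise 0).
  have b00 : 0 < 2 * prox_coef 0 by rewrite b0E mulr_gt0// divr_gt0.
  have := argmin_linear_lipschitz b00 Xcvx (@strongly_convex_sqr _ _ X (prox_coef 0) 0)
    (prox_argminE y0m) (prox_argminE ybm).
  by rewrite b0E xinit opprB addrA subrK /step xinit opprB addrA subrK /noise xinit.
have rb1 : 5 / 8 < Num.sqrt 2 / 2 :> R.
  by rewrite ltNge; apply/negP => H; have := r2; rewrite expr2; nra.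
have rb2 : Num.sqrt 2 <= 3 / 2 :> R.
  by rewrite leNgt; apply/negP => H; have := r2; rewrite expr2; nra.
have mE : margin 0 = L * (Num.sqrt 2 / 2 - 5 / 8).
  by rewrite /margin b0E; ring.
have m0 : 0 < margin 0 by rewrite mE mulr_gt0// subr_gt0.
(* The fraction minimising [(1 - th) / b + th^2 / (4 rho)] is [2 rho / b]; for [b = L / sqrt 2] and
   [rho = margin 0] it equals [2 - 5/4 sqrt 2], and the minimum is [5 / 4 / L]. *)
have th : 0 <= (2 - 5 / 4 * Num.sqrt 2 : R) <= 1 by apply/andP; split; lra.
have b0 : 0 < L * (Num.sqrt 2 / 2) by rewrite mulr_gt0// divr_gt0.
have := @noise_split _ _ (step 0) (yb - x0) (noise 0) _ _ _ m0 th b0 ss.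
rewrite dotZr -/(step_noise 0) /step_cost dotZr.
have -> : (1 - (2 - 5 / 4 * Num.sqrt 2)) / (L * (Num.sqrt 2 / 2)) +
   (2 - 5 / 4 * Num.sqrt 2) ^+ 2 / (4 * margin 0) = 5 / 4 / L.
  rewrite mE; set r := Num.sqrt 2 in r2 rb1 rne *.
  have E1 : 2 - 5 / 4 * r = 2 * r * (r / 2 - 5 / 8) by move: r2; rewrite expr2; lra.
  have h0 : r / 2 - 5 / 8 != 0 by rewrite gt_eqF// subr_gt0.
  have -> : (2 - 5 / 4 * r) ^+ 2 / (4 * (L * (r / 2 - 5 / 8))) =
      r ^+ 2 * (r / 2 - 5 / 8) / L.
    by rewrite E1; move: h0; set t := r / 2 - 5 / 8; clearbody t => h0; field; rewrite ?h0 Lne.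
  have -> : (1 - (2 - 5 / 4 * r)) / (L * (r / 2)) = (5 / 2 * r ^+ 2 - 2 * r) / r ^+ 2 / L.
    by field; rewrite rne Lne.
  by rewrite r2; field.
set q := norm2 _ ^+ 2; lra.
Qed.

Lemma later_step_noise k : (0 < k)%N ->
  k.+1%:R / 2 * step_noise k <= step_cost k / L * norm2 (noise k) ^+ 2.
Proof.
case: k => // k _; rewrite /step_cost.
have mE : margin k.+1 = L * (Num.sqrt k.+2%:R / Num.sqrt 2 - 5 / 8).
  by rewrite /margin prox_coefE; ring.
have s0 : 1 <= Num.sqrt k.+2%:R / Num.sqrt 2 :> R.
  by rewrite ler_pdivlMr ?sqrtr_gt0// mul1r ler_sqrt ?ler0n// ler_nat.
set s := Num.sqrt _ / _ in mE s0 *.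
have h0 : 0 < s - 5 / 8 by lra.
have m0 : 0 < margin k.+1 by rewrite mE mulr_gt0.
have := noise_absorbed (step k.+1) (noise k.+1) m0; rewrite -/(step_noise k.+1) mE => H.
have := ler_wpM2l (_ : 0 <= k.+2%:R / 2) H; rewrite divr_ge0// => /(_ isT) {}H.
apply: (le_trans H); rewrite le_eqVlt; apply/orP; left; apply/eqP.
by field; rewrite !gt_eqF//; lra.
Qed.

(** Each of these vectors is determined before batch [k] is drawn, so its product with the noise has
    mean zero; at [k = 0] it is deterministic, [yb] being the prox step with the exact gradient. *)
Definition step_dir (yb : 'rV[R]_n) k :=
  if k is k'.+1 then (k'.+1%:R / 2) *: (y k' - x k'.+1)
  else - (5 / 8 * Num.sqrt 2 - 1 / 2) *: (yb - x0).

Lemma cumulative_noise_le yb :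
  is_argmin X (fun v => dot (G x0) (v - x0) + prox_coef 0 * norm2 (v - x0) ^+ 2) yb ->
  cumulative_noise N <=
    \sum_(k < N.+1) (dot (noise k) (step_dir yb k) + step_cost k / L * norm2 (noise k) ^+ 2).
Proof.
move=> ybm; rewrite /cumulative_noise !big_ord_recl.
rewrite -addrA; apply: lerD; first exact: first_step_noise.
rewrite -big_split; apply: ler_sum => i _; cbv beta; rewrite lift0 [leLHS]addrC; apply: lerD.
  by rewrite /step_dir dotZr.
exact: later_step_noise.
Qed.


Hypothesis G_lipschitz : forall x x' y y', X x -> X x' -> X y -> X y' ->
  dot (G x - G x') (y - y') <= L * norm2 (x - x') * norm2 (y - y').

Lemma sqrt2_bounds : 7 / 5 <= (Num.sqrt 2 : R) <= 3 / 2.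
Proof.
have r2 : Num.sqrt 2 ^+ 2 = 2 :> R by rewrite sqr_sqrtr.
have r20 : 0 <= Num.sqrt 2 :> R by exact: sqrtr_ge0.
by apply/andP; split; rewrite leNgt; apply/negP => H; move: r2; rewrite expr2; nra.
Qed.

Lemma prox_coef0_inv : (2 * prox_coef 0)^-1 = Num.sqrt 2 / L.
Proof.
rewrite prox_coefE sqrtr1; field.
by rewrite gt_eqF//= sqrtr_eq0 -ltNge ltr0n.
Qed.

(* zz is the noise-free value of zb, and zb depends on the first noise only through the
   Lipschitz chain (y 0, z 0) -> x 1 -> zb. *)
Lemma one_step_comparator yb zb0 zz zb :
  is_argmin X (fun v => dot (G x0) (v - x0) + prox_coef 0 * norm2 (v - x0) ^+ 2) yb ->
  is_argmin X (fun v => L / sd * dprox v + dot (2^-1 *: G x0) v) zb0 ->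
  is_argmin X (fun v => L / sd * dprox v +
    dot (2^-1 *: (G x0 + G (2^-1 *: zb0 + 2^-1 *: yb))) v) zz ->
  is_argmin X (fun v => L / sd * dprox v + dot (2^-1 *: (G x0 + G (x 1))) v) zb ->
  2^-1 * dot (noise 0) (zb - x0) <=
    dot (noise 0) (2^-1 *: (zz - x0)) + 4^-1 / L * norm2 (noise 0) ^+ 2.
Proof.
move=> ybm zb0m zzm zbm; have y0m := yP (leq0n N); have z0m := z_argmin (leq0n N).
have [Xyb _] := ybm; have [Xzb0 _] := zb0m; have [Xzz _] := zzm; have [Xzb _] := zbm.
set xb := 2^-1 *: zb0 + 2^-1 *: yb in zzm.
have h2 : 1 - 2^-1 = 2^-1 :> R by field.
have Xxb : X xb.
  by rewrite /xb -[X in _ + X *: _]h2; apply: convex_setE; rewrite // invr_ge0 ler0n invf_le1 ?ler1n.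
have b00 : 0 < 2 * prox_coef 0.
  by rewrite prox_coefE mulr_gt0// divr_gt0 ?sqrtr_gt0.
have dy : norm2 (y 0 - yb) <= Num.sqrt 2 / L * norm2 (noise 0).
  have := argmin_linear_lipschitz b00 Xcvx (@strongly_convex_sqr _ _ X (prox_coef 0) 0)
    (prox_argminE y0m) (prox_argminE ybm).
  by rewrite prox_coef0_inv xinit opprB addrA subrK /noise xinit.
have dz : norm2 (z 0 - zb0) <= L^-1 * (2^-1 * norm2 (noise 0)).
  have := argmin_linear_lipschitz L0 Xcvx scaled_prox_scvx z0m zb0m.
  by rewrite big_ord1 -scalerBr norm2Z ger0_norm ?invr_ge0// /noise xinit.
(* The average of the two preceding constants is [(1/2 + sqrt 2) / 2], at most 1 because
   [sqrt 2 <= 3/2]. *)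
have dx : norm2 (x 1 - xb) <= L^-1 * norm2 (noise 0).
  have -> : x 1 - xb = 2^-1 *: (z 0 - zb0) + 2^-1 *: (y 0 - yb).
    by rewrite xS// div1r /xb !scalerBr opprD addrACA.
  apply: (le_trans (ler_norm2D _ _)); rewrite !norm2Z ger0_norm ?invr_ge0//.
  have /andP[_ r2] := sqrt2_bounds.
  have : Num.sqrt 2 / L * norm2 (noise 0) <= 3 / 2 * (L^-1 * norm2 (noise 0)).
    by rewrite -mulrA ler_wpM2r// mulr_ge0// invr_ge0 ltW.
  have : 0 <= L^-1 * norm2 (noise 0) by rewrite mulr_ge0// invr_ge0 ltW.
  lra.
(* The norm of [G (x 1) - G xb] is not controlled, only its product with [zz - zb]; hence the growth
   form instead of the Lipschitz form. *)
have dzz : norm2 (zb - zz) <= L^-1 * (2^-1 * norm2 (noise 0)).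
  have := argmin_linear_growth Xcvx scaled_prox_scvx zbm zzm.
  rewrite -scalerBr opprD addrACA subrr add0r dotZl.
  have := G_lipschitz (iterate_in (ltn0Sn N)) Xxb Xzz Xzb.
  rewrite (norm2_distC zz).
  have : L * norm2 (x 1 - xb) <= norm2 (noise 0).
    by rewrite -(ler_pM2l (_ : 0 < L^-1)) ?invr_gt0// mulKf ?gt_eqF.
  set e := norm2 (zb - zz); have : 0 <= e by exact: norm2_ge0.
  rewrite le_eqVlt => /orP[/eqP <- _ _ _|e0 H1 H2 H3].
    by rewrite !mulr_ge0// invr_ge0 ltW.
  have : L * norm2 (x 1 - xb) * e <= norm2 (noise 0) * e by rewrite ler_pM2r.
  move=> H4; rewrite -(ler_pM2l L0) mulVKf ?gt_eqF// -(ler_pM2r e0) -mulrA -expr2.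
  lra.
have -> : zb - x0 = (zb - zz) + (zz - x0) by rewrite addrA subrK.
rewrite dotZr dotDr mulrDr addrC lerD2l.
have := cauchy_schwarz (noise 0) (zb - zz).
have : norm2 (noise 0) * norm2 (zb - zz) <= norm2 (noise 0) * (L^-1 * (2^-1 * norm2 (noise 0))).
  by rewrite ler_wpM2l.
lra.
Qed.

(** Cross terms are grouped as the current increment against the sum of the earlier ones, the shape
    whose expectation vanishes for martingale increments. *)
Lemma norm2_sum_sqr (I : nat) (dl : nat -> 'rV[R]_n) :
  norm2 (\sum_(i < I) dl i) ^+ 2 =
  \sum_(i < I) (norm2 (dl i) ^+ 2 + dot (dl i) (2 *: \sum_(j < i) dl j)).
Proof.
elim: I => [|I IH]; first by rewrite !big_ord0 norm2_0 expr0n.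
rewrite big_ord_recr [RHS]big_ord_recr /= -IH !norm2_sqr dotZr.
rewrite dotDl !dotDr (dotC (dl I) (\sum_(i < I) _)); ring.
Qed.

Lemma many_step_comparator zb M : X zb -> (M <= N)%N ->
  2^-1 * \sum_(i < M) dot (noise i) (zb - x i) <=
    (2 - Num.sqrt 2) / 4 * (L / sd * D) +
    \sum_(i < M) (dot (noise i) (2^-1 *: (x0 - x i) +
        ((2 + Num.sqrt 2) / (2 * L)) *: \sum_(j < i) noise j) +
      (2 + Num.sqrt 2) / 4 / L * norm2 (noise i) ^+ 2).
Proof.
move=> Xzb MN; have /andP[_ r2] := sqrt2_bounds.
have Lne : L != 0 by rewrite gt_eqF.
have rr : (2 - Num.sqrt 2) * (2 + Num.sqrt 2) = 2 :> R.
  by rewrite -subr_sqr sqr_sqrtr// -natrX -natrB.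
set r : R := Num.sqrt 2 in r2 rr *.
(* With this Young weight, half of the squared-distance term is [(2 - r) / 4] times [L / 2] times
   the squared distance, the available share of the prox term. The dual weight simplifies because
   [(2 - r) (2 + r) = 2]. *)
have a0 : 0 < (2 - r) / 2 * L by rewrite mulr_gt0// divr_gt0//; lra.
have := dot_young (zb - x0) (\sum_(i < M) noise i) a0.
rewrite norm2_sum_sqr.
have -> : (2 * ((2 - r) / 2 * L))^-1 = (2 + r) / (2 * L).
  have rne : 2 - r != 0 by rewrite gt_eqF//; lra.
  have -> : 2 + r = 2 / (2 - r) by rewrite -[X in _ = X / _]rr mulrAC mulfV// mul1r.
  by field; rewrite rne Lne.
have : L / sd * (sd / 2 * norm2 (zb - x0) ^+ 2) <= L / sd * D.
  apply: ler_wpM2l; first by rewrite divr_ge0 ?ltW.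
  exact: le_trans (prox_quadratic Xzb) (d_le Xzb).
have -> : L / sd * (sd / 2 * norm2 (zb - x0) ^+ 2) = L / 2 * norm2 (zb - x0) ^+ 2.
  by rewrite mulrA (_ : L / sd * (sd / 2) = L / 2)//; field; rewrite gt_eqF.
move=> H1.
have : (2 - r) / 4 * (L / 2 * norm2 (zb - x0) ^+ 2) <= (2 - r) / 4 * (L / sd * D).
  by rewrite ler_wpM2l// divr_ge0//; lra.
have -> : dot (zb - x0) (\sum_(i < M) noise i) = \sum_(i < M) dot (noise i) (zb - x0).
  by rewrite dotC dot_suml.
have -> : \sum_(i < M) dot (noise i) (zb - x i) =
   \sum_(i < M) dot (noise i) (zb - x0) + \sum_(i < M) dot (noise i) (x0 - x i).
  by rewrite -big_split /=; apply: eq_bigr => i _; rewrite -dotDr addrA subrK.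
have -> : \sum_(i < M) (dot (noise i) (2^-1 *: (x0 - x i) +
        ((2 + r) / (2 * L)) *: \sum_(j < i) noise j) +
      (2 + r) / 4 / L * norm2 (noise i) ^+ 2) =
    2^-1 * \sum_(i < M) dot (noise i) (x0 - x i) +
    (2 + r) / 4 / L * (\sum_(i < M) (norm2 (noise i) ^+ 2 +
      dot (noise i) (2 *: \sum_(j < i) noise j))).
  rewrite !mulr_sumr -big_split /=; apply: eq_bigr => i _.
  by rewrite [in LHS]dotDr !dotZr; field.
have -> : (2 + r) / (2 * L) = 2 * ((2 + r) / 4 / L) by field.
lra.
Qed.

(** The test [k == N] comes first: [zb] uses gradients at [x 0, ..., x N] only, so [zb - x N] is
    known before the last batch and costs no variance. For [N = 0] no other case occurs. *)
Definition comparator_dir (zz zb : 'rV[R]_n) k :=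
  if k == N then 2^-1 *: (zb - x k)
  else if N == 1 then 2^-1 *: (zz - x0)
  else 2^-1 *: (x0 - x k) + ((2 + Num.sqrt 2) / (2 * L)) *: \sum_(j < k) noise j.

Definition comparator_cost k : R :=
  if k == N then 0 else if N == 1 then 4^-1 else (2 + Num.sqrt 2) / 4.

Lemma comparator_noise_le yb zb0 zz zb :
  is_argmin X (fun v => dot (G x0) (v - x0) + prox_coef 0 * norm2 (v - x0) ^+ 2) yb ->
  is_argmin X (fun v => L / sd * dprox v + dot (2^-1 *: G x0) v) zb0 ->
  is_argmin X (fun v => L / sd * dprox v +
    dot (2^-1 *: (G x0 + G (2^-1 *: zb0 + 2^-1 *: yb))) v) zz ->
  is_argmin X (fun v => L / sd * dprox v + dot (2^-1 *: \sum_(i < N.+1) G (x i)) v) zb ->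
  2^-1 * \sum_(i < N.+1) dot (noise i) (zb - x i) <=
    (2 - Num.sqrt 2) / 4 * (L / sd * D) +
    \sum_(k < N.+1) (dot (noise k) (comparator_dir zz zb k) +
      comparator_cost k / L * norm2 (noise k) ^+ 2).
Proof.
move=> ybm zb0m zzm zbm; have [Xzb _] := zbm.
have /andP[_ r2] := sqrt2_bounds.
rewrite [in leRHS]big_ord_recr [in leLHS]big_ord_recr mulrDr addrA.
apply: lerD; last first.
  by rewrite /comparator_dir /comparator_cost eqxx !mul0r addr0 dotZr.
have D0 : 0 <= D by rewrite -d_x0 d_le//; case: x0P.
have [N1|N1] := eqVneq N 1; last first.
  apply: (le_trans (many_step_comparator Xzb (leqnn N))); rewrite lerD2l.
  apply: ler_sum => i _; rewrite /comparator_dir /comparator_cost.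
  by rewrite (ltn_eqF (ltn_ord i)) (negbTE N1).
have kD : 0 <= (2 - Num.sqrt 2) / 4 * (L / sd * D).
  by rewrite mulr_ge0// ?mulr_ge0 ?divr_ge0// ?invr_ge0 ?ltW//; lra.
rewrite -[leLHS]add0r; apply: lerD => //.
rewrite /comparator_dir /comparator_cost N1 !big_ord1 /= xinit.
apply: one_step_comparator zb0m zzm _ => //.
by move: zbm; rewrite N1 !big_ord_recl big_ord0 addr0 /= xinit.
Qed.

Lemma total_noise_le yb zb0 zz zb :
  is_argmin X (fun v => dot (G x0) (v - x0) + prox_coef 0 * norm2 (v - x0) ^+ 2) yb ->
  is_argmin X (fun v => L / sd * dprox v + dot (2^-1 *: G x0) v) zb0 ->
  is_argmin X (fun v => L / sd * dprox v +
    dot (2^-1 *: (G x0 + G (2^-1 *: zb0 + 2^-1 *: yb))) v) zz ->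
  is_argmin X (fun v => L / sd * dprox v + dot (2^-1 *: \sum_(i < N.+1) G (x i)) v) zb ->
  2^-1 * \sum_(i < N.+1) dot (noise i) (zb - x i) + cumulative_noise N <=
    (2 - Num.sqrt 2) / 4 * (L / sd * D) +
    \sum_(k < N.+1) (dot (noise k) (comparator_dir zz zb k + step_dir yb k) +
      (comparator_cost k + step_cost k) / L * norm2 (noise k) ^+ 2).
Proof.
move=> ybm zb0m zzm zbm.
have := comparator_noise_le ybm zb0m zzm zbm; have := cumulative_noise_le ybm.
have -> : \sum_(k < N.+1) (dot (noise k) (comparator_dir zz zb k + step_dir yb k) +
      (comparator_cost k + step_cost k) / L * norm2 (noise k) ^+ 2) =
   \sum_(k < N.+1) (dot (noise k) (comparator_dir zz zb k) +
      comparator_cost k / L * norm2 (noise k) ^+ 2) +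
   \sum_(k < N.+1) (dot (noise k) (step_dir yb k) + step_cost k / L * norm2 (noise k) ^+ 2).
  by rewrite -big_split /=; apply: eq_bigr => i _; rewrite dotDr; ring.
lra.
Qed.

End Potential.

(** * Constants *)

Section Constants.
Context (R : realType).
Local Notation r2 := (Num.sqrt 2 : R).

Lemma step_costE k : (0 < k)%N ->
  step_cost R k = k.+1%:R / (4 * r2 * Num.sqrt k.+1%:R - 5).
Proof.
case: k => // k _; rewrite /step_cost.
have h : r2 ^+ 2 = 2 by rewrite sqr_sqrtr.
have r0 : r2 != 0 by rewrite gt_eqF// sqrtr_gt0.
have -> : Num.sqrt k.+2%:R / r2 = r2 * Num.sqrt k.+2%:R / 2.
  by apply: (mulfI r0); rewrite mulrCA mulfV// mulr1 !mulrA -expr2 h; field.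
have -> : 4 * (r2 * Num.sqrt k.+2%:R / 2 - 5 / 8) = (4 * r2 * Num.sqrt k.+2%:R - 5) / 2.
  by field.
by rewrite invfM invrK mulrACA mulVf// mulr1.
Qed.

Let sqrt_le_r (a b : R) : 0 <= b -> a <= b ^+ 2 -> Num.sqrt a <= b.
Proof. by move=> b0 ab; rewrite -[leRHS]ger0_norm// -sqrtr_sqr ler_sqrt// sqr_ge0. Qed.

Let sqrt_ge_r (a b : R) : 0 <= a -> 0 <= b -> b ^+ 2 <= a -> b <= Num.sqrt a.
Proof. by move=> a0 b0 ab; rewrite -[leLHS]ger0_norm// -sqrtr_sqr ler_sqrt. Qed.

(** Rational bounds sharp enough for the tight case [N = 2] of the budget. *)
Let r2_bounds : 41 / 29 <= r2 <= 17 / 12.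
Proof. by apply/andP; split; [apply: sqrt_ge_r|apply: sqrt_le_r]; lra. Qed.

Let r3_bounds : 71 / 41 <= Num.sqrt (3 : R).
Proof. by apply: sqrt_ge_r; lra. Qed.

Let cost1 : step_cost R 1 = 2 / 3.
Proof.
rewrite step_costE// -mulrA -expr2 sqr_sqrtr//; congr (_ / _); lra.
Qed.

Let cost2 : step_cost R 2 <= 63 / 100.
Proof.
rewrite step_costE//.
have /andP[h1 _] := r2_bounds; have h2 := r3_bounds.
have H : 41 / 29 * (71 / 41) <= r2 * Num.sqrt (3 : R) by apply: ler_pM; lra.
by rewrite ler_pdivrMr; lra.
Qed.

Let cost3 k : (3 <= k)%N -> step_cost R k <= Num.sqrt k.+1%:R / 3.
Proof.
move=> k3; rewrite step_costE ?(leq_trans _ k3)//.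
have /andP[h1 _] := r2_bounds.
have h2 : 2 <= Num.sqrt k.+1%:R :> R.
  by rewrite sqrt_ge_r// -natrX ler_nat.
have h3 : Num.sqrt k.+1%:R ^+ 2 = k.+1%:R :> R by rewrite sqr_sqrtr.
move: h2 h3; set u : R := Num.sqrt k.+1%:R; move=> h2 h3; rewrite -h3.
have H : 41 / 29 * u <= r2 * u by rewrite ler_pM2r; lra.
have H0 : 0 < 4 * r2 * u - 5 by lra.
rewrite ler_pdivrMr//.
have H2 : 3 * u <= 4 * r2 * u - 5 by lra.
have u0 : 0 <= u by lra.
by have := ler_wpM2l u0 H2; rewrite expr2; lra.
Qed.

(** With [u = sqrt (N+1)] and [w = sqrt N], the bound [w <= u - 1/(2u)] gives
    [u^3 - w^3 >= 3u/2 - 1/(2u) >= 13/10 u]. Divided by [sqrt 2], this exceeds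
    [u / 3 + (2 + sqrt 2)/4] as soon as [u >= 2]. *)
Let budget_step N : (3 <= N)%N ->
  N%:R * Num.sqrt N%:R / r2 + step_cost R N + (2 + r2) / 4 <=
  N.+1%:R * Num.sqrt N.+1%:R / r2.
Proof.
move=> N3; apply: (le_trans (lerD (lerD (lexx _) (cost3 N3)) (lexx _))).
have r0 : 0 < r2 by rewrite sqrtr_gt0.
have h : r2 ^+ 2 = 2 by rewrite sqr_sqrtr.
have -> : r2^-1 = r2 / 2.
  by apply: (mulfI (lt0r_neq0 r0)); rewrite mulfV ?gt_eqF// mulrA -expr2 h mulfV.
have hN : Num.sqrt N%:R ^+ 2 = N%:R :> R by rewrite sqr_sqrtr.
have hN1 : Num.sqrt N.+1%:R ^+ 2 = N.+1%:R :> R by rewrite sqr_sqrtr.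
have u2 : 2 <= Num.sqrt N.+1%:R :> R by rewrite sqrt_ge_r// -natrX ler_nat.
have w0 : 0 <= Num.sqrt N%:R :> R by exact: sqrtr_ge0.
move: hN hN1 u2 w0; set u : R := Num.sqrt N.+1%:R; set w : R := Num.sqrt N%:R.
move=> hN hN1 u2 w0; have E : N.+1%:R = w ^+ 2 + 1 by rewrite hN natr1.
rewrite E -hN; rewrite {}E in hN1; clearbody u w; rename hN1 into uw.
have wu : w * (2 * u) <= 2 * u ^+ 2 - 1.
  rewrite -ler_sqr ?nnegrE; [|by rewrite mulr_ge0//; lra|by nra].
  rewrite exprMn; have -> : w ^+ 2 = u ^+ 2 - 1 by lra.
  have : 0 <= u ^+ 2 by exact: sqr_ge0.
  nra.
have key : 13 / 10 * u <= (w ^+ 2 + 1) * u - w ^+ 2 * w.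
  have -> : w ^+ 2 = u ^+ 2 - 1 by lra.
  have : (u ^+ 2 - 1) * (w * (2 * u)) <= (u ^+ 2 - 1) * (2 * u ^+ 2 - 1).
    by apply: ler_wpM2l => //; nra.
  have u0 : 0 < u by lra.
  move=> H; rewrite -(ler_pM2r (_ : 0 < 2 * u)); last lra.
  nra.
have /andP[h1 h2] := r2_bounds.
have : 13 / 10 * u * (41 / 58) <= ((w ^+ 2 + 1) * u - w ^+ 2 * w) * (r2 / 2).
  by apply: ler_pM; lra.
lra.
Qed.

Lemma step_cost_ge0 k : 0 <= step_cost R k.
Proof.
case: k => [|k]; first by rewrite divr_ge0.
rewrite step_costE// divr_ge0// subr_ge0.
have h : r2 * r2 = 2 by rewrite -expr2 sqr_sqrtr.
have : r2 * r2 <= r2 * Num.sqrt k.+2%:R.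
  by rewrite ler_wpM2l ?sqrtr_ge0// ler_sqrt// ler_nat.
by rewrite h; lra.
Qed.

Lemma comparator_cost_ge0 N k : 0 <= comparator_cost R N k.
Proof.
rewrite /comparator_cost; case: ifP => // _; case: ifP => _; first by rewrite invr_ge0.
by rewrite divr_ge0// addr_ge0// sqrtr_ge0.
Qed.

(** [N = 0] and [N = 1] are numerical, as [comparator_cost] is special there. The induction starts
    at [N = 2]; each further index adds one step cost and one comparator cost, which [budget_step]
    covers. *)
Lemma noise_budget N :
  \sum_(k < N.+1) (comparator_cost R N k + step_cost R k) <=
    N.+1%:R * Num.sqrt N.+1%:R / r2.
Proof.
have /andP[h1 h2] := r2_bounds.
have r0 : 0 < r2 by rewrite sqrtr_gt0.
have h : r2 ^+ 2 = 2 by rewrite sqr_sqrtr.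
case: N => [|[|N]].
- rewrite big_ord1 /comparator_cost/= add0r sqrtr1 mulr1 ler_pdivlMr//; lra.
- rewrite big_ord_recr big_ord1.
  rewrite [step_cost R (widen_ord _ _)](_ : _ = 5 / 8)// [step_cost R ord_max]cost1.
  by rewrite /comparator_cost /= -mulrA mulfV ?gt_eqF//; lra.
rewrite big_split /=.
have -> : \sum_(i < N.+3) comparator_cost R N.+2 i = N.+2%:R * ((2 + r2) / 4).
  rewrite big_ord_recr /= {2}/comparator_cost eqxx addr0.
  rewrite (eq_bigr (fun=> (2 + r2) / 4)) ?sumr_const ?card_ord ?mulr_natl//.
  by move=> i _; rewrite /comparator_cost (ltn_eqF (ltn_ord i)).
elim: N => [|N IH].
  have -> : \sum_(k < 3) step_cost R k = 5 / 8 + step_cost R 1 + step_cost R 2.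
    by rewrite !big_ord_recr big_ord0 /= add0r.
  rewrite cost1; have H := cost2; have h3 := r3_bounds.
  have -> : 3 * Num.sqrt 3 / r2 = 3 / 2 * (r2 * Num.sqrt (3 : R)).
    have -> : r2^-1 = r2 / 2.
      by apply: (mulfI (lt0r_neq0 r0)); rewrite mulfV ?gt_eqF// mulrA -expr2 h mulfV.
    by field.
  have : 41 / 29 * (71 / 41) <= r2 * Num.sqrt (3 : R) by apply: ler_pM; lra.
  lra.
have H := @budget_step N.+3 isT.
have -> : \sum_(k < N.+4) step_cost R k = \sum_(k < N.+3) step_cost R k + step_cost R N.+3.
  by rewrite big_ord_recr.
have -> : N.+3%:R * ((2 + r2) / 4) = N.+2%:R * ((2 + r2) / 4) + (2 + r2) / 4.
  by rewrite -(natr1 N.+2) mulrDl mul1r.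
lra.
Qed.

End Constants.

(** * The smoothing parameter and the rate *)

Section Rate.
Context (R : realType).
Variables (nA Om sigma som sd D Lf : R) (N m : nat).
Hypotheses (nA0 : 0 < nA) (Om0 : 0 < Om) (sigma0 : 0 < sigma) (som0 : 0 < som).
Hypotheses (sd0 : 0 < sd) (D0 : 0 < D) (Lf0 : 0 <= Lf) (m0 : (0 < m)%N).
Hypothesis mP : batch_size_arg nA Om sigma som N <= m%:R.
Local Notation r2 := (Num.sqrt 2 : R).
Let mu := mu_param nA Om sigma som sd D N m.
Let L := Lf + nA ^+ 2 / (mu * som).
Let c := 6 - r2.

Let r2_sqr : r2 ^+ 2 = 2. Proof. by rewrite sqr_sqrtr. Qed.
Let c0 : 0 < c.
Proof. by rewrite subr_gt0 ltNge; apply/negP => h; have := r2_sqr; rewrite expr2; nra. Qed.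
Let a0 : 0 < N.+1%:R :> R. Proof. by rewrite ltr0n. Qed.
Let M0 : 0 < m%:R :> R. Proof. by rewrite ltr0n. Qed.

Lemma mu_param_gt0 : 0 < mu.
Proof.
rewrite /mu /mu_param; repeat (first [apply: divr_gt0 | apply: mulr_gt0 | rewrite sqrtr_gt0 | apply: addr_gt0 | rewrite exprn_gt0 // | by rewrite ltr0n]) => //.
Qed.

(** Bounding [1 / L] by [mu * som / nA ^+ 2] turns the left side into [alpha mu + beta / mu] plus a
    term in [Lf]. [mu_param] makes the first two equal, hence their sum minimal. The lower bound on
    [m] gives [S <= 2 * (M * nA ^+ 2 * Om)]: variance contributes to [alpha] no more than smoothing
    does. *)
Lemma rate_bound :
  mu * Om + 2 / N.+1%:R * (c / 4 * (L / sd * D) +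
    N.+1%:R * Num.sqrt N.+1%:R / r2 / L * (sigma ^+ 2 / m%:R)) <=
  2 * nA * Num.sqrt (c * D * Om) / Num.sqrt (N.+1%:R * sd * som) +
    c * Lf * D / (N.+1%:R * sd).
Proof.
have mu0 := mu_param_gt0; have ms0 : 0 < mu * som by rewrite mulr_gt0.
have b0 : 0 < Num.sqrt N.+1%:R :> R by rewrite sqrtr_gt0.
have b2 : Num.sqrt N.+1%:R ^+ 2 = N.+1%:R :> R by rewrite sqr_sqrtr.
have r2N : Num.sqrt (2 * N.+1%:R) = r2 * Num.sqrt N.+1%:R by rewrite sqrtrM.
have a0' := a0; have M0' := M0; have mP' := mP; rewrite /batch_size_arg in mP'.
set a : R := N.+1%:R in a0' b0 b2 mP' r2N *; set M : R := m%:R in M0' mP' *.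
set b := Num.sqrt a in b0 b2 mP' r2N *.
have S0 : 0 < M * nA ^+ 2 * Om + r2 * b * som * sigma ^+ 2.
  by rewrite addr_gt0// !mulr_gt0// exprn_gt0.
set S := M * nA ^+ 2 * Om + r2 * b * som * sigma ^+ 2 in S0.
have SM : S <= 2 * (M * nA ^+ 2 * Om).
  move: mP'; rewrite ler_pdivrMr ?mulr_gt0 ?exprn_gt0//.
  by rewrite /S; lra.
have p2 : Num.sqrt (c * M * D) ^+ 2 = c * M * D by rewrite sqr_sqrtr// !mulr_ge0// ltW.
have q2 : Num.sqrt (2 * a * sd * som) ^+ 2 = 2 * a * sd * som.
  by rewrite sqr_sqrtr// !mulr_ge0// ltW.
have s2 : Num.sqrt S ^+ 2 = S by rewrite sqr_sqrtr// ltW.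
have p0 : 0 < Num.sqrt (c * M * D) by rewrite sqrtr_gt0 !mulr_gt0.
have q0 : 0 < Num.sqrt (2 * a * sd * som) by rewrite sqrtr_gt0 !mulr_gt0.
have s0 : 0 < Num.sqrt S by rewrite sqrtr_gt0.
have muE : mu = nA ^+ 2 * Num.sqrt (c * M * D) / (Num.sqrt (2 * a * sd * som) * Num.sqrt S).
  by rewrite /mu /mu_param -/a -/M r2N.
move: muE p2 q2 s2 p0 q0 s0; set p := Num.sqrt (c * M * D).
set q := Num.sqrt (2 * a * sd * som); set s := Num.sqrt S => muE p2 q2 s2 p0 q0 s0.
clearbody p q s; clearbody b; clearbody a M.
have nz : [/\ p != 0, q != 0, s != 0, M != 0 & a != 0] by rewrite !gt_eqF.
have [pn qn sn Mn an] := nz.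
have nz' : [/\ nA != 0, som != 0, sd != 0, r2 != 0 & mu != 0] by rewrite !gt_eqF.
have [nn on dn rn mn] := nz'.
have L0 : 0 < L by rewrite ltr_wpDl// divr_gt0// exprn_gt0.
have Ln : L != 0 by rewrite gt_eqF.
have H1 : 2 / a * (a * b / r2 / L * (sigma ^+ 2 / M)) <=
    mu * (r2 * b * som * sigma ^+ 2 / (M * nA ^+ 2)).
  have -> : mu * (r2 * b * som * sigma ^+ 2 / (M * nA ^+ 2)) =
      r2 * b * sigma ^+ 2 / M * (mu * som / nA ^+ 2) by field; rewrite Mn nn.
  have -> : 2 / a * (a * b / r2 / L * (sigma ^+ 2 / M)) = r2 * b * sigma ^+ 2 / M * L^-1.
    by rewrite -[X in X / a]r2_sqr; field; rewrite ?an ?rn ?Mn ?Ln.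
  apply: ler_wpM2l; first by rewrite divr_ge0 ?mulr_ge0 ?sqr_ge0 ?ltW.
  rewrite -[leRHS]invrK lef_pV2 ?posrE ?invr_gt0 ?divr_gt0 ?exprn_gt0//.
  by rewrite invf_div /L lerDr.
have H2 : mu * Om + mu * (r2 * b * som * sigma ^+ 2 / (M * nA ^+ 2)) = p * s / (q * M).
  have -> : mu * Om + mu * (r2 * b * som * sigma ^+ 2 / (M * nA ^+ 2)) =
      mu * S / (M * nA ^+ 2) by rewrite /S; field; rewrite Mn nn.
  by rewrite -s2 muE; field; rewrite ?qn ?sn ?nn ?Mn.
have H3 : 2 / a * (c / 4 * (L / sd * D)) = p * s / (q * M) + c * Lf * D / (2 * (a * sd)).
  have -> : 2 / a * (c / 4 * (L / sd * D)) =
      c * D * nA ^+ 2 / (mu * (2 * a * sd * som)) + c * Lf * D / (2 * (a * sd)).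
    by rewrite /L; field; rewrite ?an ?mn ?on ?dn.
  congr (_ + _); rewrite -q2.
  have -> : c * D = p ^+ 2 / M by rewrite p2; field; rewrite Mn.
  by rewrite muE; field; rewrite ?qn ?sn ?nn ?Mn ?pn.
have H4 : p * s / (q * M) <= nA * Num.sqrt (c * D * Om) / Num.sqrt (a * sd * som).
  rewrite -ler_sqr ?nnegrE; [|by rewrite divr_ge0 ?mulr_ge0// ltW|
    by rewrite divr_ge0 ?mulr_ge0 ?sqrtr_ge0// ltW].
  rewrite !expr_div_n !exprMn p2 s2 q2 !sqr_sqrtr; try by rewrite !mulr_ge0// ltW.
  have -> : c * M * D * S / (2 * a * sd * som * M ^+ 2) =
     (c * D / (a * sd * som)) * (S / (2 * M)) by field; rewrite ?an ?dn ?on ?Mn.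
  have -> : nA ^+ 2 * (c * D * Om) / (a * sd * som) =
     (c * D / (a * sd * som)) * (nA ^+ 2 * Om) by field; rewrite ?an ?dn ?on.
  apply: ler_wpM2l; first by rewrite divr_ge0 ?mulr_ge0 ?ltW.
  rewrite ler_pdivrMr ?mulr_gt0//; lra.
have H5 : c * Lf * D / (2 * (a * sd)) <= c * Lf * D / (a * sd).
  have -> : c * Lf * D / (2 * (a * sd)) = (c * Lf * D / (a * sd)) / 2 by field; rewrite ?an ?dn.
  have : 0 <= c * Lf * D / (a * sd) by rewrite divr_ge0 ?mulr_ge0// ltW.
  lra.
rewrite mulrDr.
have -> : 2 * nA * Num.sqrt (c * D * Om) / Num.sqrt (a * sd * som) =
  2 * (nA * Num.sqrt (c * D * Om) / Num.sqrt (a * sd * som)) by rewrite !mulrA.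
lra.
Qed.

End Rate.

Lemma iteration_bound (R : realType) (a b eps : R) (M : nat) :
  (0 < M)%N -> 0 < eps -> a ^+ 2 / eps ^+ 2 + 2 * b / eps <= M%:R ->
  a / Num.sqrt M%:R + b / M%:R <= eps.
Proof.
move=> M0 e0 H; have t0 : 0 < Num.sqrt M%:R :> R by rewrite sqrtr_gt0 ltr0n.
have t2 : Num.sqrt M%:R ^+ 2 = M%:R :> R by rewrite sqr_sqrtr.
move: t0 t2; set t : R := Num.sqrt M%:R; move=> t0 t2; rewrite -t2 in H *.
have -> : a / t + b / t ^+ 2 = (a * t + b) / t ^+ 2 by field; rewrite gt_eqF.
rewrite ler_pdivrMr ?exprn_gt0//.
have : (a ^+ 2 / eps ^+ 2 + 2 * b / eps) * eps ^+ 2 <= t ^+ 2 * eps ^+ 2.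
  by rewrite ler_pM2r ?exprn_gt0.
have -> : (a ^+ 2 / eps ^+ 2 + 2 * b / eps) * eps ^+ 2 = a ^+ 2 + 2 * b * eps.
  by field; rewrite gt_eqF.
(* After multiplication by [t^2] the claim is [a t + b <= eps t^2], and
   [2 a eps t <= a^2 + eps^2 t^2] reduces it to [H1]. *)
move=> H1; rewrite -(ler_pM2l e0); have := sqr_ge0 (a - eps * t); nra.
Qed.

(** * Borel vectors *)

Section BorelVectors.
Context (R : realType) (n : nat) (d : measure_display) (T : measurableType d).
Implicit Types (f q : T -> 'rV[R]_n) (O : set 'rV[R]_n).

Lemma open_norm2P O : open O <->
  forall v, O v -> exists2 e, 0 < e & forall u, norm2 (u - v) < e -> O u.
Proof.
split=> [oO v Ov|H].
  have /nbhs_ballP[e /= e0 eO] : nbhs v O by exact: open_nbhs_nbhs.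
  exists e => // u uv; apply: eO; rewrite -ball_normE /= distrC.
  exact: le_lt_trans (mx_norm_le_norm2 _) uv.
rewrite openE => v Ov; have [e e0 eO] := H v Ov.
apply/nbhs_ballP; exists (e / (Num.sqrt n%:R + 1)) => /=.
  by rewrite divr_gt0// ltr_wpDl.
move=> u; rewrite -ball_normE /= distrC ltr_pdivlMr ?ltr_wpDl// => uv.
apply: eO; apply: le_lt_trans uv; apply: (le_trans (norm2_le_mx_norm _)).
by rewrite mulrC ler_wpM2l// lerDl.
Qed.

Lemma measurable_open_preimage f O : open O ->
  measurable_fun setT (f : T -> borelV R n) -> measurable (f @^-1` O).
Proof.
move=> oO mf; rewrite -[X in measurable X]setTI; apply: mf => //.
exact: sub_sigma_algebra.
Qed.

Lemma measurable_coord f j : measurable_fun setT (f : T -> borelV R n) ->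
  measurable_fun setT (fun w => f w 0 j).
Proof.
move=> mf; apply: (measurability _ (RGenOInfty.measurableE R)) => // _ [_ [x ->] <-].
rewrite setTI [X in measurable X](_ : _ = f @^-1` [set v | x < v 0 j]); last first.
  by apply/seteqP; split => w /=; rewrite in_itv/= andbT.
apply: measurable_open_preimage => //.
apply/open_norm2P => v /= xv; exists (v 0 j - x); first by rewrite subr_gt0.
move=> u uv; have := le_lt_trans (coord_le_norm2 (u - v) j) uv.
by rewrite !mxE ltr_norml => /andP[]; lra.
Qed.

(** The Borel structure is generated by open sets, so a countable base is needed: an open set is the
    union of the boxes with rational centre and radius [1 / (k+1)] that it contains. *)
Lemma measurable_rV f : (forall j, measurable_fun setT (fun w => f w 0 j)) ->
  measurable_fun setT (f : T -> borelV R n).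
Proof.
move=> mf; have near_rat (a b r h : R) : `|a - r| < h -> `|b - r| < h -> `|b - a| <= 2 * h.
  by rewrite !ltr_norml ler_norml; lra.
apply: (@measurability _ _ T (borelV R n) setT f (@open _) erefl) => _ [B oB <-].
rewrite setTI.
pose box (i : {ffun 'I_n -> rat} * nat) : set 'rV[R]_n :=
  [set v | forall j, `|v 0 j - ratr (i.1 j)| < i.2.+1%:R^-1].
pose I := [set i | box i `<=` B].
have -> : f @^-1` B = \bigcup_i (if `[< I i >] then f @^-1` box i else set0).
  rewrite eqEsubset; split => [w /= Bw|w [i _]]; last first.
    by case: ifPn => // /asboolP Ii; exact: Ii.
  have [e e0 eB] := (open_norm2P B).1 oB _ Bw.
  (* A point of the chosen box is within [2 / (k+1)] of [f w] in each coordinate, and passing to the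
     Euclidean norm costs [sqrt n]. *)
  pose e' := e / (Num.sqrt n%:R + 1) / 2.
  have e'0 : 0 < e' by rewrite !divr_gt0// ltr_wpDl.
  have [k ke] : exists k : nat, k.+1%:R^-1 < e'.
    exists (Num.truncn (e'^-1)); rewrite -[ltRHS]invrK ltf_pV2 ?posrE ?invr_gt0//.
    by rewrite real_truncnS_gt ?num_real.
  have rj j : exists r : rat, `|f w 0 j - ratr r| < k.+1%:R^-1.
    have lt_k : f w 0 j - k.+1%:R^-1 < f w 0 j + k.+1%:R^-1.
      by rewrite ltrD2l gtrN ?invr_gt0.
    have [r] := rat_in_itvoo lt_k.
    rewrite in_itv /= => /andP[r1 r2]; exists r.
    by rewrite ltr_distlC r1.
  pose c := [ffun j => projT1 (cid (rj j))].
  have cP j : `|f w 0 j - ratr (c j)| < k.+1%:R^-1.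
    by rewrite /c ffunE; case: cid.
  exists (c, k) => //; case: ifPn => [_ j|/asboolP[]]; first exact: cP.
  move=> u uP; apply: eB; apply: le_lt_trans (norm2_le_mx_norm _) _.
  have : `|u - f w| <= 2 * k.+1%:R^-1.
    rewrite [leLHS]/Num.norm/= mx_normrE; apply/bigmax_leP.
    split => [/=|[i j] _]; first by rewrite mulr_ge0// invr_ge0.
    rewrite (ord1 i) !mxE /=; exact: near_rat (cP j) (uP j).
  move=> /(@ler_wpM2l _ (Num.sqrt n%:R))-/(_ (sqrtr_ge0 _)) H.
  apply: (le_lt_trans H).
  have : Num.sqrt n%:R * (2 * k.+1%:R^-1) <= Num.sqrt n%:R * (2 * e') :> R.
    by rewrite ler_wpM2l// ler_pM2l// ltW.
  move=> {}H; apply: (le_lt_trans H).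
  have -> : e = (Num.sqrt n%:R + 1) * (2 * e').
    by rewrite /e'; field; rewrite gt_eqF// ltr_wpDl.
  by rewrite ltr_pM2r ?mulr_gt0// ltrDl.
apply: countable_bigcupT_measurable; first exact: countableP.
move=> i; case: ifP => // _.
have -> : f @^-1` box i = \bigcap_(j in [set: 'I_n])
    (fun w => f w 0 j) @^-1` [set x | `|x - ratr (i.1 j)| < i.2.+1%:R^-1].
  by rewrite eqEsubset; split => w /= H j; [move=> _|]; exact: H.
apply: fin_bigcap_measurable => [|j _]; first exact: finite_finset.
rewrite -[X in measurable X]setTI; apply: mf => //; apply: open_measurable.
have -> : [set x : R | `|x - ratr (i.1 j)| < i.2.+1%:R^-1] =
    ball (ratr (i.1 j) : R) (i.2.+1%:R^-1).
  by rewrite -ball_normE; apply/seteqP; split => x /=; rewrite distrC.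
by apply: ball_open; rewrite invr_gt0.
Qed.

(** The hypothesis makes [y] a lower semicontinuous function of [q] without exhibiting that
    function: each set where [y > x] is the preimage under [q] of a union of open balls. Minimisers
    become measurable this way with no selection theorem. *)
Lemma measurable_of_modulus q (y : T -> R) :
  measurable_fun setT (q : T -> borelV R n) ->
  (forall w0 e, 0 < e -> exists2 dl, 0 < dl &
     forall w, norm2 (q w - q w0) < dl -> y w0 - e < y w) ->
  measurable_fun setT y.
Proof.
move=> mq H; apply: (measurability _ (RGenOInfty.measurableE R)) => // _ [_ [x ->] <-].
rewrite setTI.
pose O := [set v : 'rV[R]_n | exists w0 dl, [/\ 0 < dl,
   forall w, norm2 (q w - q w0) < dl -> x < y w & norm2 (v - q w0) < dl]].
have -> : y @^-1` `]x, +oo[%classic = q @^-1` O.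
  rewrite eqEsubset; split => w /=; rewrite in_itv/= andbT; last first.
    by move=> [w0 [dl [_ + ?]]]; exact.
  move=> xy.
  have [|dl dl0 dlP] := H w (y w - x); first by rewrite subr_gt0.
  exists w, dl; split => //; last by rewrite subrr norm2_0.
  by move=> w' /dlP; lra.
apply: measurable_open_preimage => //; apply/open_norm2P => v [w0 [dl [dl0 dlP vd]]].
exists (dl - norm2 (v - q w0)); first by rewrite subr_gt0.
move=> u uv; exists w0, dl; split => //.
have -> : u - q w0 = (u - v) + (v - q w0) by rewrite addrA subrK.
by apply: le_lt_trans (ler_norm2D _ _) _; lra.
Qed.

Lemma measurable_of_lipschitz q (y : T -> R) (C : R) :
  measurable_fun setT (q : T -> borelV R n) ->
  (forall w w0, `|y w - y w0| <= C * norm2 (q w - q w0)) -> measurable_fun setT y.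
Proof.
move=> mq yC; apply: (measurable_of_modulus mq) => w0 e e0.
have C0 : 0 < `|C| + 1 by rewrite ltr_wpDl.
exists (e / (`|C| + 1)); first by rewrite divr_gt0.
move=> w; rewrite ltr_pdivlMr// => H.
have := yC w w0; rewrite ler_norml => /andP[H1 _].
have : C * norm2 (q w - q w0) <= `|C| * norm2 (q w - q w0) by rewrite ler_wpM2r// ler_norm.
have := norm2_ge0 (q w - q w0).
lra.
Qed.

Lemma measurable_rV_of_lipschitz p q (y : T -> 'rV[R]_p) (C : R) :
  measurable_fun setT (q : T -> borelV R n) ->
  (forall w w0, norm2 (y w - y w0) <= C * norm2 (q w - q w0)) ->
  forall j, measurable_fun setT (fun w => y w 0 j).
Proof.
move=> mq yC j; apply: (measurable_of_lipschitz mq (C := C)) => w w0.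
by have := coord_le_norm2 (y w - y w0) j; rewrite !mxE => /le_trans; apply.
Qed.

End BorelVectors.

(** * Independence of the past *)

Section GeneratedSigmaAlgebra.
Context (d d' : measure_display) (T : measurableType d) (V : measurableType d').
Context (I : finType) (Z : I -> {mfun T >-> V}).
Implicit Types (J : {set I}).

Definition sample_events J : set (set T) :=
  [set E | exists i B, [/\ i \in J, measurable B & E = Z i @^-1` B]].

(** The sigma-algebra of a set of samples, as a second measurable structure on the carrier [T];
    depending on the past is then plain measurability from [sampleT J]. *)
Definition sampleT J := g_sigma_algebraType (sample_events J).

Lemma sample_events_measurable J : <<s sample_events J >> `<=` @measurable d T.
Proof.
apply: smallest_sub; first exact: sigma_algebra_measurable.
move=> _ [i [B [_ mB ->]]].
by rewrite -[X in measurable X]setTI; exact: (measurable_funPT (Z i)).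
Qed.

Lemma sampleT_measurable d2 (W : measurableType d2) J (f : T -> W) :
  measurable_fun setT (f : sampleT J -> W) -> measurable_fun setT f.
Proof.
move=> mf _ B mB; apply: (@sample_events_measurable J).
exact: (mf measurableT B mB).
Qed.

Lemma sampleT_mono d2 (W : measurableType d2) J J' (f : T -> W) : J \subset J' ->
  measurable_fun setT (f : sampleT J -> W) ->
  measurable_fun setT (f : sampleT J' -> W).
Proof.
move=> JJ' mf _ B mB; have := mf measurableT B mB.
apply: smallest_sub; first exact: smallest_sigma_algebra.
move=> E [i [C [iJ mC ->]]]; apply: sub_sigma_algebra; exists i, C; split => //.
exact: (fintype.subsetP JJ').
Qed.

Lemma sample_measurable J i : i \in J -> measurable_fun setT (Z i : sampleT J -> V).
Proof.
move=> iJ _ B mB; rewrite setTI; apply: sub_sigma_algebra.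
by exists i, B.
Qed.

End GeneratedSigmaAlgebra.

Section Independence.
Context (R : realType) (d d' : measure_display).
Context (T : measurableType d) (V : measurableType d') (P : probability T R).
Context (I : finType) (xi : {RV P >-> V}) (Z : I -> {RV P >-> V}).
Hypothesis iidZ : iid_copies xi Z.

(** Uniqueness of measures on a pi-system: [P] restricted to the event of [Z i] and [P] scaled by
    the mass of that event agree on finite intersections of sample events of [J]. There, equality is
    mutual independence used for [i |: J] and for [J]. *)
Let indep (J : {set I}) (i : I) (E : set T) (B : set V) : i \notin J ->
  <<s sample_events Z J >> E -> measurable B ->
  P (E `&` Z i @^-1` B) = (P E * P (Z i @^-1` B))%E.
Proof.
move=> iJ; have [mut _] := iidZ => + mB.
have mZ : measurable (Z i @^-1` B).
  by rewrite -[X in measurable X]setTI; exact: (measurable_funPT (Z i)).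
have PZ : P (Z i @^-1` B) \is a fin_num by rewrite fin_num_measure.
pose G := [set E : set T | exists C : I -> set V, (forall j, measurable (C j)) /\
  E = \bigcap_(j in [set j | j \in J]) Z j @^-1` C j].
have GT : G setT.
  exists (fun=> setT); split => //; apply/seteqP; split => w //= _ j _.
have Gm : G `<=` measurable.
  move=> _ [C [mC ->]]; apply: fin_bigcap_measurable => [|j _].
    exact: finite_finset.
  by rewrite -[X in measurable X]setTI; exact: (measurable_funPT (Z j)).
have r0 : 0 <= fine (P (Z i @^-1` B)) by rewrite fine_ge0.
pose m1 := [the {measure set T -> \bar R} of mrestr P mZ].
pose m2 := [the {measure set T -> \bar R} of mscale (NngNum r0) P].
have m12 : forall E, <<s G >> E -> m1 E = m2 E.
  apply: (g_sigma_algebra_measure_unique G Gm (fun=> setT)) => //.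
  - by rewrite bigcup_const//; exists 0%N.
  - move=> _ _ [C [mC ->]] [C' [mC' ->]]; exists (fun j => C j `&` C' j); split.
      by move=> j; exact: measurableI.
    by rewrite -bigcapI.
  - move=> _ [C [mC ->]].
    rewrite /m1 /m2 /= /mrestr /mscale /= fineK//.
    pose C' j := if j == i then B else C j.
    have mC' j : measurable (C' j) by rewrite /C'; case: ifP.
    have CJ j : j \in J -> C' j = C j.
      by move=> jJ; rewrite /C'; case: eqVneq jJ iJ => // -> ->.
    have -> : \bigcap_(j in [set j | j \in J]) Z j @^-1` C j `&` Z i @^-1` B =
        \bigcap_(j in [set j | j \in i |: J]) Z j @^-1` C' j.
      apply/seteqP; split => w /=.
        move=> [wJ wi] j /=; rewrite !inE => /orP[/eqP ->|jJ].
          by rewrite /C' eqxx.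
        by rewrite CJ//; exact: wJ.
      move=> wJ; split => [j /= jJ|].
        by have := wJ j; rewrite /= !inE jJ orbT CJ//; exact.
      by have := wJ i; rewrite /= !inE eqxx /C' eqxx; exact.
    rewrite mut// big_setU1//= /C' eqxx; congr (_ * _)%E.
    rewrite -mut//; congr (P _).
    by apply/seteqP; split => w wJ j /= jJ; have := wJ j jJ; rewrite -/(C' j) CJ.
  - by move=> k; rewrite /m1 /= /mrestr setTI; rewrite ltey_eq PZ.
move=> sE; have : <<s G >> E.
  move: sE; apply: smallest_sub; first exact: smallest_sigma_algebra.
  move=> _ [j [C [jJ mC ->]]]; apply: sub_sigma_algebra.
  exists (fun j' => if j' == j then C else setT); split => [j'|]; first by case: ifP.
  apply/seteqP; split => w /= => [Cw j' _|].
    by case: eqVneq => [->|].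
  by move/(_ j jJ); rewrite eqxx.
move/m12; rewrite /m1 /m2 /= /mrestr /mscale /= fineK// => ->.
by rewrite muleC.
Qed.

Section Fixed.
Variables (J : {set I}) (i : I).
Hypothesis iJ : i \notin J.

Let TJ := sampleT Z J.

(** The whole past as one random variable: the identity into the coarser structure. Its law [PJ]
    lets independence be read as a product law for the pair of the past and the current sample. *)
Let idJ : T -> TJ := id.

Let idJ_measurable : measurable_fun setT idJ.
Proof. by move=> _ B mB; rewrite setTI; exact: (@sample_events_measurable _ _ _ _ _ Z J). Qed.

Let idJ_mixin := isMeasurableFun.Build _ _ _ _ _ idJ_measurable.
Let idJ_mfun : {mfun T >-> TJ} := HB.pack idJ idJ_mixin.

Let joint : T -> TJ * V := fun w => (w, Z i w).

Let joint_measurable : measurable_fun setT joint.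
Proof. by apply: measurable_fun_pair => //; exact: measurable_funPT. Qed.

Let joint_mixin := isMeasurableFun.Build _ _ _ _ _ joint_measurable.
Let joint_mfun : {mfun T >-> (TJ * V)%type} := HB.pack joint joint_mixin.

Let PJ : probability TJ R := distribution P idJ_mfun.
Let PV : probability V R := distribution P xi.

Let joint_law (A : set (TJ * V)%type) : measurable A ->
  (PJ \x PV)%E A = distribution P joint_mfun A.
Proof.
apply: product_measure_unique => E B mE mB.
have [_ same] := iidZ.
have PVB : PV B = P (Z i @^-1` B) := esym (same i B mB).
transitivity (P E * P (Z i @^-1` B))%E; first exact: (@indep J i E B iJ mE mB).
by congr (_ * _)%E.
Qed.

Lemma independent_fubini_tonelli (h : TJ * V -> \bar R) :
  measurable_fun setT h -> (forall z, (0 <= h z)%E) ->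
  (\int[P]_w h (w, Z i w) = \int[P]_w \int[P]_w' h (w, xi w'))%E.
Proof.
move=> mh h0.
have -> : (\int[P]_w h (w, Z i w) = \int[distribution P joint_mfun]_z h z)%E.
  by rewrite ge0_integral_distribution.
rewrite (@eq_measure_integral _ _ _ setT (PJ \x PV)%E); last first.
  by move=> A mA _; apply: esym; exact: joint_law.
rewrite fubini_tonelli1// /fubini_F /PJ ge0_integral_distribution//; last 2 first.
- exact: measurable_fun_fubini_tonelli_F.
- by move=> w; apply: integral_ge0.
apply: eq_integral => w _ /=; rewrite ge0_integral_distribution//.
exact: measurableT_comp.
Qed.

Lemma independent_integral0 (h : TJ * V -> \bar R) :
  measurable_fun setT h -> P.-integrable setT (fun w => h (w, Z i w)) ->
  (forall w, P.-integrable setT (fun w' => h (w, xi w'))) ->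
  (forall w, \int[P]_w' h (w, xi w') = 0)%E ->
  (\int[P]_w h (w, Z i w) = 0)%E.
Proof.
move=> mh ih ihw ih0.
have ijoint : (PJ \x PV)%E.-integrable setT h.
  apply/integrableP; split => //.
  rewrite (eq_measure_integral (distribution P joint_mfun))/=; last first.
    by move=> A mA _; exact: joint_law.
  rewrite ge0_integral_distribution//; last exact: measurableT_comp.
  by have /integrableP[] := ih.
have -> : (\int[P]_w h (w, Z i w) = \int[distribution P joint_mfun]_z h z)%E.
  by rewrite integral_distribution.
rewrite (@eq_measure_integral _ _ _ setT (PJ \x PV)%E); last first.
  by move=> A mA _; apply: esym; exact: joint_law.
rewrite -integral12_prod_meas1//.
have inner0 w : (\int[PV]_v h (w, v) = 0)%E.
  rewrite -(ih0 w); apply: (@integral_distribution _ _ _ _ _ P xi (fun v => h (w, v))) => //.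
    exact: measurableT_comp.
  exact: ihw.
by apply: integral0_eq => w _; exact: inner0.
Qed.

End Fixed.
End Independence.

(** * Moments of the oracle noise *)

Section SquareIntegrable.
Context (R : realType) (d : measure_display) (T : measurableType d) (P : probability T R).

Lemma Lfun2_of_sqr (f : T -> R) : measurable_fun setT f ->
  (\int[P]_w ((f w) ^+ 2)%:E < +oo)%E -> f \in Lfun P 2%:E.
Proof.
move=> mf foo; rewrite inE; apply/andP; split; rewrite inE//=.
rewrite /finite_norm unlock /Lnorm poweR_lty//.
apply: le_lt_trans foo; rewrite le_eqVlt; apply/orP; left; apply/eqP.
apply: eq_integral => w _; congr (_%:E).
by rewrite powR_mulrn// real_normK ?num_real.
Qed.

Lemma Lfun2_bounded (f : T -> R) (B : R) : measurable_fun setT f ->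
  (forall w, `|f w| <= B) -> f \in Lfun P 2%:E.
Proof.
move=> mf fB; apply: Lfun2_of_sqr => //.
apply: (@le_lt_trans _ _ (\int[P]_w (B ^+ 2)%:E)%E).
  apply: ge0_le_integral => //.
  - by move=> w _; rewrite lee_fin sqr_ge0.
  - by apply/measurable_EFinP; exact: measurable_funX.
  - move=> w _; rewrite lee_fin -real_normK ?num_real// ler_sqr ?nnegrE//.
    exact: le_trans (fB w).
by rewrite integral_cst//= probability_setT mule1 ltry.
Qed.

Lemma Lfun2_integrable_mul (f g : T -> R) : f \in Lfun P 2%:E -> g \in Lfun P 2%:E ->
  P.-integrable setT (fun w => (f w * g w)%:E).
Proof. by move=> lf lg; apply/Lfun1_integrable; exact: Lfun2_mul_Lfun1 lf lg. Qed.

Lemma Lfun2_integrable (f : T -> R) : f \in Lfun P 2%:E ->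
  P.-integrable setT (fun w => (f w)%:E).
Proof.
move=> lf; apply/Lfun1_integrable; apply: Lfun_subset12 lf.
by rewrite fin_num_measure.
Qed.

End SquareIntegrable.

Section OracleNoise.
Context (R : realType) (d : measure_display) (T : measurableType d) (P : probability T R).
Context (n q : nat) (I : finType).
Variables (xi : {RV P >-> borelV R q}) (Z : I -> {RV P >-> borelV R q}).
Hypothesis iidZ : iid_copies xi Z.
Variables (X : set 'rV[R]_n) (F : 'rV[R]_n -> R) (gradF : 'rV[R]_n -> 'rV[R]_n).
Variables (sigma : R) (Psi : 'rV[R]_n -> 'rV[R]_q -> R).
Variables (GPsi : 'rV[R]_n -> 'rV[R]_q -> 'rV[R]_n).
Hypothesis Xcl : closed X.
Hypothesis oracle : stochastic_oracle X xi F gradF sigma Psi GPsi.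

Definition oracle_noise (x : T -> 'rV[R]_n) (i : I) (w : T) : 'rV[R]_n :=
  GPsi (x w) (Z i w) - gradF (x w).

Section Measurability.
Variables (J : {set I}) (x : T -> 'rV[R]_n).
Hypothesis xX : forall w, X (x w).
Hypothesis mx : measurable_fun setT (x : sampleT Z J -> borelV R n).

Let G (z : sampleT Z J * borelV R q) j : R := GPsi (x z.1) z.2 0 j.

Lemma oracle_sample_measurable :
  measurable_fun setT (fun z : sampleT Z J * borelV R q => GPsi (x z.1) z.2 : borelV R n).
Proof.
have mX : measurable (X : set (borelV R n)).
  rewrite -(setCK X); apply: measurableC; apply: sub_sigma_algebra.
  exact: closed_openC.
apply: (measurable_comp (F := X `*` [set: 'rV[R]_q] : set (borelV R n * borelV R q))
   (g := fun z : sampleT Z J * borelV R q => ((x z.1 : borelV R n), z.2)) _ _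
   (oracle_grad_measurable oracle)).
- exact: measurableX.
- by move=> _ [z _ <-]; split => //=.
- apply: measurable_fun_pair => //.
  by apply: (measurableT_comp mx); exact: measurable_fst.
Qed.

Let mG j : measurable_fun setT (fun z => G z j).
Proof. exact: measurable_coord oracle_sample_measurable. Qed.

(** The transfer to the law of [xi] goes through positive and negative parts, where no integrability
    has to be known yet. *)
Let gradE w j : ((gradF (x w) 0 j)%:E = \int[distribution P xi]_v (G (w, v) j)%:E)%E.
Proof.
rewrite -(oracle_grad_mean oracle (xX w) j) unlock.
have mE : measurable_fun setT (fun v => (G (w, v) j)%:E).
  by apply/measurable_EFinP; exact: (measurableT_comp (mG j)).
rewrite [RHS]integralE [LHS]integralE.
rewrite [X in _ = (X - _)%E]ge0_integral_distribution//; last exact: measurable_funepos.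
rewrite [X in _ = (_ - X)%E]ge0_integral_distribution//; last exact: measurable_funeneg.
by rewrite -funepos_comp -funeneg_comp.
Qed.

(** No measurability is assumed of [gradF]; along [x] it is recovered as the partial integral, over
    the sample, of the jointly measurable oracle. *)
Lemma gradient_measurable j :
  measurable_fun setT ((fun w => gradF (x w) 0 j) : sampleT Z J -> R).
Proof.
apply/measurable_EFinP.
have mE : measurable_fun setT (fun z => (G z j)%:E) by exact/measurable_EFinP.
pose f1 (w : sampleT Z J) := (\int[distribution P xi]_v (EFin \o G ^~ j)^\+ (w, v))%E.
pose f2 (w : sampleT Z J) := (\int[distribution P xi]_v (EFin \o G ^~ j)^\- (w, v))%E.
have -> : EFin \o (fun w => gradF (x w) 0 j) = (f1 \- f2)%E.
  apply/funext => w /=; rewrite gradE [LHS]integralE /f1 /f2.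
  have -> : (fun v => (G (w, v) j)%:E) = (EFin \o G ^~ j) \o (pair w) by [].
  by rewrite funepos_comp funeneg_comp.
apply: emeasurable_funB.
- apply: (@measurable_fun_fubini_tonelli_F _ _ _ _ _ (distribution P xi)) => //.
  exact: measurable_funepos.
- apply: (@measurable_fun_fubini_tonelli_F _ _ _ _ _ (distribution P xi)) => //.
  exact: measurable_funeneg.
Qed.

Lemma oracle_noise_measurable i j : i \in J ->
  measurable_fun setT ((fun w => oracle_noise x i w 0 j) : sampleT Z J -> R).
Proof.
move=> iJ.
have -> : (fun w => oracle_noise x i w 0 j) =
    (fun w : sampleT Z J => G (w, Z i w) j - gradF (x w) 0 j).
  by apply/funext => w; rewrite !mxE.
apply: measurable_funB; last exact: gradient_measurable.
apply: (measurableT_comp (mG j)); apply: measurable_fun_pair => //.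
exact: sample_measurable.
Qed.

End Measurability.

Section Moments.
Variables (J : {set I}) (x : T -> 'rV[R]_n) (i : I).
Hypothesis xX : forall w, X (x w).
Hypothesis mx : measurable_fun setT (x : sampleT Z J -> borelV R n).
Hypothesis iJ : i \notin J.

Let G (z : sampleT Z J * borelV R q) j : R := GPsi (x z.1) z.2 0 j.

Let dev (z : sampleT Z J * borelV R q) j : R := G z j - gradF (x z.1) 0 j.

Let mdev j : measurable_fun setT (fun z => dev z j).
Proof.
apply: measurable_funB; first exact: measurable_coord (oracle_sample_measurable xX mx).
exact: (measurableT_comp (gradient_measurable xX mx j)).
Qed.

Let norm2_devE w v : norm2 (GPsi (x w) v - gradF (x w)) ^+ 2 = \sum_j dev (w, v) j ^+ 2.
Proof. by rewrite norm2_sqr; apply: eq_bigr => j _; rewrite !mxE expr2. Qed.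

Let oracle_noise_section w j : (fun w' => dev (w, xi w') j) \in Lfun P 2%:E.
Proof.
have m2 j' : measurable_fun setT (fun w' => dev (w, xi w') j').
  by apply: (measurableT_comp (f := fun v => dev (w, v) j')) => //; exact: measurableT_comp (mdev j') _.
apply: Lfun2_of_sqr => //.
apply: (@le_lt_trans _ _ (sigma ^+ 2)%:E); last exact: ltry.
apply: le_trans (oracle_grad_variance oracle (xX w)); rewrite unlock.
apply: ge0_le_integral => //.
- by move=> w' _; rewrite lee_fin sqr_ge0.
- by apply/measurable_EFinP; exact: measurable_funX.
- apply/measurable_EFinP.
  under eq_fun do rewrite norm2_devE.
  by apply: measurable_sum => j'; exact: measurable_funX.
- move=> w' _; rewrite lee_fin norm2_devE (bigD1 j)//= lerDl.
  by apply: sumr_ge0 => j' _; exact: sqr_ge0.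
Qed.

Lemma oracle_noise_variance :
  (\int[P]_w (norm2 (oracle_noise x i w) ^+ 2)%:E <= (sigma ^+ 2)%:E)%E.
Proof.
have mn : measurable_fun setT (fun z : sampleT Z J * borelV R q =>
   (norm2 (GPsi (x z.1) z.2 - gradF (x z.1)) ^+ 2)%:E).
  apply/measurable_EFinP.
  have -> : (fun z : sampleT Z J * borelV R q =>
     norm2 (GPsi (x z.1) z.2 - gradF (x z.1)) ^+ 2) = (fun z => \sum_j dev z j ^+ 2).
    by apply/funext => -[w v]; rewrite norm2_devE.
  by apply: measurable_sum => j; exact: measurable_funX.
rewrite (independent_fubini_tonelli iidZ iJ mn); last by move=> z; rewrite lee_fin sqr_ge0.
apply: (@le_trans _ _ (\int[P]_w (sigma ^+ 2)%:E)%E); last first.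
  by rewrite integral_cst//= probability_setT mule1.
apply: ge0_le_integral => //.
- by move=> w _; apply: integral_ge0 => w' _; rewrite lee_fin sqr_ge0.
- apply: (@sampleT_measurable _ _ _ _ _ Z _ _ J).
  have -> : (fun w => \int[P]_w' (norm2 (GPsi (x w) (xi w') - gradF (x w)) ^+ 2)%:E)%E =
     (fun w : sampleT Z J => \int[distribution P xi]_v
        (norm2 (GPsi (x w) v - gradF (x w)) ^+ 2)%:E)%E.
    apply/funext => w; rewrite ge0_integral_distribution//.
      exact: (measurable_fun_pair2 (w : sampleT Z J) mn).
    by move=> v; rewrite lee_fin sqr_ge0.
  apply: (@measurable_fun_fubini_tonelli_F _ _ _ _ _ (distribution P xi) _ mn) => //.
  by move=> z; rewrite lee_fin sqr_ge0.
- by move=> w _; have := oracle_grad_variance oracle (xX w); rewrite unlock.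
Qed.

Lemma oracle_noise_Lfun2 j : (fun w => oracle_noise x i w 0 j) \in Lfun P 2%:E.
Proof.
have mj j' : measurable_fun setT (fun w => oracle_noise x i w 0 j').
  apply: (@sampleT_measurable _ _ _ _ _ Z _ _ (i |: J)).
  apply: (oracle_noise_measurable xX); last by rewrite !inE eqxx.
  by apply: sampleT_mono mx; exact: finset.subsetUr.
apply: Lfun2_of_sqr => //.
apply: (@le_lt_trans _ _ (sigma ^+ 2)%:E); last exact: ltry.
apply: le_trans oracle_noise_variance; apply: ge0_le_integral => //.
- by move=> w _; rewrite lee_fin sqr_ge0.
- by apply/measurable_EFinP; exact: measurable_funX.
- apply/measurable_EFinP; under eq_fun do rewrite norm2_sqr.
  by apply: measurable_sum => j'; exact: measurable_funM.
- move=> w _; rewrite lee_fin norm2_sqr /dot (bigD1 j)//= -expr2 lerDl.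
  by apply: sumr_ge0 => j' _; rewrite -expr2 sqr_ge0.
Qed.

Lemma oracle_noise_orthogonal (u : T -> R) j :
  measurable_fun setT (u : sampleT Z J -> R) -> u \in Lfun P 2%:E ->
  (\int[P]_w (u w * oracle_noise x i w 0 j)%:E = 0)%E.
Proof.
move=> mu lu.
have mh : measurable_fun setT (fun z : sampleT Z J * borelV R q => (u z.1 * dev z j)%:E).
  apply/measurable_EFinP; apply: measurable_funM; last exact: mdev.
  exact: (measurableT_comp mu).
have P1 : P setT \is a fin_num by rewrite fin_num_measure.
have E w : oracle_noise x i w 0 j = dev (w, Z i w) j by rewrite !mxE.
under eq_integral do rewrite E.
have H := independent_integral0 iidZ iJ mh; apply: H => [|w|w] /=.
- by under eq_fun do rewrite -E; exact: Lfun2_integrable_mul lu (oracle_noise_Lfun2 j).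
- exact: Lfun2_integrable_mul (Lfun_cst P (u w) 2) (oracle_noise_section w j).
(* A finite value of the mean does not by itself give integrability; this comes from the
   square-integrable deviation plus a constant. *)
- have lG : P.-integrable setT (fun w' => (GPsi (x w) (xi w') 0 j)%:E).
    have I1 := Lfun2_integrable (oracle_noise_section w j).
    have I2 := Lfun2_integrable (Lfun_cst P (gradF (x w) 0 j) 2).
    have := integrableD measurableT I1 I2.
    apply: eq_integrable => // w' _.
    by rewrite -EFinD /dev /G /= subrK.
  under eq_integral do rewrite EFinM.
  rewrite integralZl//; last exact: Lfun2_integrable (oracle_noise_section w j).
  suff -> : (\int[P]_w' (dev (w, xi w') j)%:E = 0)%E by rewrite mule0.
  have := oracle_grad_mean oracle (xX w) j; rewrite unlock => EG.
  rewrite /dev; under eq_integral do rewrite EFinB.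
  have I2 : P.-integrable setT (cst (gradF (x w) 0 j)%:E).
    exact: Lfun2_integrable (Lfun_cst P (gradF (x w) 0 j) 2).
  rewrite -[LHS]/(\int[P]_w' ((GPsi (x w) (xi w') 0 j)%:E - cst (gradF (x w) 0 j)%:E w'))%E.
  have -> := integralB measurableT lG I2.
  by rewrite EG integral_cst//= probability_setT mule1 subee.
Qed.

End Moments.
End OracleNoise.

Section RealExpectation.
Context (R : realType) (d : measure_display) (T : measurableType d) (P : probability T R).
Implicit Types f g : T -> R.

Lemma integrable_EFinD f g : P.-integrable setT (EFin \o f) ->
  P.-integrable setT (EFin \o g) -> P.-integrable setT (EFin \o (fun w => f w + g w)).
Proof. by move=> fi gi; apply: eq_integrable (integrableD measurableT fi gi). Qed.

Lemma integrable_EFinZ (a : R) f : P.-integrable setT (EFin \o f) ->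
  P.-integrable setT (EFin \o (fun w => a * f w)).
Proof. by move=> fi; apply: eq_integrable (integrableZl measurableT a fi). Qed.

Lemma Rintegral_sum (I : nat) (f : nat -> T -> R) :
  (forall i, (i < I)%N -> P.-integrable setT (EFin \o f i)) ->
  P.-integrable setT (EFin \o (fun w => \sum_(i < I) f i w)) /\
  \int[P]_w (\sum_(i < I) f i w) = \sum_(i < I) \int[P]_w f i w.
Proof.
elim: I => [_|I IH fi].
  have -> : (fun w => \sum_(i < 0) f i w) = cst 0 by apply/funext => w; rewrite big_ord0.
  by rewrite big_ord0; split; [exact: integrable0|rewrite Rintegral_cst// mul0r].
have [i1 e1] := IH (fun i iI => fi i (leqW iI)).
have -> : (fun w => \sum_(i < I.+1) f i w) = (fun w => (\sum_(i < I) f i w) + f I w).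
  by apply/funext => w; rewrite big_ord_recr.
have iI := fi I (leqnn _); split; first exact: integrable_EFinD.
by rewrite RintegralD// big_ord_recr /= e1.
Qed.

End RealExpectation.

(** * Mini-batches and the filtration of the samples *)

Section Batches.
Context (R : realType) (d : measure_display) (T : measurableType d) (P : probability T R).
Context (n q K m : nat).
Variables (xi : {RV P >-> borelV R q}) (xs : nat -> nat -> {RV P >-> borelV R q}).
Let I : finType := ('I_K * 'I_m)%type.
Let Z (ki : I) : {RV P >-> borelV R q} := xs ki.1 ki.2.
Hypothesis iidZ : iid_copies xi Z.
Hypothesis m0 : (0 < m)%N.
Variables (X : set 'rV[R]_n) (F : 'rV[R]_n -> R) (gradF : 'rV[R]_n -> 'rV[R]_n).
Variables (sigma : R) (Psi : 'rV[R]_n -> 'rV[R]_q -> R).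
Variables (GPsi : 'rV[R]_n -> 'rV[R]_q -> 'rV[R]_n).
Hypothesis Xcl : closed X.
Hypothesis oracle : stochastic_oracle X xi F gradF sigma Psi GPsi.
Variable x : nat -> T -> 'rV[R]_n.

(** Indexed finer than by batches, because the variance of a mini-batch rests on the orthogonality
    of each sample noise to the earlier ones of the same batch. *)
Definition past_samples (k i : nat) : {set 'I_K * 'I_m} :=
  [set ki : 'I_K * 'I_m | (ki.1 < k)%N || ((ki.1 == k :> nat) && (ki.2 < i)%N)].

(* v is a function of the samples of the first k batches and of the first i samples
   of the next one. *)
Definition known_at k i (v : T -> 'rV[R]_n) :=
  forall j, measurable_fun setT ((fun w => v w 0 j) : sampleT Z (past_samples k i) -> R) /\
            (fun w => v w 0 j) \in Lfun P 2%:E.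

Definition known k := known_at k 0.

Lemma past_samples_mono k i k' i' : (k < k')%N || ((k == k') && (i <= i')%N) ->
  past_samples k i \subset past_samples k' i'.
Proof.
move=> H; apply/fintype.subsetP => -[a b]; rewrite !inE /=.
case/orP: H => [kk'|/andP[/eqP <- ii']] /orP[ak|/andP[/eqP ak bi]].
- by rewrite (ltn_trans ak kk').
- by rewrite ak kk'.
- by rewrite ak.
- by rewrite ak eqxx (leq_trans bi ii') orbT.
Qed.

Lemma past_samples_full k : past_samples k m = past_samples k.+1 0.
Proof.
apply/setP => -[a b]; rewrite !inE /= ltn_ord andbT ltn0 andbF orbF.
by rewrite [RHS]ltnS [RHS]leq_eqVlt orbC.
Qed.

Lemma known_at_mono k i k' i' v : (k < k')%N || ((k == k') && (i <= i')%N) ->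
  known_at k i v -> known_at k' i' v.
Proof.
move=> H kv j; have [mv lv] := kv j; split => //.
exact: sampleT_mono (past_samples_mono H) mv.
Qed.

Lemma known_atD k i u v : known_at k i u -> known_at k i v ->
  known_at k i (fun w => u w + v w).
Proof.
move=> ku kv j; have [mu lu] := ku j; have [mv lv] := kv j; split.
  by under eq_fun do rewrite mxE; exact: measurable_funD.
have p1 : (1 <= 2%:E :> \bar R)%E by rewrite lee_fin ler1n.
have -> : (fun w => (u w + v w) 0 j) = (fun w => u w 0 j) + (fun w => v w 0 j).
  by apply/funext => w; rewrite !mxE.
by have [_ add_closed] := Lfun_addr_closed P p1; exact: add_closed.
Qed.

Lemma known_atZ k i (a : R) v : known_at k i v -> known_at k i (fun w => a *: v w).
Proof.
move=> kv j; have [mv lv] := kv j; split.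
  by under eq_fun do rewrite mxE; exact: measurable_funM.
have p1 : (1 <= 2 :> R) by rewrite ler1n.
have -> : (fun w => (a *: v w) 0 j) = a \o* (fun w => v w 0 j).
  by apply/funext => w; rewrite !mxE /= mulrC.
exact: Lfun_scale.
Qed.

Lemma known_at_bounded k i (v : T -> 'rV[R]_n) (B : R) :
  (forall j, measurable_fun setT ((fun w => v w 0 j) : sampleT Z (past_samples k i) -> R)) ->
  (forall w, norm2 (v w) <= B) -> known_at k i v.
Proof.
move=> mv vB j; split; first exact: mv.
apply: (@Lfun2_bounded _ _ _ _ _ B); first exact: sampleT_measurable (mv j).
by move=> w; exact: le_trans (coord_le_norm2 _ _) (vB w).
Qed.

Lemma known_at0 k i : known_at k i (fun=> 0).
Proof.
apply: (@known_at_bounded _ _ _ 0) => [j|w]; last by rewrite norm2_0.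
rewrite (_ : (fun=> _) = cst 0); first exact: measurable_cst.
by apply/funext => w; rewrite mxE.
Qed.

Lemma known_at_sum k i (M : nat) (v : nat -> T -> 'rV[R]_n) :
  (forall j, (j < M)%N -> known_at k i (v j)) ->
  known_at k i (fun w => \sum_(j < M) v j w).
Proof.
elim: M => [_|M IH kv].
  by under [X in known_at _ _ X]eq_fun do rewrite big_ord0; exact: known_at0.
under [X in known_at _ _ X]eq_fun do rewrite big_ord_recr.
by apply: known_atD; [apply: IH => j jM; exact: kv (leqW jM)|exact: kv].
Qed.

Definition sample_noise k i w := GPsi (x k w) (xs k i w) - gradF (x k w).

Definition batch_noise k w := m%:R^-1 *: \sum_(i < m) sample_noise k i w.

Lemma batch_noiseE k w :
  batch_grad GPsi m (fun k i => xs k i) x k w - gradF (x k w) = batch_noise k w.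
Proof.
rewrite /batch_noise /sample_noise sumrB scalerBr sumr_const card_ord.
by rewrite -(scaler_nat m (gradF _)) scalerA mulVf ?scale1r// pnatr_eq0 -lt0n.
Qed.

Section OneBatch.
Variable k : nat.
Hypothesis kK : (k < K)%N.
Hypothesis xX : forall w, X (x k w).
Hypothesis mx : forall j,
  measurable_fun setT ((fun w => x k w 0 j) : sampleT Z (past_samples k 0) -> R).

Let mxi i : measurable_fun setT (x k : sampleT Z (past_samples k i) -> borelV R n).
Proof.
apply: measurable_rV => j; apply: sampleT_mono (mx j).
by apply: past_samples_mono; rewrite eqxx orbT.
Qed.

Let sample i (iM : (i < m)%N) : I := (Ordinal kK, Ordinal iM).

Let sample_notin i (iM : (i < m)%N) : sample iM \notin past_samples k i.
Proof. by rewrite !inE /= !ltnn andbF. Qed.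

Lemma sample_noise_known i : (i < m)%N -> known_at k i.+1 (sample_noise k i).
Proof.
move=> iM j; split.
  have iJ : sample iM \in past_samples k i.+1 by rewrite !inE /= eqxx ltnSn orbT.
  exact: (oracle_noise_measurable Xcl oracle xX (@mxi i.+1) j iJ).
exact: (oracle_noise_Lfun2 iidZ Xcl oracle xX (@mxi i) (sample_notin iM)).
Qed.

Lemma sample_noise_orthogonal i v : (i < m)%N -> known_at k i v ->
  P.-integrable setT (EFin \o (fun w => dot (sample_noise k i w) (v w))) /\
  \int[P]_w dot (sample_noise k i w) (v w) = 0.
Proof.
move=> iM kv.
(* [Rintegral_sum] takes families indexed by [nat]; the value beyond [n] is an irrelevant
   default. *)
pose g (j : nat) w := if insub j is Some j' then sample_noise k i w 0 j' * v w 0 j' else 0.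
have gE (j : 'I_n) : g j = (fun w => sample_noise k i w 0 j * v w 0 j).
  by apply/funext => w; rewrite /g valK.
have gi j : (j < n)%N -> P.-integrable setT (EFin \o g j).
  move=> jn; rewrite (gE (Ordinal jn)); have [_ l1] := sample_noise_known iM (Ordinal jn).
  by have [_ l2] := kv (Ordinal jn); exact: Lfun2_integrable_mul.
have [int_g Eg] := Rintegral_sum gi.
have dE : (fun w => dot (sample_noise k i w) (v w)) = (fun w => \sum_(j < n) g j w).
  by apply/funext => w; apply: eq_bigr => j _; rewrite gE.
rewrite dE; split => //; rewrite Eg; apply: big1 => j _.
rewrite gE /Rintegral; have [mv lv] := kv j.
have := oracle_noise_orthogonal iidZ Xcl oracle xX (@mxi i) (sample_notin iM) j mv lv.
move=> H; under eq_integral do rewrite mulrC.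
by rewrite [X in fine X](_ : _ = 0%E) //; exact: H.
Qed.

Lemma sample_noise_variance i : (i < m)%N ->
  P.-integrable setT (EFin \o (fun w => norm2 (sample_noise k i w) ^+ 2)) /\
  \int[P]_w (norm2 (sample_noise k i w) ^+ 2) <= sigma ^+ 2.
Proof.
move=> iM.
have H : (\int[P]_w (norm2 (sample_noise k i w) ^+ 2)%:E <= (sigma ^+ 2)%:E)%E.
  exact: (oracle_noise_variance iidZ Xcl oracle xX (@mxi i) (sample_notin iM)).
have mn : measurable_fun setT (fun w => norm2 (sample_noise k i w) ^+ 2).
  under eq_fun do rewrite norm2_sqr.
  apply: measurable_sum => j; have [mj _] := sample_noise_known iM j.
  by apply: measurable_funM; exact: sampleT_measurable mj.
split.
  apply/integrableP; split; first exact/measurable_EFinP.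
  under eq_integral do rewrite /= ger0_norm ?sqr_ge0//.
  exact: le_lt_trans H (ltry _).
rewrite /Rintegral -lee_fin fineK//.
rewrite ge0_fin_numE; first exact: le_lt_trans H (ltry _).
by apply: integral_ge0 => w _; rewrite lee_fin sqr_ge0.
Qed.

Lemma batch_noise_known : known k.+1 (batch_noise k).
Proof.
rewrite /known /known_at -past_samples_full -/(known_at k m _).
apply: known_atZ; apply: known_at_sum => i iM.
by apply: known_at_mono (sample_noise_known iM); rewrite eqxx iM orbT.
Qed.

Lemma batch_noise_orthogonal v : known k v ->
  P.-integrable setT (EFin \o (fun w => dot (batch_noise k w) (v w))) /\
  \int[P]_w dot (batch_noise k w) (v w) = 0.
Proof.
move=> kv; pose g i w := dot (sample_noise k i w) (v w).
have H i : (i < m)%N -> P.-integrable setT (EFin \o g i) /\ \int[P]_w g i w = 0.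
  move=> iM; apply: sample_noise_orthogonal => //.
  by apply: known_at_mono kv; rewrite eqxx orbT.
have [ig eg] := Rintegral_sum (fun i iM => (H i iM).1).
have -> : (fun w => dot (batch_noise k w) (v w)) =
    (fun w => m%:R^-1 * \sum_(i < m) g i w).
  by apply/funext => w; rewrite /batch_noise dotZl dot_suml.
split; first exact: integrable_EFinZ.
rewrite RintegralZl// eg big1 ?mulr0// => i _.
by have [_ ->] := H i (ltn_ord i).
Qed.

(** Cross terms within the batch vanish one sample at a time; [m] variances times [m^-2] leave
    [sigma^2 / m]. *)
Lemma batch_noise_variance :
  P.-integrable setT (EFin \o (fun w => norm2 (batch_noise k w) ^+ 2)) /\
  \int[P]_w (norm2 (batch_noise k w) ^+ 2) <= sigma ^+ 2 / m%:R.
Proof.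
pose v i w : 'rV[R]_n := 2 *: \sum_(j < i) sample_noise k j w.
have kv i : (i < m)%N -> known_at k i (v i).
  move=> iM; apply: known_atZ; apply: known_at_sum => j ji.
  by apply: known_at_mono (sample_noise_known (ltn_trans ji iM)); rewrite eqxx ji orbT.
pose g i w := norm2 (sample_noise k i w) ^+ 2 + dot (sample_noise k i w) (v i w).
have H i : (i < m)%N -> P.-integrable setT (EFin \o g i) /\ \int[P]_w g i w <= sigma ^+ 2.
  move=> iM; have [i1 e1] := sample_noise_variance iM.
  have [i2 e2] := sample_noise_orthogonal iM (kv i iM).
  split; first exact: integrable_EFinD.
  by rewrite RintegralD// e2 addr0.
have [ig eg] := Rintegral_sum (fun i iM => (H i iM).1).
have -> : (fun w => norm2 (batch_noise k w) ^+ 2) =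
    (fun w => m%:R^-1 ^+ 2 * \sum_(i < m) g i w).
  apply/funext => w; rewrite /batch_noise norm2Z exprMn real_normK ?num_real//.
  by rewrite (norm2_sum_sqr m (fun i => sample_noise k i w)).
split; first exact: integrable_EFinZ.
rewrite RintegralZl// eg.
have mR : 0 < m%:R :> R by rewrite ltr0n.
have : \sum_(i < m) \int[P]_w g i w <= sigma ^+ 2 * m%:R.
  rewrite mulr_natr -[X in _ *+ X]card_ord -sumr_const.
  by apply: ler_sum => i _; exact: (H i (ltn_ord i)).2.
move=> /(ler_wpM2l (sqr_ge0 (m%:R^-1)))/le_trans; apply.
by rewrite le_eqVlt; apply/orP; left; apply/eqP; field; rewrite gt_eqF.
Qed.

End OneBatch.

Lemma noise_expectation (C : R) (c : nat -> R) (v : nat -> T -> 'rV[R]_n) :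
  (forall k, (k < K)%N -> forall w, X (x k w)) ->
  (forall k j, (k < K)%N ->
    measurable_fun setT ((fun w => x k w 0 j) : sampleT Z (past_samples k 0) -> R)) ->
  (forall k, (k < K)%N -> 0 <= c k) -> (forall k, (k < K)%N -> known k (v k)) ->
  let rhs w := C + \sum_(k < K) (dot (batch_noise k w) (v k w) +
                               c k * norm2 (batch_noise k w) ^+ 2) in
  P.-integrable setT (EFin \o rhs) /\
  \int[P]_w rhs w <= C + (\sum_(k < K) c k) * (sigma ^+ 2 / m%:R).
Proof.
move=> xX mx c0 kv rhs.
pose g k w := dot (batch_noise k w) (v k w) + c k * norm2 (batch_noise k w) ^+ 2.
have H k : (k < K)%N -> P.-integrable setT (EFin \o g k) /\
    \int[P]_w g k w <= c k * (sigma ^+ 2 / m%:R).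
  move=> kK; have mxk j := mx k j kK.
  have [i1 e1] := batch_noise_orthogonal kK (xX k kK) mxk (kv k kK).
  have [i2 e2] := batch_noise_variance kK (xX k kK) mxk.
  have i3 : P.-integrable setT (EFin \o (fun w => c k * norm2 (batch_noise k w) ^+ 2)).
    exact: integrable_EFinZ.
  split; first exact: integrable_EFinD.
  by rewrite RintegralD// e1 add0r RintegralZl// ler_wpM2l// c0.
have [ig eg] := Rintegral_sum (fun k kK => (H k kK).1).
have iC : P.-integrable setT (EFin \o cst C).
  exact: finite_measure_integrable_cst.
split; first exact: integrable_EFinD.
rewrite RintegralD// Rintegral_cst//= probability_setT mulr1 lerD2l eg mulr_suml.
by apply: ler_sum => k _; exact: (H k (ltn_ord k)).2.
Qed.

End Batches.

(** * The random iterates *)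

Section Continuity.
Context (R : realType) (n : nat).

Lemma norm2_lipschitz_continuous (F : 'rV[R]_n -> R) (C : R) :
  (forall u v, `|F u - F v| <= C * norm2 (u - v)) -> continuous F.
Proof.
move=> FC; apply/continuousP => B oB; apply/open_norm2P => v Bv.
have /nbhs_ballP[e /= e0 eB] : nbhs (F v) B by exact: open_nbhs_nbhs.
have K0 : 0 < `|C| + 1 by rewrite ltr_wpDl.
exists (e / (`|C| + 1)); first exact: divr_gt0.
move=> u; rewrite ltr_pdivlMr// => uv; apply: eB; rewrite -ball_normE /= distrC.
apply: le_lt_trans (FC u v) _; apply: le_lt_trans uv.
by rewrite mulrC ler_wpM2l// (le_trans (ler_norm C))// lerDl.
Qed.

Lemma continuous_dot (q : 'rV[R]_n) : continuous (dot q).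
Proof.
apply: (@norm2_lipschitz_continuous _ (norm2 q)) => u v.
by rewrite -dotBr; exact: cauchy_schwarz_abs.
Qed.

Lemma continuous_norm2 : continuous (@norm2 R n).
Proof.
apply: (@norm2_lipschitz_continuous _ 1) => u v; rewrite mul1r ler_norml.
have := ler_norm2D (u - v) v; have := ler_norm2D (v - u) u.
by rewrite !subrK (norm2_distC v u); lra.
Qed.

Lemma argmin_linear_exists (X : set 'rV[R]_n) (F : 'rV[R]_n -> R) (q : 'rV[R]_n) :
  X !=set0 -> bounded_set X -> closed X -> {within X, continuous F} ->
  exists v, is_argmin X (fun v => F v + dot q v) v.
Proof.
move=> X0 Xb Xc cF; apply: argmin_exists => // v.
by apply: cvgD; [exact: cF|exact: (continuous_subspaceT (@continuous_dot q))].
Qed.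

Lemma argmin_prox_exists (X : set 'rV[R]_n) (x g : 'rV[R]_n) (a : R) :
  X !=set0 -> bounded_set X -> closed X ->
  exists v, is_argmin X (fun v => dot g (v - x) + a * norm2 (v - x) ^+ 2) v.
Proof.
move=> X0 Xb Xc.
have cg : continuous (fun t : R => a * t ^+ 2).
  by move=> t; apply: cvgM; [exact: cvg_cst|exact: exprn_continuous].
have cF : {within X, continuous ((fun t : R => a * t ^+ 2) \o @norm2 R n)}.
  apply: continuous_subspaceT => v; apply: continuous_comp; last exact: cg.
  exact: continuous_norm2.
have [v vm] := argmin_linear_exists (g - (2 * a) *: x) X0 Xb Xc cF; exists v.
apply: is_argmin_ext vm; exists (- (a * dot x x - dot g x)) => u _.
by rewrite /= !norm2_sqr !dotE (dotC x u); ring.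
Qed.

End Continuity.

Section Run.
Context (R : realType) (d : measure_display) (T : measurableType d) (P : probability T R).
Context (n q N m : nat).
Variables (xi : {RV P >-> borelV R q}) (xs : nat -> nat -> {RV P >-> borelV R q}).
Hypothesis iidZ : iid_copies xi (fun ki : 'I_N.+1 * 'I_m => xs ki.1 ki.2).
Hypothesis m0 : (0 < m)%N.
Variables (X : set 'rV[R]_n) (F : 'rV[R]_n -> R) (G : 'rV[R]_n -> 'rV[R]_n) (L : R).
Hypotheses (X0 : X !=set0) (Xbnd : bounded_set X) (Xcl : closed X) (Xcvx : convex_set X).
Hypothesis L0 : 0 < L.
Hypothesis gradient_le_F : forall x y, X x -> X y -> F x + dot (G x) (y - x) <= F y.
Hypothesis descent : forall x y, X x -> X y ->
  F y <= F x + dot (G x) (y - x) + L / 2 * norm2 (y - x) ^+ 2.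
Hypothesis G_lipschitz : forall x x' y y', X x -> X x' -> X y -> X y' ->
  dot (G x - G x') (y - y') <= L * norm2 (x - x') * norm2 (y - y').
Variables (dprox : 'rV[R]_n -> R) (sd D : R) (x0 : 'rV[R]_n).
Hypothesis d_cont : {within X, continuous dprox}.
Hypotheses (sd0 : 0 < sd) (d_scvx : strongly_convex_on X sd dprox).
Hypotheses (x0P : is_argmin X dprox x0) (d_x0 : dprox x0 = 0).
Hypothesis d_le : forall x, X x -> dprox x <= D.
Variables (sigma : R) (Psi : 'rV[R]_n -> 'rV[R]_q -> R).
Variables (GPsi : 'rV[R]_n -> 'rV[R]_q -> 'rV[R]_n).
Hypothesis oracle : stochastic_oracle X xi F G sigma Psi GPsi.
Variables (x y z : nat -> T -> 'rV[R]_n).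
Hypothesis run : nesterov_run X dprox sd L x0 Psi GPsi N m (fun k i => xs k i) x y z.

Let Z (ki : 'I_N.+1 * 'I_m) := xs ki.1 ki.2.
Let past k := past_samples N.+1 m k 0.
Let g w k := batch_grad GPsi m (fun k i => xs k i) x k w.
Let val w k := batch_value Psi m (fun k i => xs k i) x k w.

(** The measurability half of [known]. The other half comes from boundedness of [X]: a difference of
    two seen points of [X] is bounded, hence square integrable. *)
Definition seen k (v : T -> 'rV[R]_n) :=
  forall j, measurable_fun setT ((fun w => v w 0 j) : sampleT Z (past k) -> R).

Lemma seen_mono k k' v : (k <= k')%N -> seen k v -> seen k' v.
Proof.
move=> kk' sv j; apply: sampleT_mono (sv j); apply: past_samples_mono.
by rewrite leqnn andbT orbC -leq_eqVlt.
Qed.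

Lemma seenD k u v : seen k u -> seen k v -> seen k (fun w => u w + v w).
Proof. by move=> su sv j; under eq_fun do rewrite mxE; exact: measurable_funD. Qed.

Lemma seenZ k (a : R) v : seen k v -> seen k (fun w => a *: v w).
Proof. by move=> sv j; under eq_fun do rewrite mxE; exact: measurable_funM. Qed.

Lemma seenB k u v : seen k u -> seen k v -> seen k (fun w => u w - v w).
Proof.
move=> su sv; under [X in seen _ X]eq_fun do rewrite -scaleN1r.
by apply: seenD => //; exact: seenZ.
Qed.

Lemma seen_cst k v : seen k (fun=> v).
Proof. by move=> j; exact: measurable_cst. Qed.

Lemma seen_sum k M (v : nat -> T -> 'rV[R]_n) :
  (forall i, (i < M)%N -> seen k (v i)) -> seen k (fun w => \sum_(i < M) v i w).
Proof.
elim: M => [_|M IH sv].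
  by under [X in seen _ X]eq_fun do rewrite big_ord0; exact: seen_cst.
under [X in seen _ X]eq_fun do rewrite big_ord_recr.
by apply: seenD; [apply: IH => i iM; exact: sv (leqW iM)|exact: sv].
Qed.

Lemma seen_lipschitz k u v (C : R) : seen k u ->
  (forall w w', norm2 (v w - v w') <= C * norm2 (u w - u w')) -> seen k v.
Proof.
move=> su vu j.
exact: (measurable_rV_of_lipschitz (measurable_rV su) vu).
Qed.

Let yP w k : (k <= N)%N -> is_argmin X (fun v => dot (g w k) (v - x k w) +
  prox_coef L k * norm2 (v - x k w) ^+ 2) (y k w).
Proof. exact: run_y run k w. Qed.

Let zP w k : (k <= N)%N -> is_argmin X (fun v => L / sd * dprox v +
  \sum_(i < k.+1) 2^-1 * (val w i + dot (g w i) (v - x i w))) (z k w).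
Proof. exact: run_z run k w. Qed.

Let xS w k : (k <= N)%N ->
  x k.+1 w = k.+2%:R^-1 *: z k w + (k.+1%:R / k.+2%:R) *: y k w.
Proof. exact: run_x run k w. Qed.

Let xinit w : x 0 w = x0. Proof. exact: run_init run w. Qed.

Lemma run_in k w : (k <= N.+1)%N -> X (x k w).
Proof. exact: (@iterate_in _ _ _ _ Xcvx _ _ _ x0P _ _ _ (x^~ w) (y^~ w) (z^~ w) (xinit w) (yP w) (zP w) (xS w)). Qed.

Lemma run_y_in k w : (k <= N)%N -> X (y k w).
Proof. by move=> kN; have [] := yP w kN. Qed.

Let prox_pos k : 0 < 2 * prox_coef L k.
Proof. by rewrite prox_coefE mulr_gt0// divr_gt0 ?sqrtr_gt0// ltr0n. Qed.

Let lam_scvx : strongly_convex_on X L (fun v => L / sd * dprox v).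
Proof. exact: scaled_prox_scvx. Qed.

Let seen_grad k : (k <= N)%N -> seen k (x k) -> seen k.+1 (g^~ k).
Proof.
move=> kN sx.
have sn : seen k.+1 (batch_noise m xs G GPsi x k).
  have kn := batch_noise_known iidZ Xcl oracle (leq_ltn_trans kN (ltnSn N)) (fun w => run_in w (leqW kN)) sx.
  by move=> j; have [] := kn j.
have sG : seen k.+1 (fun w => G (x k w)).
  apply: (@seen_mono k) => // j.
  exact: (gradient_measurable Xcl oracle (fun w => run_in w (leqW kN)) (measurable_rV sx)).
have -> : g^~ k = (fun w => batch_noise m xs G GPsi x k w + G (x k w)).
  by apply/funext => w; rewrite -batch_noiseE// subrK.
exact: seenD.
Qed.

Let seen_y k : (k <= N)%N -> seen k (x k) -> seen k.+1 (y k).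
Proof.
move=> kN sx; have sq : seen k.+1 (fun w => g w k - (2 * prox_coef L k) *: x k w).
  by apply: seenB; [exact: seen_grad|apply: seenZ; exact: seen_mono sx].
apply: (seen_lipschitz sq (C := (2 * prox_coef L k)^-1)) => w w'.
exact: (argmin_linear_lipschitz (prox_pos k) Xcvx
  (@strongly_convex_sqr _ _ X (prox_coef L k) 0) (prox_argminE (yP w kN)) (prox_argminE (yP w' kN))).
Qed.

Let seen_z k : (k <= N)%N -> (forall i, (i <= k)%N -> seen i (x i)) -> seen k.+1 (z k).
Proof.
move=> kN sx; have sq : seen k.+1 (fun w => 2^-1 *: \sum_(i < k.+1) g w i).
  apply: seenZ; apply: (@seen_sum _ _ (fun i w => g w i)) => i ik.
  apply: (@seen_mono i.+1) => //; apply: seen_grad; first exact: leq_trans kN.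
  exact: sx.
have zE w := @z_argmin _ _ _ _ _ _ _ (val w) (g w) (x^~ w) (z^~ w) (zP w) k kN.
apply: (seen_lipschitz sq (C := L^-1)) => w w'.
exact: (argmin_linear_lipschitz L0 Xcvx lam_scvx (zE w) (zE w')).
Qed.

Lemma seen_x k : (k <= N.+1)%N -> seen k (x k).
Proof.
elim/ltn_ind: k => -[_ _|k IH kN].
  by have -> : x 0 = (fun=> x0) by [apply/funext => w; exact: xinit]; exact: seen_cst.
have sx i : (i <= k)%N -> seen i (x i).
  by move=> ik; apply: IH; rewrite ?ltnS// (leq_trans ik)// ltnW.
have -> : x k.+1 = (fun w => k.+2%:R^-1 *: z k w + (k.+1%:R / k.+2%:R) *: y k w).
  by apply/funext => w; exact: xS.
by apply: seenD; apply: seenZ; [apply: seen_z|apply: seen_y => //; exact: sx].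
Qed.

Lemma run_x_measurable k : (k <= N.+1)%N ->
  measurable_fun setT (x k : T -> borelV R n).
Proof. by move=> kN; apply: measurable_rV => j; exact: sampleT_measurable (seen_x kN j). Qed.

Lemma run_y_measurable k : (k <= N)%N -> measurable_fun setT (y k : T -> borelV R n).
Proof.
move=> kN; apply: measurable_rV => j.
exact: sampleT_measurable (seen_y kN (seen_x (leqW kN)) j).
Qed.

Let known_in k u v : seen k u -> seen k v -> (forall w, X (u w)) -> (forall w, X (v w)) ->
  known N.+1 m xs k (fun w => u w - v w).
Proof.
move=> su sv Xu Xv; have [B B0 XB] := bounded_norm2 Xbnd.
apply: (known_at_bounded (B := B + B)); first exact: seenB.
by move=> w; apply: (le_trans (ler_norm2D _ _)); rewrite norm2N lerD// XB.
Qed.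

(** One integrable [rhs] serves every [v] at each outcome, so an infimum over [v] can be taken at a
    random dual point before any expectation. *)
Lemma run_gap_bound : exists2 rhs : T -> R,
  P.-integrable setT (EFin \o rhs) /\
  \int[P]_w rhs w <= (2 - Num.sqrt 2) / 4 * (L / sd * D) +
    N.+1%:R * Num.sqrt N.+1%:R / Num.sqrt 2 / L * (sigma ^+ 2 / m%:R) &
  forall w v, X v -> N.+1%:R / 2 * F (y N w) <= L / sd * D +
    2^-1 * (\sum_(i < N.+1) (F (x i w) + dot (G (x i w)) (v - x i w))) + rhs w.
Proof.
have lc : {within X, continuous (fun v => L / sd * dprox v)}.
  by move=> v; apply: cvgMr; exact: d_cont.
have [yb ybm] := argmin_prox_exists x0 (G x0) (prox_coef L 0) X0 Xbnd Xcl.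
have [zb0 zb0m] := argmin_linear_exists (2^-1 *: G x0) X0 Xbnd Xcl lc.
have [zz zzm] := argmin_linear_exists
  (2^-1 *: (G x0 + G (2^-1 *: zb0 + 2^-1 *: yb))) X0 Xbnd Xcl lc.
(* [zb] is chosen outcome by outcome; stability of the minimiser makes it measurable at time [N] in
   [szb]. *)
have /choice[zb zbm] w : exists v, is_argmin X (fun v => L / sd * dprox v +
    dot (2^-1 *: \sum_(i < N.+1) G (x i w)) v) v by exact: argmin_linear_exists.
pose cost k := (comparator_cost R N k + step_cost R k) / L.
pose dir k w := comparator_dir G L x0 N (g w) (x^~ w) zz (zb w) k +
                step_dir x0 (x^~ w) (y^~ w) yb k.
have nE k w : noise G (g w) (x^~ w) k = batch_noise m xs G GPsi x k w.
  by rewrite /noise -batch_noiseE.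
have Xx k w : (k <= N)%N -> X (x k w) by move=> kN; exact: run_in (leqW kN).
have Xx0 : X x0 by case: x0P.
have sx k : (k <= N)%N -> seen k (x k) by move=> kN; exact: seen_x (leqW kN).
have szb : seen N zb.
  have sq : seen N (fun w => 2^-1 *: \sum_(i < N.+1) G (x i w)).
    apply: seenZ; apply: (@seen_sum _ _ (fun i w => G (x i w))) => i iN.
    apply: (@seen_mono i) => // j.
    exact: (gradient_measurable Xcl oracle (fun w => Xx i w iN) (measurable_rV (sx i iN))).
  apply: (seen_lipschitz sq (C := L^-1)) => w w'.
  exact: (argmin_linear_lipschitz L0 Xcvx lam_scvx (zbm w) (zbm w')).
have kdir k : (k < N.+1)%N -> known N.+1 m xs k (dir k).
  move=> kN; apply: known_atD; last first.
    case: k kN => [_|k kN] /=.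
      apply: known_atZ; apply: known_in; try exact: seen_cst; try by [].
      by move=> _; case: ybm.
    apply: known_atZ; apply: known_in.
    - exact: (seen_y (ltnW kN) (sx _ (ltnW kN))).
    - exact: sx.
    - by move=> w; exact: run_y_in (ltnW kN).
    - by move=> w; exact: Xx.
  rewrite /comparator_dir; case: eqVneq => [kNE|kNN].
    apply: known_atZ; apply: known_in; rewrite ?kNE//; first exact: sx.
      by move=> w; case: (zbm w).
    by move=> w; exact: Xx.
  case: eqVneq => _.
    apply: known_atZ; apply: known_in; try exact: seen_cst; try by [].
    by move=> _; case: zzm.
  apply: known_atD.
    apply: known_atZ; apply: known_in; try exact: seen_cst; try by [].
      exact: sx.
    by move=> w; exact: Xx.
  apply: known_atZ; apply: (@known_at_sum _ _ _ _ _ _ _ _ _ k 0 k (fun j w => noise G (g w) (x^~ w) j)) => j jk.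
  have -> : (fun w => noise G (g w) (x^~ w) j) = batch_noise m xs G GPsi x j.
    by apply/funext => w; exact: nE.
  have jN : (j < N.+1)%N by exact: ltn_trans kN.
  apply: (known_at_mono (k := j.+1) (i := 0%N)); first by rewrite leqnn andbT orbC -leq_eqVlt.
  exact: (batch_noise_known iidZ Xcl oracle jN (fun w => Xx j w jN) (sx j jN)).
have cost0 k : (k < N.+1)%N -> 0 <= cost k.
  by move=> _; rewrite divr_ge0 ?(ltW L0)// addr_ge0 ?step_cost_ge0 ?comparator_cost_ge0.
have [irhs Erhs] := noise_expectation iidZ m0 Xcl oracle ((2 - Num.sqrt 2) / 4 * (L / sd * D))
  (fun k kN w => Xx k w kN) (fun k j kN => sx k kN j) cost0 kdir.
eexists; first (split; first exact: irhs).
  apply: (le_trans Erhs); rewrite lerD2l ler_wpM2r ?divr_ge0 ?sqr_ge0//.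
  rewrite -mulr_suml ler_wpM2r ?invr_ge0 ?(ltW L0)//; exact: noise_budget.
move=> w v Xv.
have := pathwise_bound (V := val w) (g := g w) (x := x^~ w) (y := y^~ w) (z := z^~ w)
  Xcvx L0 gradient_le_F descent sd0 d_scvx x0P d_x0 d_le
  (xinit w) (yP w) (zP w) (xS w) (zbm w) Xv.
have := total_noise_le (V := val w) (g := g w) (x := x^~ w) (y := y^~ w) (z := z^~ w)
  Xcvx L0 sd0 d_scvx x0P d_x0 d_le
  (xinit w) (yP w) (zP w) (xS w) G_lipschitz ybm zb0m zzm (zbm w).
have -> : \sum_(k < N.+1) (dot (noise G (g w) (x^~ w) k)
    (comparator_dir G L x0 N (g w) (x^~ w) zz (zb w) k + step_dir x0 (x^~ w) (y^~ w) yb k) +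
    (comparator_cost R N k + step_cost R k) / L * norm2 (noise G (g w) (x^~ w) k) ^+ 2) =
  \sum_(k < N.+1) (dot (batch_noise m xs G GPsi x k w) (dir k w) +
     cost k * norm2 (batch_noise m xs G GPsi x k w) ^+ 2).
  by apply: eq_bigr => k _; rewrite nE.
lra.
Qed.

End Run.

(** Continuity relative to [U] gives the lower modulus required by [measurable_of_modulus], because
    every value [u w] lies in [U]. *)
Lemma measurable_within (R : realType) (d : measure_display) (T : measurableType d)
    (n : nat) (U : set 'rV[R]_n) (Q : 'rV[R]_n -> R) (u : T -> 'rV[R]_n) :
  {within U, continuous Q} -> (forall w, U (u w)) ->
  measurable_fun setT (u : T -> borelV R n) -> measurable_fun setT (fun w => Q (u w)).
Proof.
move=> cQ Uu mu; apply: (measurable_of_modulus mu) => w0 e e0.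
have [W oW QW] : exists2 W, open W & W `&` U = Q @^-1` [set t | Q (u w0) - e < t] `&` U.
  have oQ := (continuousP (Q : subspace U -> R)).1 cQ _ (@open_gt _ (Q (u w0) - e)).
  exact: (open_subspaceP _ _).1 oQ.
have [_ Ww0] : (U `&` W) (u w0).
  by rewrite setIC QW; split => //=; rewrite ltrBlDr ltrDl.
have [dl dl0 H] := (open_norm2P W).1 oW _ Ww0.
exists dl => // w /H Ww; have : (W `&` U) (u w) by split.
by rewrite QW => -[].
Qed.

Theorem theorem1 (R : realType) (n p q : nat)
  (* primal feasible set and smooth part *)
  (X : set 'rV[R]_n) (f : 'rV[R]_n -> R) (gradf : 'rV[R]_n -> 'rV[R]_n) (Lf : R)
  (X0 : X !=set0) (Xbnd : bounded_set X) (Xcl : closed X) (Xcvx : convex_set X)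
  (fcvx : convex_function X f)
  (fgrad : forall x, X x -> is_gradient_on X f x (gradf x))
  (Lf0 : 0 <= Lf)
  (fLip : forall x y, X x -> X y ->
     norm2 (gradf x - gradf y) <= Lf * norm2 (x - y))
  (* max-type nonsmooth part *)
  (U : set 'rV[R]_p) (A : {linear 'rV[R]_n -> 'rV[R]_p}) (Q : 'rV[R]_p -> R)
  (U0 : U !=set0) (Ubnd : bounded_set U) (Ucl : closed U) (Ucvx : convex_set U)
  (Qcont : {within U, continuous Q}) (Qcvx : convex_function U Q)
  (* smoothing function *)
  (om : 'rV[R]_p -> R) (som : R)
  (om_cont : {within U, continuous om}) (som0 : 0 < som)
  (om_scvx : strongly_convex_on U som om)
  (om_ge0 : forall u, U u -> 0 <= om u)
  (om_min : exists2 u, U u & om u = 0)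
  (umu : R -> 'rV[R]_n -> 'rV[R]_p)
  (umuP : forall mu x, 0 < mu ->
     is_argmax U (fun u => dot (A x) u - Q u - mu * om u) (umu mu x))
  (* prox-function *)
  (dprox : 'rV[R]_n -> R) (sd D : R) (x0 : 'rV[R]_n)
  (d_cont : {within X, continuous dprox}) (sd0 : 0 < sd)
  (d_scvx : strongly_convex_on X sd dprox)
  (x0P : is_argmin X dprox x0) (d_x0 : dprox x0 = 0)
  (D0 : 0 < D) (d_le : forall x, X x -> dprox x <= D)
  (* stochastic oracle *)
  (d : measure_display) (T : measurableType d) (P : probability T R)
  (xi : {RV P >-> borelV R q})
  (gradpsi : R -> 'rV[R]_n -> 'rV[R]_n)
  (psi_grad : forall mu x, 0 < mu -> X x ->
     is_gradient_on X (psi_mu f U A Q om mu) x (gradpsi mu x))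
  (Psi : R -> 'rV[R]_n -> 'rV[R]_q -> R)
  (GPsi : R -> 'rV[R]_n -> 'rV[R]_q -> 'rV[R]_n)
  (sigma : R) (sigma0 : 0 < sigma)
  (oracleP : forall mu, 0 < mu ->
     stochastic_oracle X xi (psi_mu f U A Q om mu) (gradpsi mu) sigma
       (Psi mu) (GPsi mu))
  (nA0 : 0 < opnorm A) (Om0 : 0 < omega_max U om) :
  let nA := opnorm A in
  let Om := omega_max U om in
  let c := 6 - Num.sqrt 2 in
  (* the iterates x, y, z are produced by the algorithm run for k = 0, ..., N
     on the samples xs with the prescribed batch size and smoothing parameter *)
  let is_run (N : nat) (xs : nat -> nat -> {RV P >-> borelV R q})
      (x y z : nat -> T -> 'rV[R]_n) (m : nat) (mu : R) :=
    [/\ m%:Z = Num.ceil (batch_size_arg nA Om sigma som N),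
        mu = mu_param nA Om sigma som sd D N m,
        iid_copies xi (fun ki : 'I_N.+1 * 'I_m => xs ki.1 ki.2)
      & nesterov_run X dprox sd (lip_psi_mu A Lf som mu) x0 (Psi mu) (GPsi mu)
          N m (fun k i => xs k i) x y z] in
  let gap (N : nat) (mu : R) (x y : nat -> T -> 'rV[R]_n) (w : T) : R :=
    let xhat := y N w in
    let uhat := \sum_(i < N.+1) N.+1%:R^-1 *: umu mu (x i w) in
    psi f U A Q xhat - phi X f A Q uhat in
  (forall N xs x y z m mu, is_run N xs x y z m mu ->
     [/\ forall w, X (y N w),
         forall w, U (\sum_(i < N.+1) N.+1%:R^-1 *: umu mu (x i w)),
         P.-integrable setT (EFin \o gap N mu x y)
       & (0 <= 'E_P[gap N mu x y] <=
           (2 * nA * Num.sqrt (c * D * Om) / Num.sqrt (N.+1%:R * sd * som)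
            + c * Lf * D / (N.+1%:R * sd))%:E)%E]) /\
  (forall eps : R, 0 < eps ->
     exists N : nat,
       N.+1%:Z = Num.ceil (4 * c * D * Om * nA ^+ 2 / (sd * som) * (1 / eps ^+ 2)
                           + 2 * c * Lf * D / sd * (1 / eps)) /\
       forall xs x y z m mu, is_run N xs x y z m mu ->
         ('E_P[gap N mu x y] <= eps%:E)%E).
Proof.
move=> nA Om c is_run gap.
have c0 : 0 < c by have /andP[_ h] := sqrt2_bounds R; rewrite /c; lra.
have main N xs x y z m mu : is_run N xs x y z m mu ->
    [/\ forall w, X (y N w),
         forall w, U (\sum_(i < N.+1) N.+1%:R^-1 *: umu mu (x i w)),
         P.-integrable setT (EFin \o gap N mu x y)
       & (0 <= 'E_P[gap N mu x y] <=
           (2 * nA * Num.sqrt (c * D * Om) / Num.sqrt (N.+1%:R * sd * som)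
            + c * Lf * D / (N.+1%:R * sd))%:E)%E].
  move=> [mE muE iid run].
  have mP : batch_size_arg nA Om sigma som N <= m%:R.
    by rewrite -[m%:R]/(m%:Z%:~R) mE ceil_ge.
  have m0 : (0 < m)%N.
    rewrite -(ltr0n R); apply: lt_le_trans mP.
    by rewrite divr_gt0 ?mulr_gt0 ?exprn_gt0 ?sqrtr_gt0 ?ltr0n.
  have mu0 : 0 < mu by rewrite muE; exact: mu_param_gt0.
  pose L := lip_psi_mu A Lf som mu; pose F := psi_mu f U A Q om mu.
  pose G := gradpsi mu; pose u := umu mu.
  have uP x' := umuP mu x' mu0.
  have gF x' (Xx : X x') := psi_grad mu x' mu0 Xx.
  have L0 : 0 < L by exact: lip_psi_mu_gt0.
  have S1 := psi_mu_gradient_le Xcvx fcvx fgrad fLip Ucvx Qcvx som0 om_scvx nA0 mu0 uP gF.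
  have S2 := psi_mu_descent Xcvx fcvx fgrad fLip Ucvx Qcvx som0 om_scvx nA0 mu0 uP gF.
  have S3 := gradient_psi_mu_lipschitz Xcvx fcvx fgrad fLip Ucvx Qcvx som0 om_scvx nA0
    mu0 uP gF.
  have Xx k w : (k <= N)%N -> X (x k w) by move=> kN; exact: (run_in Xcvx x0P run w (leqW kN)).
  have Xy w : X (y N w) by exact: (run_y_in run w (leqnn N)).
  have model w := average_linear_model Xcvx fcvx fgrad fLip Ucvx Qcvx som0 om_scvx om_ge0
    nA0 mu0 uP gF (x := x^~ w) (fun i => Xx i w).
  pose uhat w := \sum_(i < N.+1) N.+1%:R^-1 *: u (x i w).
  have Uu w : U (uhat w) by have [] := model w.
  have [rhs [irhs Erhs] rhsP] := run_gap_bound iid m0 X0 Xbnd Xcl Xcvx L0 S1 S2 S3 d_cont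
    sd0 d_scvx x0P d_x0 d_le (oracleP mu mu0) run.
  (* Integrable majorant of the gap: the smoothing error, plus the prox and noise terms of the
     trajectory bound after division by [(N+1)/2]. *)
  pose B w := (mu * Om + 2 / N.+1%:R * (L / sd * D)) + 2 / N.+1%:R * rhs w.
  have gapB w : gap N mu x y w <= B w.
    have h2 : 0 < N.+1%:R / 2 :> R by rewrite divr_gt0 ?ltr0n.
    have hF : F (y N w) - 2 / N.+1%:R * (L / sd * D + rhs w) <= phi X f A Q (uhat w).
      apply: phi_ge => // v Xv; rewrite -(ler_pM2l h2).
      have := rhsP w v Xv; have [_ /(_ v Xv)] := model w.
      have -> : N.+1%:R / 2 * (F (y N w) - 2 / N.+1%:R * (L / sd * D + rhs w)) =
        N.+1%:R / 2 * F (y N w) - (L / sd * D + rhs w).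
        by field; rewrite nat1r pnatr_eq0 gt_eqF.
      rewrite -/(uhat w) /F; lra.
    have := psi_le_psi_mu f U0 Ubnd Ucl om_cont mu0 uP (y N w).
    move: hF; rewrite /gap /B /F -/(uhat w) -/Om; set r := 2 / N.+1%:R; clearbody r.
    by lra.
  have gap0 w : 0 <= gap N mu x y w.
    rewrite subr_ge0.
    exact: (weak_duality X0 Xbnd Xcvx fcvx fgrad Lf0 fLip U0 Ubnd Ucl Qcont nA0
      (Xy w) (Uu w)).
  have mx k : (k <= N)%N -> measurable_fun setT (x k : T -> borelV R n).
    move=> kN; exact: (run_x_measurable iid m0 Xcl Xcvx L0 sd0 d_scvx x0P (oracleP mu mu0) run (leqW kN)).
  have my : measurable_fun setT (y N : T -> borelV R n).
    exact: (run_y_measurable iid m0 Xcl Xcvx L0 sd0 d_scvx x0P (oracleP mu mu0) run (leqnn N)).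
  have mu_x i j : (i <= N)%N -> measurable_fun setT (fun w => u (x i w) 0 j).
    move=> iN.
    apply: (measurable_rV_of_lipschitz (mx i iN) (C := (mu * som)^-1 * opnorm A)) => w w'.
    apply: (le_trans (umu_lipschitz Ucvx Qcvx som0 om_scvx mu0 uP _ _)).
    by rewrite -mulrA ler_wpM2l ?opnorm_bound// invr_ge0 mulr_ge0// ltW.
  have muhat : measurable_fun setT (uhat : T -> borelV R p).
    apply: measurable_rV => j.
    rewrite (_ : (fun w => uhat w 0 j) =
      (fun w => \sum_(i < N.+1) N.+1%:R^-1 * u (x i w) 0 j)); last first.
      by apply/funext => w; rewrite summxE; apply: eq_bigr => i _; rewrite mxE.
    by apply: measurable_sum => i; apply: measurable_funM => //; exact: mu_x (ltn_ord i).
  have mgap : measurable_fun setT (gap N mu x y).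
    have [C1 _ H1] := lipschitz_psi X0 Xbnd Xcvx fcvx fgrad Lf0 fLip U0 Ubnd Ucl Qcont nA0.
    have [C2 _ H2] := lipschitz_phi X0 Xbnd Xcvx fcvx fgrad Lf0 fLip Q Ubnd nA0.
    (* [Q] is added and subtracted so that each summand is either Lipschitz in the iterates or
       covered by [measurable_within]. *)
    rewrite (_ : gap N mu x y = (fun w => psi f U A Q (y N w) -
      (phi X f A Q (uhat w) + Q (uhat w)) + Q (uhat w))); last first.
      by apply/funext => w; rewrite /gap -/(uhat w); ring.
    apply: measurable_funD; last exact: measurable_within Qcont Uu muhat.
    apply: measurable_funB.
      by apply: (measurable_of_lipschitz my (C := C1)) => w w'; exact: H1.
    by apply: (measurable_of_lipschitz muhat (C := C2)) => w w'; exact: H2.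
  have iB : P.-integrable setT (EFin \o B).
    apply: integrable_EFinD; last exact: integrable_EFinZ.
    exact: finite_measure_integrable_cst.
  have igap : P.-integrable setT (EFin \o gap N mu x y).
    apply: le_integrable iB => //; first exact/measurable_EFinP.
    by move=> w _; rewrite /= lee_fin !ger0_norm// (le_trans (gap0 w)).
  split => //; apply/andP; split; first exact: expectation_ge0.
  rewrite unlock; apply: (@le_trans _ _ (\int[P]_w (B w)%:E)%E).
    by apply: le_integral => // w _; rewrite lee_fin.
  rewrite -[leLHS]fineK ?integrable_fin_num// lee_fin -/(Rintegral _ _ _).
  rewrite /B RintegralD//; [|exact: finite_measure_integrable_cst|exact: integrable_EFinZ].
  rewrite Rintegral_cst//= probability_setT mulr1 RintegralZl//.
  have := rate_bound nA0 Om0 sigma0 som0 sd0 D0 Lf0 m0 mP.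
  rewrite -muE -/(lip_psi_mu A Lf som mu) -/L => H; apply: le_trans H.
  have := ler_wpM2l (_ : 0 <= 2 / N.+1%:R) Erhs; rewrite divr_ge0// => /(_ isT).
  rewrite /Om; set r := 2 / N.+1%:R; set t := _ / L * (sigma ^+ 2 / _).
  by clearbody r t; lra.
split=> [|eps eps0]; first exact: main.
set arg := (4 * c * D * Om * nA ^+ 2 / (sd * som) * (1 / eps ^+ 2) +
            2 * c * Lf * D / sd * (1 / eps)).
have arg0 : 0 < arg.
  rewrite ltr_pwDl//.
    by rewrite !(mulr_gt0, invr_gt0, exprn_gt0).
  by rewrite !(mulr_ge0, invr_ge0)// ltW.
have ceil0 : 0 < Num.ceil arg by rewrite ceil_gt0.
(* [arg] is positive, so its ceiling is at least 1 and the predecessor is undone by [.+1]. *)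
exists `|Num.ceil arg|%N.-1.
have NE : `|Num.ceil arg|%N.-1.+1%:Z = Num.ceil arg.
  by rewrite prednK ?absz_gt0 ?gt_eqF// gtz0_abs.
split => // xs x y z m mu runN; have [_ _ _ /andP[_ H]] := main _ _ _ _ _ _ _ runN.
apply: (le_trans H); rewrite lee_fin.
set M := _.-1.+1 in NE *.
have MP : arg <= M%:R by rewrite -[M%:R]/(M%:Z%:~R) NE ceil_ge.
(* With [b = c * Lf * D / sd], the sum [a^2 / eps^2 + 2 b / eps] is exactly the argument of the
   ceiling. *)
pose a := 2 * nA * Num.sqrt (c * D * Om) / Num.sqrt (sd * som).
have := @iteration_bound R a (c * Lf * D / sd) eps M (ltn0Sn _) eps0.
have -> : a ^+ 2 / eps ^+ 2 + 2 * (c * Lf * D / sd) / eps = arg.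
  rewrite /a /arg !(exprMn, exprVn) !sqr_sqrtr ?mulr_ge0 ?ltW//.
  by field; rewrite !gt_eqF.
move=> /(_ MP) => H2; apply: le_trans H2.
rewrite lerD// le_eqVlt; apply/orP; left; apply/eqP.
  rewrite (_ : Num.sqrt (M%:R * sd * som) = Num.sqrt M%:R * Num.sqrt (sd * som)).
    by rewrite /a invfM; ring.
  by rewrite -sqrtrM ?ler0n// mulrA.
by rewrite invfM; ring.
Qed.
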